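(* Let $B$ be a language in $({\rm NP}\cap \mathrm{coNP})\cap \mathrm{NEXPD}$. Then for every well sub-polynomial function $g:\mathbb{N}\to\mathbb{N}$, ${\rm NEXP}\not\subseteq {\rm NP}_{\rm T}({\rm P}_{g(n)\text{-}{\rm T}}({\rm NP})\cap \wp(B))$.
   Context: ${\rm NEXP}=\bigcup_{c\ge 1}\mathrm{NTIME}(2^{n^c})$. For a language $A\subseteq\{0,1\}^*$, $A^{\le n}$ is the set of its strings of length at most $n$. $\mathrm{NEXPD}$ is the class of languages $A$ such that for every constant $c>0$, $|A^{\le n}|<2^{n^c}$ for infinitely many integers $n$. A function $f$ is sub-polynomial if for every constant $c>0$, $f(n)\le n^c$ for all large $n$; super-polynomial if for every $c>0$, $f(n)\ge n^c$ for all large $n$; time constructible if given $n$, $f(n)$ can be computed in $O(f(n))$ deterministic steps. A function $g$ is well sub-polynomial if $g$ is sub-polynomial, time constructible, and there is a time constructible super-polynomial function $h$ such that for each positive constant $c$, $g(h(n)^c)\le n$ for all sufficiently large $n$. $\wp(B)$ is the power set of $B$ (the class of all subsets of $B$). ${\rm P}_{g(n)\text{-}{\rm T}}({\rm NP})$ is the class of languages reducible to some ${\rm NP}$ language by a polynomial-time (deterministic) Turing reduction that makes at most $g(n)$ queries on inputs of length $n$. For a class $C$, ${\rm NP}_{\rm T}(C)$ is the class of languages reducible to some language in $C$ via polynomial-time nondeterministic Turing reductions. *)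

(* Defs.v *)
From Stdlib Require Import BinNums.
From mathcomp Require Import all_boot all_order all_algebra.
From mathcomp Require Import finmap.
From mathcomp Require Import all_classical all_reals all_analysis.

Set Implicit Arguments.
Unset Strict Implicit.
Unset Printing Implicit Defensive.

Import Order.TTheory GRing.Theory Num.Theory.

Local Open Scope classical_set_scope.
Local Open Scope nat_scope.

Definition language : Type := set (seq bool).

(* The model is the multitape Turing machine with two-way infinite tapes over
   {0, 1, blank}. A machine with a larger tape alphabet is simulated step by
   step, without slowdown, by spending several tapes on each of its tapes. *)

(* [None] is the blank. *)
Definition symbol : Type := option bool.

(* The head scans the first symbol of [right_of], and [left_of] lists the cells
   to its left, nearest first; all the cells that are not listed are blank. *)
Record tape := Tape { left_of : seq symbol; right_of : seq symbol }.

Inductive move := Left | Stay | Right.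

Definition read (t : tape) : symbol := head None (right_of t).

Definition write (s : symbol) (t : tape) : tape :=
  Tape (left_of t) (s :: behead (right_of t)).

Definition shift (m : move) (t : tape) : tape :=
  match m with
  | Left => Tape (behead (left_of t)) (head None (left_of t) :: right_of t)
  | Stay => t
  | Right => Tape (read t :: left_of t) (behead (right_of t))
  end.

(* The string of bits that starts under the head and ends before the first
   blank. *)
Definition word_at (t : tape) : seq bool :=
  pmap id (take (index None (right_of t)) (right_of t)).

(* [delta q a q' b] holds when, in state [q] and scanning the symbols [a], the
   machine may go to state [q'], write the symbols of [b] and then move its
   heads as [b] says. It halts when it has no such choice. *)
Record machine := Machine {
  state : finType;
  last_tape : nat;
  start : state;
  accepting : pred state;
  delta : state -> {ffun 'I_last_tape.+1 -> symbol} ->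
          state -> {ffun 'I_last_tape.+1 -> symbol * move} -> bool }.

Definition deterministic (M : machine) : Prop :=
  forall (q : state M) a q1 b1 q2 b2,
    delta q a q1 b1 -> delta q a q2 b2 -> q1 = q2 /\ b1 = b2.

Definition config (M : machine) : Type :=
  (state M * {ffun 'I_(last_tape M).+1 -> tape})%type.

Definition init (M : machine) (x : seq bool) : config M :=
  (start M, [ffun i => Tape [::] (if i == ord0 then map Some x else [::])]).

Definition step (M : machine) (c c' : config M) : Prop :=
  exists2 b, delta c.1 [ffun i => read (c.2 i)] c'.1 b
           & c'.2 = [ffun i => shift (b i).2 (write (b i).1 (c.2 i))].

(* When [query q = Some k], the state [q] asks the oracle about the word at the
   head of the last tape; the state is [k true] or [k false] after one step,
   according to the answer, and the tapes do not change. *)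
Record oracle_machine := OracleMachine {
  base :> machine;
  query : state base -> option (bool -> state base) }.

Definition oracle_step (M : oracle_machine) (O : language) (c c' : config M) :
    Prop :=
  if query c.1 is Some k
  then c' = (k (word_at (c.2 ord_max) \in O), c.2)
  else step c c'.

Fixpoint computation (T : Type) (next : T -> T -> Prop) (c : T) (s : seq T) :
    Prop :=
  if s is c' :: s' then next c c' /\ computation next c' s' else True.

Definition bigO (u t : nat -> nat) : Prop :=
  exists a, \forall n \near \oo, u n <= a * t n.

Definition accepts (M : machine) (next : config M -> config M -> Prop)
    (x : seq bool) : Prop :=
  exists2 s, computation next (init M x) s
           & accepting (last (init M x) s).1.

(* All the computations on every input halt within the time bound, whether they
   accept or not. *)
Definition runs_in_time (M : machine) (next : config M -> config M -> Prop)
    (t : nat -> nat) : Prop :=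
  exists2 u, bigO u t
           & forall x s, computation next (init M x) s -> size s <= u (size x).

Definition decides_in_time (M : machine) (next : config M -> config M -> Prop)
    (L : language) (t : nat -> nat) : Prop :=
  (forall x, L x <-> accepts next x) /\ runs_in_time next t.

Definition NTIME (t : nat -> nat) : set language :=
  [set L | exists M : machine, decides_in_time (@step M) L t].

Definition NP : set language := \bigcup_c NTIME (fun n => n ^ c).

Definition coNP : set language := [set L | NP (~` L)].

Definition NEXP : set language :=
  \bigcup_(c in [set c | 1 <= c]) NTIME (fun n => 2 ^ (n ^ c)).

Definition NP_T (C : set language) : set language :=
  [set L | exists2 A, C A &
     exists (M : oracle_machine) (c : nat),
       decides_in_time (@oracle_step M A) L (fun n => n ^ c)].

(* Each configuration in a query state makes exactly one query. *)
Definition makes_at_most_queries (M : oracle_machine) (O : language)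
    (g : nat -> nat) : Prop :=
  forall x s, computation (@oracle_step M O) (init M x) s ->
    count (fun c : config M => query c.1) (init M x :: s) <= g (size x).

Definition P_T (g : nat -> nat) (C : set language) : set language :=
  [set L | exists2 A, C A &
     exists (M : oracle_machine) (c : nat),
       [/\ deterministic M,
           decides_in_time (@oracle_step M A) L (fun n => n ^ c)
         & makes_at_most_queries M A g]].

Definition power_set (B : language) : set language := [set A | A `<=` B].

Definition upto (A : language) (n : nat) : set (seq bool) :=
  [set x | A x /\ size x <= n].

(* [fset_set], used to count [upto A n], is meaningful on finite sets only. *)
Lemma finite_upto (A : language) (n : nat) : finite_set (upto A n).
Proof.
apply: (@sub_finite_set _ _ (range (fun t : n.-bseq bool => t : seq bool))).
  by move=> x [_ xn]; exists (Bseq xn).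
exact: finite_image.
Qed.

Definition NEXPD (R : realType) : set language :=
  [set A | forall c : R, (0 < c)%R ->
     infinite_set
       [set n | (#|` fset_set (upto A n)|%:R < 2 `^ (n%:R `^ c))%R]].

Definition sub_polynomial (R : realType) (f : nat -> nat) : Prop :=
  forall c : R, (0 < c)%R -> \forall n \near \oo, ((f n)%:R <= n%:R `^ c)%R.

Definition super_polynomial (R : realType) (f : nat -> nat) : Prop :=
  forall c : R, (0 < c)%R -> \forall n \near \oo, (n%:R `^ c <= (f n)%:R)%R.

Fixpoint positive_bits (p : positive) : seq bool :=
  match p with
  | xH => [:: true]
  | xO p' => rcons (positive_bits p') false
  | xI p' => rcons (positive_bits p') true
  end.

(* Most significant bit first, without leading zeros; [binary 0 = [::]]. *)
Definition binary (n : nat) : seq bool :=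
  if bin_of_nat n is Npos p then positive_bits p else [::].

(* The argument is given in binary: a sub-polynomial time bound does not leave
   the time to read it in unary. The result is also in binary, at the head of
   the last tape. *)
Definition time_constructible (f : nat -> nat) : Prop :=
  exists2 M : machine, deterministic M &
    exists2 u, bigO u f &
      forall n, exists s,
        let c := last (init M (binary n)) s in
        [/\ computation (@step M) (init M (binary n)) s,
            forall c', ~ step c c',
            size s <= u n
          & word_at (c.2 ord_max) = binary (f n)].

Definition well_sub_polynomial (R : realType) (g : nat -> nat) : Prop :=
  [/\ sub_polynomial R g,
      time_constructible g
    & exists h : nat -> nat,
        [/\ time_constructible h,
            super_polynomial R h
          & forall c, 0 < c -> \forall n \near \oo, g (h n ^ c) <= n]].

(* Main.v *)
(* Suppose that NEXP is contained in NP_T(P_g-T(NP) /\ P(B)). First, NEXP is then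
   contained in NP_T(P_g-T(NP)), so that the complement of a NEXP language S, after a
   polynomial padding x |-> x 0^(n^k - n), is a language T in NEXP: an exponential
   search decides any language of NP_T(P_g-T(NP)). Second, T is itself accepted by a
   polynomial-time machine M0 with an oracle A in B, where A is decided by M1 with at
   most g queries to a language D in NP. At a length m where B is sparse there are at
   most |B^{<= m}| 2^g = 2^o(n) pairs of a word of B and a pattern of answers of M1 on
   this word whose positive answers are witnessed by runs of the machine for D. If the
   number of these pairs is known, they can all be guessed; the true pattern for a word
   is then the greatest in lexicographic order, which gives A exactly and hence decides
   T on that padded length in nondeterministic time 2^O(n). The language S reads the
   machines, the lengths and the number of pairs from the bits of its input x and does
   this, so that on a suitable x it accepts x if and only if T accepts the padded x,
   that is, if and only if S rejects x.

   Both languages are given by bounded arithmetic formulas that have one guessed set W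
   of numbers below 2^n; a single construction puts all of them in NEXP. *)
Require Import Defs.
From HB Require Import structures.
From mathcomp Require Import all_boot all_order all_algebra.
From mathcomp Require Import finmap.
From mathcomp Require Import all_classical all_reals all_analysis.
From mathcomp Require Import zify.

Set Implicit Arguments.
Unset Strict Implicit.
Unset Printing Implicit Defensive.

Import Order.TTheory GRing.Theory Num.Theory.

Local Open Scope classical_set_scope.
Local Open Scope nat_scope.

(** The order of the choices is the obstacle: T is built from S, and [M0], [M1] exist only once T is
    fixed, so S cannot mention them. Hence S is universal, and all the advice is one number whose
    bits form [x]. A count is enough as advice: nothing certifies directly that a guessed list of
    pairs is complete, but distinct valid pairs in the exact total number must be all of them. The
    two formulas code runs differently. For T, numbers go up to [2 ^ (n ^ k)], so a whole run is a
    number and quantifiers over runs are bounded; negations and exact oracle answers are then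
    harmless. For S, numbers stay below [2 ^ n], too small for a run of polynomial length: runs have
    to be slices of [W], where a negative answer has no witness. This is what forces patterns and
    their comparison. Every address in [W] must be below [2 ^ n]. With [s = n %/ r] there are at
    most [2 ^ s * 2 ^ s] pairs, all addresses are bounded by a fixed polynomial in [2 ^ (2 * s)],
    and [r] is chosen from its degree. *)

(** * Transition systems and bisimulation *)

Definition halts_within (T : Type) (next : T -> T -> Prop) (x : T) (n : nat) :=
  forall s, computation next x s -> size s <= n.

Definition reaches (T : Type) (next : T -> T -> Prop) (fin : T -> bool) (x : T) :=
  exists2 s, computation next x s & fin (last x s).

Lemma halts_step (T : Type) (next : T -> T -> Prop) x n :
  (forall y, next x y -> halts_within next y n) -> halts_within next x n.+1.
Proof. by move=> h [|y s] //= [xy sy]; rewrite ltnS; apply: h sy. Qed.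

Lemma halts_le (T : Type) (next : T -> T -> Prop) x m n :
  m <= n -> halts_within next x m -> halts_within next x n.
Proof. by move=> mn h s /h sm; exact: leq_trans mn. Qed.

Lemma reaches_step (T : Type) (next : T -> T -> Prop) fin x :
  ~~ fin x ->
  reaches next fin x <-> exists2 y, next x y & reaches next fin y.
Proof.
move=> nx; split=> [[[|y s] /= xs fs]|[y xy [s ys fs]]].
- by rewrite fs in nx.
- by case: xs => xy ys; exists y => //; exists s.
- by exists (y :: s).
Qed.

Section Bisimulation.
Variables (T U : Type) (nextT : T -> T -> Prop) (nextU : U -> U -> Prop).
Variables (finT : T -> bool) (finU : U -> bool) (R : T -> U -> Prop).
Hypothesis forth : forall x y x', R x y -> nextT x x' ->
  exists2 y', nextU y y' & R x' y'.
Hypothesis back : forall x y y', R x y -> nextU y y' ->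
  exists2 x', nextT x x' & R x' y'.
Hypothesis finR : forall x y, R x y -> finT x = finU y.

Lemma bisim_halts x y n : R x y -> halts_within nextU y n -> halts_within nextT x n.
Proof.
move=> Rxy h s xs.
suff [s' ys' <-] : exists2 s', computation nextU y s' & size s' = size s.
  exact: h.
elim: s x y Rxy {h} xs => [|x' s IH] x y Rxy /=; first by exists [::].
case=> /(forth Rxy)[y' yy' R'] /(IH _ _ R')[s' c <-].
by exists (y' :: s').
Qed.

Lemma bisim_reaches x y : R x y -> reaches nextT finT x <-> reaches nextU finU y.
Proof.
move=> Rxy; split.
  move=> [s]; elim: s x y Rxy => [|x' s IH] x y Rxy /=.
    by move=> _ f; exists [::] => //=; rewrite -(finR Rxy).
  move=> [/(forth Rxy)[y' yy' R'] c] /(IH _ _ R' c)[s' c' f].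
  by exists (y' :: s').
move=> [s]; elim: s x y Rxy => [|y' s IH] x y Rxy /=.
  by move=> _ f; exists [::] => //=; rewrite (finR Rxy).
move=> [/(back Rxy)[x' xx' R'] c] /(IH _ _ R' c)[s' c' f].
by exists (x' :: s').
Qed.
End Bisimulation.

(** * Assembly programs and their machines *)

(** Positions are absolute, whereas the two lists of a [tape] are relative to the head: a move then
    changes only an integer, and a counter can be kept as the position of a head. *)
Definition cells : Type := int -> symbol.

(* The cell [z] of the tape is the cell at distance [z - p] of its head. *)
Definition represents (t : tape) (f : cells) (p : int) :=
  (forall j, nth None (right_of t) j = f (p + j%:Z)%R) /\
  (forall j, nth None (left_of t) j = f (p - 1 - j%:Z)%R).

Definition put (f : cells) (p : int) (s : symbol) : cells :=
  fun z => if z == p then s else f z.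

Definition moved (m : move) (p : int) : int :=
  match m with Left => (p - 1)%R | Stay => p | Right => (p + 1)%R end.

Lemma represents_read t f p : represents t f p -> read t = f p.
Proof. by move=> [r _]; rewrite /read -nth0 r addr0. Qed.

Lemma represents_step t f p s m : represents t f p ->
  represents (Defs.shift m (write s t)) (put f p s) (moved m p).
Proof.
move=> [r l].
have bl j : nth None (behead (left_of t)) j = f (p - 1 - j.+1%:Z)%R.
  by rewrite nth_behead l.
have br j : nth None (behead (right_of t)) j = f (p + j.+1%:Z)%R.
  by rewrite nth_behead r.
have hl : head None (left_of t) = f (p - 1)%R by rewrite -nth0 l subr0.
case: m; split=> -[|j] /=; rewrite /put ?hl ?bl ?br ?l ?nth_behead ?r;
  try (by case: eqP => // h; lia); try by rewrite ?addr0 ?subr0 ?eqxx.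
2: case: j => [|j] /=; rewrite ?br.
all: case: eqP => [h|h] //; try lia.
all: by apply: (congr1 f); lia.
Qed.

(* [Mark] writes [Some true] on all the tapes but the first two. *)
Inductive instr :=
  | IMove of nat & move
  | IMark
  | IGuess of nat
  | IBranch of nat & pred symbol & nat
  | IJump of nat
  | IFail.

Definition tape_of (i : instr) : nat :=
  match i with IMove i _ | IGuess i | IBranch i _ _ => i | _ => 0 end.

Definition keep (a : nat -> symbol) : nat -> symbol * move :=
  fun j => (a j, Stay).

Definition put_at (i : nat) (s : symbol) (a : nat -> symbol) : nat -> symbol * move :=
  fun j => (if j == i then s else a j, Stay).

Definition outcomes (ins : instr) (pc : nat) (a : nat -> symbol) :
    seq (nat * (nat -> symbol * move)) :=
  match ins with
  | IMove i m => [:: (pc.+1, fun j => (a j, if j == i then m else Stay))]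
  | IMark => [:: (pc.+1, fun j => (if 1 < j then Some true else a j, Stay))]
  | IGuess i => [:: (pc.+1, put_at i (Some true) a); (pc.+1, put_at i (Some false) a)]
  | IBranch i p l => [:: (if p (a i) then pc.+1 else l, keep a)]
  | IJump l => [:: (l, keep a)]
  | IFail => [::]
  end.

Definition store : Type := ((nat -> int) * (nat -> cells))%type.

Definition scan (st : store) (j : nat) : symbol := st.2 j (st.1 j).

Definition act (st : store) (b : nat -> symbol * move) : store :=
  (fun j => moved (b j).2 (st.1 j), fun j => put (st.2 j) (st.1 j) (b j).1).

Definition asm_step (P : seq instr) (x y : nat * store) : Prop :=
  exists i, let os := outcomes (nth IFail P x.1) x.1 (scan x.2) in
    i < size os /\ y = ((nth (0, keep (fun=> None)) os i).1,
                        act x.2 (nth (0, keep (fun=> None)) os i).2).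

Definition last_tape_of (P : seq instr) : nat := \max_(n <- map tape_of P) n.

(** The program counter is the state. Past the end of the program [nth] yields [IFail], so the extra
    state [size P] halts; it is the only accepting one. *)
Definition asm_machine (P : seq instr) : machine :=
  @Machine 'I_(size P).+1 (last_tape_of P) ord0 (fun q => q == size P :> nat)
    (fun q a q' b =>
       let os := outcomes (nth IFail P q) q (fun j => a (inord j)) in
       `[< exists i, [/\ i < size os,
            q' = (nth (0, keep (fun=> None)) os i).1 :> nat &
            b = [ffun j : 'I__ => (nth (0, keep (fun=> None)) os i).2 j]] >]).

Definition jumps_within (n : nat) (i : instr) : bool :=
  match i with IBranch _ _ l | IJump l => l <= n | _ => true end.

Section AsmMachine.
Variable P : seq instr.
Hypothesis jumpsP : all (jumps_within (size P)) P.
Let M := asm_machine P.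

Definition asm_rel (c : config M) (x : nat * store) : Prop :=
  c.1 = x.1 :> nat /\ forall j : 'I_(last_tape M).+1,
    represents (c.2 j) (x.2.2 j) (x.2.1 j).

Lemma asm_next_lt q a i : q < (size P).+1 ->
  let os := outcomes (nth IFail P q) q a in
  i < size os -> (nth (0, keep (fun=> None)) os i).1 < (size P).+1.
Proof.
move=> qP; case: (ltnP q (size P)) => [qs|qs]; last by rewrite nth_default.
have /(all_nthP IFail)/(_ q qs) := jumpsP.
case: (nth IFail P q) => [k m||k|k p l|l|] /= jl; case: i => [|[|i]] //= _.
by case: (p (a k)).
Qed.

(** A [store] has infinitely many tapes and the machine finitely many. An instruction inspects only
    its own tape and treats each other tape separately, so the truncation is invisible. *)
Lemma outcomes_ext (q : nat) (a b : nat -> symbol) :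
  (forall j, j <= last_tape_of P -> a j = b j) ->
  let os := outcomes (nth IFail P q) q in
  size (os a) = size (os b) /\
  forall i, i < size (os a) ->
  let d := (0, keep (fun=> None)) in
  (nth d (os a) i).1 = (nth d (os b) i).1 /\
  forall j, j <= last_tape_of P -> (nth d (os a) i).2 j = (nth d (os b) i).2 j.
Proof.
move=> ab /=; case: (ltnP q (size P)) => [qs|qs]; last by rewrite nth_default.
have : tape_of (nth IFail P q) <= last_tape_of P.
  rewrite -(nth_map _ 0) //; apply: leq_bigmax_seq => //.
  by rewrite mem_nth ?size_map.
case: (nth IFail P q) => [k m||k|k p l|l|] //= kP;
  split=> // -[|[|i]] //= _; split=> //; rewrite /put_at /keep /=;
  try (by move=> j jP; rewrite ab); by rewrite ab.
Qed.

Let rd (c : config M) : nat -> symbol :=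
  fun j => [ffun i => read (c.2 i)] (inord j : 'I_(last_tape M).+1).

Lemma asm_rd c x : asm_rel c x ->
  forall j, j <= last_tape_of P -> rd c j = scan x.2 j.
Proof.
move=> [_ r] j jP; rewrite /rd ffunE; have /represents_read -> := r (inord j).
by rewrite inordK.
Qed.

Lemma asm_forth c x c' : asm_rel c x -> step c c' ->
  exists2 x', asm_step P x x' & asm_rel c' x'.
Proof.
move=> r [b /asboolP[i [ios q' bE]] cE].
have [se ee] := outcomes_ext (c.1 : 'I__) (asm_rd r).
case: r ios q' bE ee => qE r ios q' bE ee.
have [e1 e2] := ee _ ios.
exists (c'.1 : nat, act x.2 (nth (0, keep (fun=> None)) (outcomes (nth IFail P x.1) x.1 (scan x.2)) i).2).
  by exists i; rewrite /= -qE; split; [rewrite -se | rewrite q' e1].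
split=> // j; rewrite cE ffunE bE ffunE /= /act /=.
rewrite -qE -e2; first exact: represents_step.
by rewrite -ltnS ltn_ord.
Qed.

Lemma asm_back c x x' : asm_rel c x -> asm_step P x x' ->
  exists2 c', step c c' & asm_rel c' x'.
Proof.
move=> r [i [ios xE]].
have [se ee] := outcomes_ext (c.1 : 'I__) (asm_rd r).
case: r ee se => qE r ee se.
move: ios xE; rewrite /= -qE -se => ios ->.
have [e1 e2] := ee _ ios.
have lt := asm_next_lt (ltn_ord (c.1 : 'I_(size P).+1)) ios.
pose b := [ffun j : 'I_(last_tape M).+1 =>
  (nth (0, keep (fun=> None)) (outcomes (nth IFail P (c.1 : 'I_(size P).+1))
    (c.1 : 'I_(size P).+1) (rd c)) i).2 j].
exists (Ordinal lt : state M, [ffun j => Defs.shift (b j).2 (write (b j).1 (c.2 j))]).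
  by exists b => //; apply/asboolP; exists i.
split=> /=; first by rewrite -e1.
move=> j; rewrite ffunE /b ffunE e2; last by rewrite -ltnS ltn_ord.
exact: represents_step.
Qed.

Definition input_store (x : seq bool) : store :=
  (fun=> 0%R, fun j z => if (j, z) is (0, Posz k) then nth None (map Some x) k else None).

Lemma asm_init x : asm_rel (init M x) (0, input_store x).
Proof.
split=> // j; rewrite ffunE /=; case: j => [[|j] jP]; split=> k //=;
  by rewrite ?add0r ?sub0r ?nth_nil //; case: k.
Qed.

Lemma asm_accepts x :
  accepts (@step M) x <->
  reaches (asm_step P) (fun y => y.1 == size P) (0, input_store x).
Proof.
have fin (c : config M) (y : nat * store) : asm_rel c y ->
    accepting c.1 = (y.1 == size P) by move=> [/= -> _].
exact: (bisim_reaches asm_forth asm_back fin (asm_init x)).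
Qed.

Lemma asm_halts x n : halts_within (asm_step P) (0, input_store x) n ->
  halts_within (@step M) (init M x) n.
Proof. by move=> h; exact: (bisim_halts asm_forth (asm_init x) h). Qed.
End AsmMachine.

(** * Structured commands and their compilation *)

Inductive cmd :=
  | Move of nat & move
  | Mark
  | Guess of nat
  | Fail
  | Skip
  | Seq of cmd & cmd
  | If of nat & pred symbol & cmd & cmd
  | While of nat & pred symbol & cmd.

Fixpoint len (c : cmd) : nat :=
  match c with
  | Skip => 0
  | Seq c1 c2 => len c1 + len c2
  | If _ _ c1 c2 => len c1 + len c2 + 2
  | While _ _ c => len c + 2
  | _ => 1
  end.

Fixpoint compile (o : nat) (c : cmd) : seq instr :=
  match c with
  | Move i m => [:: IMove i m]
  | Mark => [:: IMark]
  | Guess i => [:: IGuess i]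
  | Fail => [:: IFail]
  | Skip => [::]
  | Seq c1 c2 => compile o c1 ++ compile (o + len c1) c2
  | If i p c1 c2 =>
      IBranch i p (o + len c1).+2 ::
        compile o.+1 c1 ++
        IJump (o + len c1 + len c2).+2 :: compile (o + len c1).+2 c2
  | While i p c =>
      IBranch i p (o + len c).+2 :: compile o.+1 c ++ [:: IJump o]
  end.

Lemma size_compile o c : size (compile o c) = len c.
Proof.
elim: c o => //= [c1 I1 c2 I2|_ _ c1 I1 c2 I2|_ _ c I] o.
- by rewrite size_cat I1 I2.
- by rewrite size_cat /= I1 I2; lia.
- by rewrite size_cat /= I; lia.
Qed.

Lemma jumps_compile n o c : o + len c <= n -> all (jumps_within n) (compile o c).
Proof.
elim: c o => //= [c1 I1 c2 I2|_ _ c1 I1 c2 I2|_ _ c I] o h.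
- by rewrite all_cat I1 ?I2; lia.
- by rewrite all_cat /= I1 ?I2 /=; lia.
- by rewrite all_cat /= I; lia.
Qed.

Lemma act_keep st : act st (keep (scan st)) = st.
Proof.
case: st => f g; congr pair; apply/funext => j; apply/funext => z /=.
by rewrite /put /scan /=; case: eqP => // ->.
Qed.

Definition fits (P : seq instr) (o : nat) (C : seq instr) :=
  o + size C <= size P /\ forall i, i < size C -> nth IFail P (o + i) = nth IFail C i.

Lemma fits_cat P o C D :
  fits P o (C ++ D) <-> fits P o C /\ fits P (o + size C) D.
Proof.
rewrite /fits size_cat addnA; split=> [[s h]|[[s h] [s' h']]].
  split; split; try lia.
    move=> i iC; rewrite h; last lia.
    by rewrite nth_cat iC.
  move=> i iC; rewrite -addnA h; last lia.
  by rewrite nth_cat ltnNge leq_addr addKn.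
split=> // i iC; rewrite nth_cat; case: ltnP => ic; first exact: h.
by rewrite -h'; [congr (nth _ _ _); lia | lia].
Qed.

Lemma fits_cons P o i C :
  fits P o (i :: C) <->
  [/\ o < size P, nth IFail P o = i & fits P o.+1 C].
Proof.
rewrite -cat1s fits_cat addn1; split=> [[[s h] f]|[s h f]].
  by split=> //; [move: s; rewrite /= addn1 | move: (h 0 isT); rewrite addn0].
split=> //; split=> [|[|//]]; rewrite ?addn1 // addn0.
by [].
Qed.

Notation run P := (asm_step P).
Notation at_end P := (fun y : nat * store => y.1 == size P).

Section OneStep.
Variables (P : seq instr) (o : nat) (st : store).
Let d := (0, keep (fun=> None)).
Let os := outcomes (nth IFail P o) o (scan st).
Let next i := ((nth d os i).1, act st (nth d os i).2).

Lemma run_halts m :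
  (forall i, i < size os -> halts_within (run P) (next i) m) ->
  halts_within (run P) (o, st) m.+1.
Proof. by move=> h; apply: halts_step => y [i [ios ->]]; exact: h. Qed.

Lemma run_reaches : o < size P ->
  reaches (run P) (at_end P) (o, st) <->
  exists2 i, i < size os & reaches (run P) (at_end P) (next i).
Proof.
move=> oP; rewrite reaches_step /=; last by rewrite neq_ltn oP.
split=> [[y [i [ios ->]] r]|[i ios r]]; first by exists i.
by exists (next i) => //; exists i.
Qed.
End OneStep.

(* [runs c st n Q]: every run of [c] from [st] leaves [c] after at most [n]
   steps, and [Q] is the set of the stores in which it may do so. *)
Definition runs (c : cmd) (st : store) (n : nat) (Q : store -> Prop) :=
  forall P o, fits P o (compile o c) ->
  (forall m, (forall st', Q st' -> halts_within (run P) (o + len c, st') m) ->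
     halts_within (run P) (o, st) (n + m)) /\
  (reaches (run P) (at_end P) (o, st) <->
   exists2 st', Q st' & reaches (run P) (at_end P) (o + len c, st')).

Notation runsd c st n st' := (runs c st n (eq st')).

Lemma runs_conseq c st m n Q Q' : runs c st m Q -> m <= n ->
  (forall st', Q st' <-> Q' st') -> runs c st n Q'.
Proof.
move=> h mn QQ P o f; have [h1 h2] := h P o f; split=> [k hk|].
  apply: (@halts_le _ _ _ (m + k)); first by rewrite leq_add2r.
  by apply: h1 => st' /QQ; exact: hk.
by rewrite h2; split=> -[st' /QQ q r]; exists st'.
Qed.

Lemma runs_le c st m n Q : runs c st m Q -> m <= n -> runs c st n Q.
Proof. by move=> h mn; apply: runs_conseq h mn _. Qed.

Lemma runs_move i m st :
  runsd (Move i m) st 1 (fun j => if j == i then moved m (st.1 j) else st.1 j, st.2).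
Proof.
set st' := (_, _).
have E : act st (fun j => (scan st j, if j == i then m else Stay)) = st'.
  congr pair; first by apply/funext => j /=; case: eqP.
  by apply/funext => j; apply/funext => z; rewrite /put; case: eqP => // ->.
move=> P o /fits_cons[oP iE _]; split=> [k h|].
  apply: run_halts; rewrite iE /= => -[|//] _ /=; rewrite E -addn1; exact: h.
rewrite run_reaches // iE addn1; split=> [[[|//] _ /=]|[_ <- r]].
  by rewrite E => r; exists st'.
by exists 0 => //=; rewrite E.
Qed.

Lemma runs_mark st :
  runsd Mark st 1 (st.1, fun j => if 1 < j then put (st.2 j) (st.1 j) (Some true) else st.2 j).
Proof.
set st' := (_, _).
have E : act st (fun j => (if 1 < j then Some true else scan st j, Stay)) = st'.
  congr pair; apply/funext => j; apply/funext => z; rewrite /put.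
  by case: (1 < j) => //=; case: (z =P st.1 j) => // ->.
move=> P o /fits_cons[oP iE _]; split=> [k h|].
  apply: run_halts; rewrite iE /= => -[|//] _ /=; rewrite E -addn1; exact: h.
rewrite run_reaches // iE addn1; split=> [[[|//] _ /=]|[_ <- r]].
  by rewrite E => r; exists st'.
by exists 0 => //=; rewrite E.
Qed.

Lemma runs_guess i st :
  runs (Guess i) st 1 (fun st' => exists b : bool, st' =
    (st.1, fun j => if j == i then put (st.2 j) (st.1 j) (Some b) else st.2 j)).
Proof.
have E b : act st (put_at i (Some b) (scan st)) =
    (st.1, fun j => if j == i then put (st.2 j) (st.1 j) (Some b) else st.2 j).
  congr pair; apply/funext => j; apply/funext => z; rewrite /put_at /put /=.
  by case: (j == i) => //=; case: (z =P st.1 j) => // ->.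
move=> P o /fits_cons[oP iE _]; split=> [k h|].
  apply: run_halts; rewrite iE /= => -[|[|//]] _ /=; rewrite E -addn1.
    by apply: h; exists true.
  by apply: h; exists false.
rewrite run_reaches // iE addn1; split=> [[[|[|//]] _ /=]|[_ [[] ->] r]].
- by rewrite E => r; eexists; [exists true | exact: r].
- by rewrite E => r; eexists; [exists false | exact: r].
- by exists 0 => //=; rewrite E.
- by exists 1 => //=; rewrite E.
Qed.

Lemma runs_fail st : runs Fail st 1 (fun=> False).
Proof.
move=> P o /fits_cons[oP iE _]; split=> [k _|].
  by apply: run_halts; rewrite iE.
by rewrite run_reaches // iE; split=> -[].
Qed.

Lemma runs_skip st : runsd Skip st 0 st.
Proof.
move=> P o f; rewrite addn0; split=> [k h|]; first exact: h.
by split=> [r|[_ <-]//]; exists st.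
Qed.

Lemma runs_seq c1 c2 st m n Q1 Q2 : runs c1 st m Q1 ->
  (forall st1, Q1 st1 -> runs c2 st1 n (Q2 st1)) ->
  runs (Seq c1 c2) st (m + n) (fun st' => exists2 st1, Q1 st1 & Q2 st1 st').
Proof.
move=> h1 h2 P o /= /fits_cat[/h1[a1 b1]]; rewrite size_compile => f2.
rewrite addnA; split=> [k h|].
  rewrite -addnA; apply: a1 => st1 q1; have [a2 _] := h2 _ q1 _ _ f2.
  by apply: a2 => st2 q2; apply: h; exists st1.
rewrite b1; split=> [[st1 q1]|[st2 [st1 q1 q2] r]].
  by have [_ ->] := h2 _ q1 _ _ f2; move=> [st2 q2 r]; exists st2 => //; exists st1.
exists st1 => //; have [_ ->] := h2 _ q1 _ _ f2; by exists st2.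
Qed.

Lemma runs_if i p c1 c2 st n Q :
  runs (if p (scan st i) then c1 else c2) st n Q -> runs (If i p c1 c2) st n.+2 Q.
Proof.
move=> h P o /= /fits_cons[oP iE] /fits_cat[f1].
rewrite size_compile -/(len _) => /fits_cons[oP' jE f2].
have E := act_keep st.
set e := o + _; have eE : e = (o + len c1 + len c2).+2 by rewrite /e; lia.
case: ifP h => pi h.
  have [a b] := h _ _ f1.
  have J st' k : halts_within (run P) (e, st') k ->
      halts_within (run P) (o.+1 + len c1, st') k.+1.
    move=> hk; apply: run_halts; rewrite jE /= => -[|//] _ /=.
    by rewrite act_keep -eE.
  have J' st' : reaches (run P) (at_end P) (o.+1 + len c1, st') <->
      reaches (run P) (at_end P) (e, st').
    have F := act_keep st'.
    rewrite run_reaches // jE eE; split=> [[[|//] _ /=]|r]; first by rewrite F.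
    by exists 0 => //=; rewrite F.
  split=> [k hk|].
    have -> : n.+2 + k = (n + k.+1).+1 by lia.
    apply: run_halts; rewrite iE /= => -[|//] _ /=; rewrite E pi.
    by apply: a => st' q; apply: J; exact: hk.
  rewrite run_reaches // iE /=; split=> [[[|//] _ /=]|[st' q r]].
    by rewrite E pi b => -[st' q /J' r]; exists st'.
  by exists 0 => //=; rewrite E pi b; exists st' => //; apply/J'.
have f2' : fits P (o + len c1).+2 (compile (o + len c1).+2 c2) by [].
have [a b] := h _ _ f2'.
have eE' : (o + len c1).+2 + len c2 = e by lia.
split=> [k hk|].
  apply: (@halts_le _ _ _ (n + k).+1); first lia.
  apply: run_halts; rewrite iE /= => -[|//] _ /=; rewrite E pi.
  by apply: a; rewrite eE'; exact: hk.
rewrite run_reaches // iE /=; split=> [[[|//] _ /=]|[st' q r]].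
  by rewrite E pi b eE'.
by exists 0 => //=; rewrite E pi b eE'; exists st'.
Qed.

Lemma runs_while_end i p c st : p (scan st i) = false -> runsd (While i p c) st 1 st.
Proof.
move=> pi P o /= /fits_cons[oP iE] /fits_cat[_].
rewrite size_compile => /fits_cons[oP' jE _].
have -> : o + (len c + 2) = (o + len c).+2 by lia.
split=> [k h|].
  apply: run_halts; rewrite iE /= => -[|//] _ /=.
  by rewrite act_keep pi; apply: h.
rewrite run_reaches // iE /=; split=> [[[|//] _ /=]|[_ <- r]].
  by rewrite act_keep pi => r; exists st.
by exists 0 => //=; rewrite act_keep pi.
Qed.

Lemma runs_while_loop i (p : pred symbol) c st m n Q1 Q2 : p (scan st i) -> runs c st m Q1 ->
  (forall st1, Q1 st1 -> runs (While i p c) st1 n (Q2 st1)) ->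
  runs (While i p c) st (m + n).+2 (fun st' => exists2 st1, Q1 st1 & Q2 st1 st').
Proof.
move=> pi h1 h2 P o f; have [oP iE] := (fits_cons _ _ _ _).1 f.
move=> /fits_cat[f1]; rewrite size_compile => /fits_cons[oP' jE _].
have [a b] := h1 _ _ f1.
have next st1 : Q1 st1 ->
    reaches (run P) (at_end P) (o.+1 + len c, st1) <->
    exists2 st', Q2 st1 st' & reaches (run P) (at_end P) (o + len (While i p c), st').
  move=> q1; have [_ <-] := h2 _ q1 _ _ f.
  rewrite run_reaches // jE; split=> [[[|//] _ /=]|r]; first by rewrite act_keep.
  by exists 0 => //=; rewrite act_keep.
split=> [k h|].
  have -> : (m + n).+2 + k = (m + (n + k).+1).+1 by lia.
  apply: run_halts; rewrite iE /= => -[|//] _ /=; rewrite act_keep pi.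
  apply: a => st1 q1; apply: run_halts; rewrite jE /= => -[|//] _ /=.
  have [a' _] := h2 _ q1 _ _ f.
  by rewrite act_keep; apply: a' => st' q2; apply: h; exists st1.
rewrite run_reaches // iE; split=> [[[|//] _ /=]|[st' [st1 q1 q2] r]].
  rewrite act_keep pi b => -[st1 q1 /next-/(_ q1)[st' q2 r]].
  by exists st' => //; exists st1.
exists 0 => //=; rewrite act_keep pi b; exists st1 => //.
by apply/next => //; exists st'.
Qed.

Lemma runsd_seq c1 c2 st m n st1 st2 : runsd c1 st m st1 -> runsd c2 st1 n st2 ->
  runsd (Seq c1 c2) st (m + n) st2.
Proof.
move=> h1 h2; apply: (runs_conseq (runs_seq (Q2 := fun=> eq st2) h1 _) (leqnn _)).
  by move=> _ <-.
by move=> st'; split=> [[]//|<-]; exists st1.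
Qed.

Lemma runsd_eq c st n st1 st2 : runsd c st n st1 -> st1 = st2 -> runsd c st n st2.
Proof. by move=> h <-. Qed.

(** * Counters *)

Definition mark : cells := fun z => if z == 0%R then Some true else None.

(* Tape [0] holds the input and tape [1] the guess; the others are counters, whose
   value is the position of the head. *)
Definition counters (X W : cells) (rho : nat -> nat) : store :=
  (fun j => Posz (rho j), fun j => match j with 0 => X | 1 => W | _ => mark end).

Definition upd (rho : nat -> nat) (r v : nat) : nat -> nat :=
  fun x => if x == r then v else rho x.

(** A counter tape carries [Some true] at position 0 and blanks elsewhere, so reading anything else
    means that the counter is positive. *)
Definition nonzero : pred symbol := fun s => s != Some true.

Definition Inc r := Move r Right.
Definition Dec r := Move r Left.
Definition Loop r c := While r nonzero c.

Ltac same_counters :=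
  congr (counters _ _ _); apply/funext => ?; rewrite /upd /=;
  repeat (case: eqP => [?|?]); subst; try lia; try congruence.

Section Counters.
Variables X W : cells.
Local Notation "<< rho >>" := (counters X W rho).

Lemma nonzero_scan rho r : 1 < r -> nonzero (scan <<rho>> r) = (rho r != 0).
Proof.
by case: r => [|[|r]] // _; rewrite /scan /= /mark /nonzero; case: (rho _).
Qed.

Lemma runs_inc rho r : runsd (Inc r) <<rho>> 1 <<upd rho r (rho r).+1>>.
Proof.
apply: runsd_eq; first exact: runs_move.
congr pair; apply/funext => j /=.
by rewrite /upd; case: eqP => [->|//]; rewrite -addn1 PoszD.
Qed.

Lemma runs_dec rho r v : rho r = v.+1 -> runsd (Dec r) <<rho>> 1 <<upd rho r v>>.
Proof.
move=> rv; apply: runsd_eq; first exact: runs_move.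
congr pair; apply/funext => j /=.
by rewrite /upd; case: eqP => [->|//]; rewrite rv; lia.
Qed.

Lemma runs_for r c n b (f : nat -> nat -> nat) : 1 < r ->
  (forall i, i <= n -> (0 < f i r) = (i < n)) ->
  (forall i, i < n -> runsd c <<f i>> b <<f i.+1>>) ->
  runsd (Loop r c) <<f 0>> (n * (b + 2) + 1) <<f n>>.
Proof.
move=> r1; elim: n f => [|n IH] f fr fc.
  by apply: runs_while_end; rewrite nonzero_scan // -lt0n fr.
have h : runsd (Loop r c) <<f 1>> (n * (b + 2) + 1) <<f n.+1>>.
  apply: (IH (fun i => f i.+1)) => i ik; last exact: fc.
  by rewrite fr //; lia.
apply: (runs_conseq (runs_while_loop (Q2 := fun=> eq <<f n.+1>>) _ (fc 0 isT) _)).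
- by rewrite nonzero_scan // -lt0n fr.
- by move=> _ <-; exact: h.
- by rewrite mulSn; lia.
- by move=> st'; split=> [[]//|<-]; exists <<f 1>>.
Qed.

Lemma runs_loop r c n b (f : nat -> nat -> nat) st st' : 1 < r ->
  (forall i, i <= n -> (0 < f i r) = (i < n)) ->
  (forall i, i < n -> runsd c <<f i>> b <<f i.+1>>) ->
  st = <<f 0>> -> st' = <<f n>> ->
  runsd (Loop r c) st (n * (b + 2) + 1) st'.
Proof. by move=> r1 fr fc -> ->; exact: runs_for. Qed.

Definition Clear r := Loop r (Dec r).

Lemma runs_clear rho r : 1 < r -> runsd (Clear r) <<rho>> (rho r * 3 + 1) <<upd rho r 0>>.
Proof.
move=> r1; apply: (@runs_loop r _ (rho r) 1 (fun i => upd rho r (rho r - i))) => //.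
- by move=> i _; rewrite /upd eqxx; lia.
- move=> i ir; apply: runsd_eq (@runs_dec _ _ (rho r - i.+1) _) _.
    by rewrite /upd eqxx; lia.
  by same_counters.
- by same_counters.
- by same_counters.
Qed.

(** Reading a counter destroys it, so [t] collects a copy of [r] from which the second loop restores
    it. *)
Definition Add r s t :=
  Seq (Loop r (Seq (Dec r) (Seq (Inc s) (Inc t)))) (Loop t (Seq (Dec t) (Inc r))).

Lemma runs_add rho r s t : 1 < r -> 1 < t -> r != s -> s != t -> r != t -> rho t = 0 ->
  runsd (Add r s t) <<rho>> (rho r * 9 + 2) <<upd rho s (rho s + rho r)>>.
Proof.
move=> r1 t1 /eqP rs /eqP st /eqP rt t0.
have -> : rho r * 9 + 2 = (rho r * (3 + 2) + 1) + (rho r * (2 + 2) + 1) by lia.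
set v := rho r.
pose f i := upd (upd (upd rho t i) s (rho s + i)) r (v - i).
pose g i := upd (upd (upd rho t (v - i)) s (rho s + v)) r i.
apply: (@runsd_seq _ _ _ _ _ <<f v>>).
  apply: (@runs_loop r _ v 3 f) => //.
  - by move=> i _; rewrite /f /upd eqxx; lia.
  - move=> i iv; apply: (@runsd_seq _ _ _ 1 2); last apply: (@runsd_seq _ _ _ 1 1).
    + by apply: (@runs_dec _ _ (v - i.+1)); rewrite /f /upd eqxx; lia.
    + exact: runs_inc.
    + by apply: runsd_eq; [exact: runs_inc | rewrite /f; same_counters].
  - by rewrite /f; same_counters.
apply: (@runs_loop t _ v 2 g) => //.
- by move=> i _; rewrite /g /upd; repeat (case: eqP => ?; try lia).
- move=> i iv; apply: (@runsd_seq _ _ _ 1 1).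
  + by apply: (@runs_dec _ _ (v - i.+1)); rewrite /g /upd; repeat (case: eqP => ?; try lia).
  + by apply: runsd_eq; [exact: runs_inc | rewrite /g; same_counters].
- by rewrite /f /g; same_counters.
- by rewrite /g; same_counters.
Qed.
End Counters.

(** * Bounded formulas *)

Inductive term := Var of nat | Cst of nat | Plus of term & term | Times of term & term.

(* [Exi t p] binds the variable [0] of [p], which ranges below [t]. *)
Inductive bform :=
  | Le of term & term
  | InX of term
  | InW of term
  | Neg of bform
  | Conj of bform & bform
  | Exi of term & bform.

Definition scons (v : nat) (th : nat -> nat) : nat -> nat :=
  fun i => if i is i'.+1 then th i' else v.

Fixpoint value (t : term) (th : nat -> nat) : nat :=
  match t with
  | Var i => th i
  | Cst c => c
  | Plus a b => value a th + value b th
  | Times a b => value a th * value b th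
  end.

Fixpoint sat (X W : nat -> bool) (p : bform) (th : nat -> nat) : bool :=
  match p with
  | Le a b => value a th <= value b th
  | InX t => X (value t th)
  | InW t => W (value t th)
  | Neg q => ~~ sat X W q th
  | Conj q r => sat X W q th && sat X W r th
  | Exi t q => has (fun v => sat X W q (scons v th)) (iota 0 (value t th))
  end.

(** De Bruijn levels: the innermost of [l] variables has the highest register, and older ones never
    move. Counter 2 is reserved for truth values; the step of two leaves a counter next to each
    variable, which serves as the loop counter of its quantifier. *)
Definition reg (l i : nat) := 3 + (l - i.+1).*2.

(** The value is added to counter [d], and the counters above [d] are scratch. A variable beyond [l]
    is 0 by [env_at], hence [Skip]. *)
Fixpoint eval (l d : nat) (t : term) : cmd :=
  match t with
  | Var i => if i < l then Add (reg l i) d d.+1 else Skip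
  | Cst c => iter c (Seq (Inc d)) Skip
  | Plus a b => Seq (eval l d a) (eval l d b)
  | Times a b =>
      Seq (eval l d.+1 a) (Seq (eval l d.+2 b)
        (Seq (Loop d.+1 (Seq (Dec d.+1) (Add d.+2 d d.+3))) (Clear d.+2)))
  end.

(** Counter [d] is emptied while the head of tape [i] walks to the right; [d.+1] remembers the way
    back. *)
Definition Lookup i d :=
  Seq (Loop d (Seq (Dec d) (Seq (Inc d.+1) (Inc i))))
    (Seq (If i (fun s => s == Some true) (Inc 2) Skip)
       (Loop d.+1 (Seq (Dec d.+1) (Dec i)))).

(** Counter 2 is 0 on entry and holds the verdict on exit. For [Le], counter [d.+2] ends at the
    truncated difference of the two values. For [Exi], a witness ends the search by clearing the
    loop counter, so that the body is always entered with verdict 0. *)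
Fixpoint check (l : nat) (p : bform) : cmd :=
  let d := 3 + l.*2 in
  match p with
  | Le a b =>
      Seq (eval l d a) (Seq (eval l d.+1 b)
        (Seq (Loop d (Seq (Dec d) (If d.+1 nonzero (Dec d.+1) (Inc d.+2))))
          (Seq (If d.+2 nonzero Skip (Inc 2)) (Seq (Clear d.+1) (Clear d.+2)))))
  | InX t => Seq (eval l d t) (Lookup 0 d)
  | InW t => Seq (eval l d t) (Lookup 1 d)
  | Neg q => Seq (check l q) (If 2 nonzero (Dec 2) (Inc 2))
  | Conj q r => Seq (check l q) (If 2 nonzero (Seq (Dec 2) (check l r)) Skip)
  | Exi t q =>
      Seq (eval l d.+1 t)
        (Seq (Loop d.+1 (Seq (Dec d.+1) (Seq (check l.+1 q)
           (Seq (Inc d) (If 2 nonzero (Clear d.+1) Skip)))))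
        (Clear d))
  end.

Lemma exp_const V c : 2 <= V -> c <= V ^ c.
Proof. by move=> V2; rewrite ltnW // ltn_expl. Qed.

Lemma exp_mul V a b i j : a <= V ^ i -> b <= V ^ j -> a * b <= V ^ (i + j).
Proof. by move=> h k; rewrite expnD leq_mul. Qed.

Lemma exp_add V a b i j : 2 <= V -> a <= V ^ i -> b <= V ^ j -> a + b <= V ^ (i + j).+1.
Proof.
move=> V2 h k; apply: (@leq_trans (2 * V ^ (i + j))); last by rewrite expnS leq_mul.
have hi : V ^ i <= V ^ (i + j) by rewrite leq_pexp2l ?leq_addr //; lia.
have hj : V ^ j <= V ^ (i + j) by rewrite leq_pexp2l ?leq_addl //; lia.
by lia.
Qed.

Lemma exp_succ V a i : 2 <= V -> a <= V ^ i -> a.+1 <= V ^ i.+1.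
Proof.
move=> V2 h; rewrite expnS; have : 0 < V ^ i by rewrite expn_gt0 (ltnW V2).
by nia.
Qed.

(** Running times are bounded by powers of one [V >= 2], which absorb constants, sums and products.
    The exponent is left open by [eexists] and is found here from the shape of the bound. *)
Ltac exp_bound := repeat first
  [ eassumption | eapply exp_succ | eapply exp_add | eapply exp_mul
  | eapply exp_const | done ].

Lemma value_exp t : exists k, forall V th, 2 <= V -> (forall i, th i <= V) -> value t th <= V ^ k.
Proof.
elim: t => [i|c|a [i ai] b [j bj]|a [i ai] b [j bj]].
- by exists 1 => V th _; rewrite expn1; exact.
- by exists c => V th V2 _; exact: exp_const.
- exists (i + j).+1 => V th V2 h /=; apply: exp_add => //; [exact: ai|exact: bj].
- by exists (i + j) => V th V2 h /=; apply: exp_mul; [exact: ai|exact: bj].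
Qed.

Definition env_at (l : nat) (th rho : nat -> nat) :=
  forall i, if i < l then rho (reg l i) = th i else th i = 0.

Lemma reg_lt l i : i < l -> reg l i < 3 + l.*2 /\ 2 < reg l i.
Proof. by rewrite /reg -!muln2 => il; split; lia. Qed.

Lemma env_upd l th rho r v : 3 + l.*2 <= r \/ r <= 2 ->
  env_at l th rho -> env_at l th (upd rho r v).
Proof.
move=> dr h i; have := h i; case: ifP => // il <-.
by rewrite /upd; case: eqP => // e; have := reg_lt il; lia.
Qed.

Lemma eval_runs t l : exists k, forall X W d V th rho, 2 <= V -> (forall i, th i <= V) ->
  3 + l.*2 <= d -> env_at l th rho -> (forall r, d < r -> rho r = 0) ->
  runsd (eval l d t) (counters X W (rho)) (V ^ k) (counters X W (upd rho d (rho d + value t th))).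
Proof.
elim: t => [i|c|a [i ai] b [j bj]|a [i ai] b [j bj]] /=.
- eexists => X W d V th rho V2 thV dl en r0; have := en i; case: ifP => il.
    move=> e; have [h1 h2] := reg_lt il.
    apply: (runs_le (n := V ^ (1 + 9 + 2).+1)); last exact: leqnn.
    apply: (runs_le (m := rho (reg l i) * 9 + 2)).
      rewrite -e; apply: runs_add; rewrite ?r0 //; try apply/eqP; lia.
    by rewrite e; do !(apply: exp_add || apply: exp_mul || apply: exp_const) => //; rewrite expn1.
  move=> ->; rewrite addn0; apply: runs_le; first apply: runsd_eq; first exact: runs_skip.
    by same_counters.
  by [].
- exists c => X W d V th rho V2 _ _ _ _.
  apply: (runs_le (m := c)); last exact: exp_const.
  elim: c rho => [|c IH] rho /=.
    by apply: runsd_eq; [exact: runs_skip | same_counters].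
  rewrite -add1n; apply: runsd_seq; first exact: runs_inc.
  by apply: runsd_eq; [exact: IH | same_counters].
- exists (i + j).+1 => X W d V th rho V2 thV dl en r0.
  apply: (runs_le (m := V ^ i + V ^ j)); last exact: exp_add.
  apply: runsd_seq; first by apply: ai.
  apply: runsd_eq; first apply: bj => //.
  + by apply: env_upd => //; left.
  + by move=> r dr; rewrite /upd; case: eqP => [|_]; [lia | exact: r0].
  + by same_counters.
- have [p ap] := value_exp a; have [q bq] := value_exp b.
  eexists => X W d V th rho V2 thV dl en r0.
  set A := value a th; set B := value b th; have d0 : 1 < d.+1 by lia.
  have hA : A <= V ^ p by exact: ap.
  have hB : B <= V ^ q by exact: bq.
  apply: runs_le.
    apply: runsd_seq; first apply: (ai X W d.+1 V th rho) => //; first lia.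
      by move=> r h; rewrite r0 //; lia.
    apply: runsd_seq; first apply: (bj X W d.+2 V th) => //; first lia.
    + by apply: env_upd => //; left; lia.
    + by move=> r h; rewrite /upd; case: eqP => [|_]; [lia | rewrite r0 //; lia].
    apply: (@runsd_seq _ _ _ _ _
      (counters X W (upd (upd (upd rho d (rho d + A * B)) d.+1 0) d.+2 B))); last first.
      apply: runsd_eq; first exact: runs_clear.
      by same_counters; rewrite ?r0 //; lia.
    apply: (@runs_loop X W d.+1 _ A (1 + (B * 9 + 2))
      (fun i => upd (upd (upd rho d (rho d + i * B)) d.+1 (A - i)) d.+2 B)) => //.
    + by move=> k _; rewrite /upd; repeat case: eqP => ?; lia.
    + move=> k kA; apply: runsd_seq.
        by apply: (@runs_dec _ _ _ _ (A - k.+1)); rewrite /upd; repeat case: eqP => ?; lia.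
      set rho' := upd _ d.+1 _.
      have rB : B = rho' d.+2 by rewrite /rho' /upd; repeat case: eqP => ?; lia.
      apply: runsd_eq; first (rewrite {1}rB; apply: runs_add; try (apply/eqP; lia); try lia).
        rewrite /rho' /upd; repeat (case: eqP => ?; first lia).
        by rewrite r0 //; lia.
      by rewrite -rB /rho'; same_counters; rewrite mulSn; lia.
    + by same_counters; rewrite ?r0 //; lia.
    + by rewrite subnn.
  rewrite /upd eqxx.
  by exp_bound.
Qed.

Definition is_true_at (f : cells) (v : nat) : bool := f (Posz v) == Some true.

Lemma lookup_runs X W i d rho : i < 2 -> 2 < d -> rho 0 = 0 -> rho 1 = 0 -> rho 2 = 0 ->
  rho d.+1 = 0 ->
  runsd (Lookup i d) (counters X W (rho)) (rho d * 9 + 5)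
    (counters X W (upd (upd rho d 0) 2 (is_true_at (if i == 0 then X else W) (rho d)))).
Proof.
move=> i2 d2 z0 z1 z2 zd; set v := rho d; set b := is_true_at _ _.
have zi : rho i = 0 by case: i i2 {b} => [|[|]].
have -> : v * 9 + 5 = (v * (3 + 2) + 1) + (3 + (v * (2 + 2) + 1)) by lia.
pose f k := upd (upd (upd rho i k) d.+1 k) d (v - k).
pose g k := upd (upd (upd (upd rho i (v - k)) d.+1 (v - k)) d 0) 2 b.
apply: (@runsd_seq _ _ _ _ _ (counters X W (f v))).
  apply: (@runs_loop X W d _ v 3 f); first lia.
  - by move=> k _; rewrite /f /upd eqxx; lia.
  - move=> k kv; apply: (@runsd_seq _ _ _ 1 2); last apply: (@runsd_seq _ _ _ 1 1).
    + by apply: (@runs_dec _ _ _ _ (v - k.+1)); rewrite /f /upd eqxx; lia.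
    + exact: runs_inc.
    + by apply: runsd_eq; [exact: runs_inc | rewrite /f; same_counters].
  - by rewrite /f; same_counters.
  - by [].
apply: (@runsd_seq _ _ _ _ _ (counters X W (g 0))).
  apply: runs_if.
  have -> : (scan (counters X W (f v)) i == Some true) = b.
    have fv : f v i = v by rewrite /f /upd; repeat (case: eqP => ?; try lia).
    by rewrite /b /is_true_at /scan /= fv; case: (i) i2 => [|[|]].
  case: b @g => g.
    apply: runsd_eq; first exact: runs_inc.
    by rewrite /f /g; same_counters.
  apply: runs_le; first apply: runsd_eq; first exact: runs_skip.
    by rewrite /f /g; same_counters.
  by [].
apply: (@runs_loop X W d.+1 _ v 2 g); first lia.
- by move=> k _; rewrite /g /upd; repeat (case: eqP => ?; try lia).
- move=> k kv; apply: (@runsd_seq _ _ _ 1 1).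
  + by apply: (@runs_dec _ _ _ _ (v - k.+1)); rewrite /g /upd; repeat (case: eqP => ?; try lia).
  + apply: runsd_eq; first apply: (@runs_dec _ _ _ _ (v - k.+1)).
      by rewrite /g /upd; repeat (case: eqP => ?; try lia).
    by rewrite /g; same_counters.
- by [].
- by rewrite /g; same_counters.
Qed.

(** The exponent depends only on the formula and on [l]. Under a quantifier the new variable may
    exceed [V], so the induction hypothesis is applied with a power of [V] in place of [V]. *)
Lemma check_runs p l : exists k, forall X W V th rho, 2 <= V -> (forall i, th i <= V) ->
  env_at l th rho -> (forall r, 3 + l.*2 <= r -> rho r = 0) ->
  rho 0 = 0 -> rho 1 = 0 -> rho 2 = 0 ->
  runsd (check l p) (counters X W (rho)) (V ^ k) (counters X W (upd rho 2 (sat (is_true_at X) (is_true_at W) p th))).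
Proof.
elim: p l => [a b|t|t|q IH|q IH r IHr|t q IH] l /=; set d := 3 + l.*2.
- have [i ai] := eval_runs a l; have [j bj] := eval_runs b l.
  have [p ap] := value_exp a; have [q bq] := value_exp b.
  eexists => X W V th rho V2 thV en r0 z0 z1 z2.
  set A := value a th; set B := value b th.
  have hA : A <= V ^ p by exact: ap.
  have hB : B <= V ^ q by exact: bq.
  have hd : 2 < d by [].
  apply: runs_le.
    apply: runsd_seq; first apply: (ai X W d V th rho) => //.
      by move=> r h; rewrite r0 //; lia.
    apply: runsd_seq; first apply: (bj X W d.+1 V th) => //.
    + by apply: env_upd => //; left; lia.
    + by move=> r h; rewrite /upd; case: eqP => [|_]; [lia | rewrite r0 //; lia].
    apply: (@runsd_seq _ _ _ _ _ (counters X W (upd (upd (upd rho d.+1 (B - A)) d.+2 (A - B)) d 0))).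
      apply: (@runs_loop X W d _ A 4
        (fun i => upd (upd (upd rho d.+1 (B - i)) d.+2 (i - B)) d (A - i))) => //.
      + by move=> k _; rewrite /upd eqxx; lia.
      + move=> k kA; apply: (@runsd_seq _ _ _ 1 3).
          by apply: (@runs_dec _ _ _ _ (A - k.+1)); rewrite /upd eqxx; lia.
        apply: runs_if; rewrite nonzero_scan //.
        set rho' := upd _ d (A - k.+1).
        have e : rho' d.+1 = B - k by rewrite /rho' /upd; repeat (case: eqP => ?; try lia).
        rewrite e; case: eqP => h /=; last first.
          apply: runsd_eq; first by apply: (@runs_dec _ _ _ _ (B - k.+1)); rewrite e; lia.
          by rewrite /rho'; same_counters.
        apply: runsd_eq; first exact: runs_inc.
        by rewrite /rho'; same_counters.
      + by same_counters; rewrite ?r0 //; lia.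
      + by same_counters.
    apply: (@runsd_seq _ _ _ 3 _
      (counters X W (upd (upd (upd (upd rho d.+1 (B - A)) d.+2 (A - B)) d 0) 2 (A <= B)))).
      apply: runs_if; rewrite nonzero_scan //.
      set rho' := upd _ d 0.
      have e : rho' d.+2 = A - B by rewrite /rho' /upd; repeat (case: eqP => ?; try lia).
      rewrite e subn_eq0; case: (leqP A B) => h /=; last first.
        apply: runs_le; first apply: runsd_eq; first exact: runs_skip.
          by rewrite /rho'; same_counters.
        by [].
      apply: runsd_eq; first exact: runs_inc.
      by rewrite /rho'; same_counters.
    apply: runsd_seq; first by apply: runs_clear; lia.
    apply: runsd_eq; first by apply: runs_clear; lia.
    by same_counters; rewrite ?r0 //; lia.
  have hBA : B - A <= V ^ q by lia.
  have hAB : A - B <= V ^ p by lia.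
  rewrite /upd; repeat (case: eqP => ?; try lia).
  by exp_bound.
- have [i ai] := eval_runs t l; have [p ap] := value_exp t.
  eexists => X W V th rho V2 thV en r0 z0 z1 z2.
  have hA : value t th <= V ^ p by exact: ap.
  apply: runs_le.
    apply: runsd_seq; first apply: (ai X W d V th rho) => //.
      by move=> r h; rewrite r0 //; lia.
    apply: runsd_eq; first apply: (@lookup_runs X W 0) => //; rewrite /upd;
      repeat (case: eqP => ?; try lia) => //.
    + by rewrite r0 //; lia.
    + by rewrite r0 //; same_counters; rewrite ?r0 //; lia.
  rewrite /upd eqxx r0 // add0n.
  by exp_bound.
- have [i ai] := eval_runs t l; have [p ap] := value_exp t.
  eexists => X W V th rho V2 thV en r0 z0 z1 z2.
  have hA : value t th <= V ^ p by exact: ap.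
  apply: runs_le.
    apply: runsd_seq; first apply: (ai X W d V th rho) => //.
      by move=> r h; rewrite r0 //; lia.
    apply: runsd_eq; first apply: (@lookup_runs X W 1) => //; rewrite /upd;
      repeat (case: eqP => ?; try lia) => //.
    + by rewrite r0 //; lia.
    + by rewrite r0 //; same_counters; rewrite ?r0 //; lia.
  rewrite /upd eqxx r0 // add0n.
  by exp_bound.
- have [i ai] := IH l.
  eexists => X W V th rho V2 thV en r0 z0 z1 z2.
  apply: runs_le.
    apply: runsd_seq; first exact: (ai X W V th rho).
    apply: runs_if; rewrite nonzero_scan //.
    rewrite {1}/upd /=; case: (sat _ _ q th) => /=.
      apply: runsd_eq; first by apply: (@runs_dec _ _ _ _ 0).
      by same_counters.
    apply: runsd_eq; first exact: runs_inc.
    by same_counters.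
  by exp_bound.
- have [i ai] := IH l; have [j bj] := IHr l.
  eexists => X W V th rho V2 thV en r0 z0 z1 z2.
  apply: (@runs_le _ _ (V ^ i + (1 + V ^ j).+2)); last by exp_bound.
  apply: runsd_seq; first exact: (ai X W V th rho).
  apply: runs_if; rewrite nonzero_scan //.
  rewrite {1}/upd /=; case: (sat _ _ q th) => /=.
    apply: (@runsd_seq _ _ _ _ _ (counters X W (rho))); last exact: bj.
    apply: runsd_eq; first by apply: (@runs_dec _ _ _ _ 0).
    by same_counters.
  apply: runs_le; first apply: runsd_eq; first exact: runs_skip.
    by same_counters.
  by [].
- have [i ai] := eval_runs t l; have [p ap] := value_exp t; have [j bj] := IH l.+1.
  eexists => X W V th rho V2 thV en r0 z0 z1 z2.
  set n := value t th.
  (* The new bound must dominate [V] as well as [n], and [p] may be 0: hence [p.+1]. *)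
  have hA : n <= V ^ p.+1.
    by apply: (leq_trans (ap _ _ V2 thV)); rewrite leq_pexp2l //; lia.
  have V2' : 2 <= V ^ p.+1.
    by apply: (leq_trans V2); rewrite -{1}(expn1 V) leq_pexp2l //; lia.
  have thV' k : th k <= V ^ p.+1.
    by apply: (leq_trans (thV k)); rewrite -{1}(expn1 V) leq_pexp2l //; lia.
  set S := fun v => sat (is_true_at X) (is_true_at W) q (scons v th).
  (* [c] is the number of rounds that are really executed: up to and including the first witness, or
     all [n]. *)
  pose c := if has S (iota 0 n) then (find S (iota 0 n)).+1 else n.
  have cn : c <= n.
    by rewrite /c; case: ifP => //; rewrite has_find size_iota.
  have Sc v : v < c -> S v = has S (iota 0 n) && (v.+1 == c).
    rewrite /c; case: ifP => h vc /=.
      case: (v.+1 =P _) => [[->]|ne].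
        by have := nth_find 0 h; rewrite nth_iota ?add0n // -[X in _ < X](size_iota 0 n) -has_find.
      have := @before_find _ 0 S (iota 0 n) v; rewrite nth_iota ?add0n; first by apply; lia.
      by apply: (leq_trans (_ : v < (find S (iota 0 n)))); [lia | rewrite -[X in _ <= X](size_iota 0 n) find_size].
    by apply/negbTE; apply: (hasPn (negbT h)); rewrite mem_iota.
  have cE : ~~ has S (iota 0 n) -> c = n by rewrite /c; case: ifP.
  have hc : has S (iota 0 n) -> 0 < c by rewrite /c => ->.
  clearbody c; pose f k := upd (upd (upd rho d k) d.+1 (if k < c then n - k else 0)) 2
                  (has S (iota 0 n) && (k == c)).
  apply: (@runs_le _ _ (V ^ i + (c * ((1 + ((V ^ p.+1) ^ j + (1 + (n * 3 + 1).+2))) + 2) + 1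
     + (c * 3 + 1)))); last first.
    have cV : c <= V ^ p.+1 by lia.
    rewrite -expnM; exp_bound.
  apply: runsd_seq; first apply: (ai X W d.+1 V th rho) => //.
    by move=> r h; rewrite r0 //; lia.
  apply: (@runsd_seq _ _ _ _ _ (counters X W (f c))).
    apply: (@runs_loop X W d.+1 _ c _ f) => //.
    + move=> k kc; rewrite /f /upd; repeat (case: eqP => ?; try lia).
      by case: (ltnP k c) => // h; rewrite subn_gt0 (leq_trans h).
    + move=> k kc; apply: runsd_seq.
        apply: (@runs_dec _ _ _ _ (n - k.+1)).
        by rewrite /f /upd kc; repeat (case: eqP => ?; try lia).
      have fk : has S (iota 0 n) && (k == c) = false by rewrite ltn_eqF // andbF.
      apply: runsd_seq; first apply: (bj X W (V ^ p.+1) (scons k th)) => //.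
      + by case=> [|m] //=; lia.
      + move=> [|m] /=.
          rewrite /reg subn1 /= /f /upd /d; repeat (case: eqP => ?; try lia).
        rewrite /reg subSS -/(reg l m) ltnS; have := en m; case: ifP => // ml e.
        have [h1 h2] := reg_lt ml; rewrite -e /f /upd.
        by repeat (case: eqP => ?; try lia).
      + by move=> r h; rewrite /f /upd; repeat (case: eqP => ?; try lia); rewrite r0 //; lia.
      + by rewrite /f /upd /= fk.
      rewrite -/(S k) Sc //.
      apply: runsd_seq; first exact: runs_inc.
      apply: runs_if; rewrite nonzero_scan //.
      set rho' := upd _ d _.
      have -> : rho' 2 = has S (iota 0 n) && (k.+1 == c).
        by rewrite /rho' /upd; repeat (case: eqP => ?; try lia).
      rewrite eqb0 negbK; case: (boolP (_ && _)) => [/andP[hS1 /eqP kc']|hS].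
        apply: runs_le; first apply: runsd_eq; first by apply: runs_clear; lia.
          by rewrite /rho' /f hS1 kc' eqxx ltnn; same_counters.
        have -> : rho' d.+1 = n - k.+1.
          by rewrite /rho' /f /upd; repeat (case: eqP => ?; try lia).
        by rewrite leq_add2r leq_mul2r leq_subr orbT.
      apply: runs_le; first apply: runsd_eq; first exact: runs_skip.
        have ck : (if k.+1 < c then n - k.+1 else 0) = n - k.+1.
          case: (ltnP k.+1 c) => // ck; have ec : k.+1 = c by lia.
          by move: hS; rewrite ec eqxx andbT => /cE ->; rewrite subnn.
        by rewrite /rho' /f (negbTE hS) fk ck; same_counters.
      by [].
    + have f0 : has S (iota 0 n) && (0 == c) = false.
        by apply/andP => -[/hc]; rewrite lt0n eq_sym => /negbTE->.
      have fn : (if 0 < c then n - 0 else 0) = n.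
        rewrite subn0; case: posnP => // c0; rewrite -{1}c0; apply: cE.
        by apply/negP => /hc; rewrite c0.
      by rewrite /f f0 fn; same_counters; rewrite ?r0 //; lia.
  have fd : f c d = c by rewrite /f /upd; repeat (case: eqP => ?; try lia).
  have := @runs_clear X W (f c) d isT; rewrite fd => h.
  apply: (runsd_eq h).
  by rewrite /f ltnn eqxx andbT; same_counters; rewrite ?r0 //; lia.
Unshelve. all: exact: 0.
Qed.

(** * Measuring the input and guessing [W] *)

Definition fill (W : cells) (i n : nat) (w : nat -> bool) : cells :=
  fun z => if z is Posz k then if i <= k < i + n then Some (w k) else W z else W z.


Definition filled (st : store) (n : nat) (w : nat -> bool) : store :=
  (fun j => match j with 1 => (st.1 1 + n%:Z)%R | 6 => 0%R | _ => st.1 j end,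
   fun j => if j is 1 then fill (st.2 1) `|st.1 1| n w else st.2 j).

Lemma filled_counters X W rho n w : filled (counters X W rho) n w =
  counters X (fill W (rho 1) n w) (upd (upd rho 6 0) 1 (rho 1 + n)).
Proof.
congr pair; apply/funext => -[|[|j]] //=; rewrite /upd.
by case: j => [|[|[|[|[|j]]]]].
Qed.

Lemma guess_runs X W rho n : rho 6 = n ->
  runs (Loop 6 (Seq (Dec 6) (Seq (Guess 1) (Inc 1)))) (counters X W rho) (n * 5 + 1)
    (fun st' => exists w, st' = filled (counters X W rho) n w).
Proof.
elim: n W rho => [|n IH] W rho r6.
  apply: (@runs_conseq _ _ 1 _ (eq (counters X W rho))) => //.
    by apply: runs_while_end; rewrite nonzero_scan // r6.
  have same w : filled (counters X W rho) 0 w = counters X W rho.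
    rewrite filled_counters.
    have -> : fill W (rho 1) 0 w = W.
      apply/funext => -[k|k] //=; rewrite addn0; case: ifP => // /andP[h1 h2]; lia.
    by same_counters.
  by move=> st'; split=> [<-|[w ->]]; [exists (fun=> true); rewrite same | rewrite same].
pose A b := counters X (put W (Posz (rho 1)) (Some b)) (upd (upd rho 6 n) 1 (rho 1).+1).
have guess : runs (Seq (Dec 6) (Seq (Guess 1) (Inc 1))) (counters X W rho) 3
    (fun st' => exists b : bool, st' = A b).
  pose next (st : store) : store :=
    (fun j => if j == 1 then moved Right (st.1 j) else st.1 j, st.2).
  apply: (runs_conseq (runs_seq (n := 2) (Q2 := fun st1 st' => exists2 st2,
    (exists b : bool, st2 = (st1.1, fun j => if j == 1 then put (st1.2 j) (st1.1 j) (Some b) else st1.2 j))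
     & next st2 = st') (runs_dec (r := 6) X W r6) _)) => //.
  - move=> st1 _; apply: (@runs_seq _ _ _ 1 1 _ (fun st2 => eq (next st2))).
      exact: runs_guess.
    by move=> st2 _; exact: runs_move.
  have same b : next ((counters X W (upd rho 6 n)).1,
      fun j => if j == 1 then put ((counters X W (upd rho 6 n)).2 j)
        ((counters X W (upd rho 6 n)).1 j) (Some b) else (counters X W (upd rho 6 n)).2 j) = A b.
    congr pair; apply/funext => -[|[|j]] //=.
    by rewrite /upd /=; lia.
  move=> st'; split=> [[st1 <- [st2 [b ->] <-]]|[b ->]]; first by exists b.
  eexists; first reflexivity; eexists; first by exists b.
  exact: same.
apply: (runs_conseq (runs_while_loop (n := n * 5 + 1)
   (Q2 := fun st1 st' => exists w, st' = filled st1 n w) _ guess _)).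
- by rewrite nonzero_scan // r6.
- by move=> _ [b ->]; exact: IH.
- by lia.
have same b w : filled (A b) n w =
    filled (counters X W rho) n.+1 (fun k => if k == rho 1 then b else w k).
  rewrite !filled_counters; set W1 := fill _ _ _ _; set W2 := fill _ _ _ _.
  have -> : W1 = W2.
    apply/funext => -[k|k] //=; rewrite /W1 /W2 /= /put /upd /=.
    case: (k =P rho 1) => [->|ne].
      by rewrite eqxx ltnn leqnn /= addnS ltnS leq_addr.
    rewrite addSnnS; have -> : (Posz k == Posz (rho 1)) = false by apply/eqP; lia.
    by have -> : (rho 1 < k < rho 1 + n.+1) = (rho 1 <= k < rho 1 + n.+1) by lia.
  by same_counters.
move=> st'; split=> [[_ [b ->] [w ->]]|[w ->]].
  by eexists; exact: same.
exists (A (w (rho 1))); first by exists (w (rho 1)).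
exists w; rewrite same; congr filled; apply/funext => k.
by case: eqP => // ->.
Qed.

Definition Double := Seq (Loop 3 (Seq (Dec 3) (Seq (Inc 6) (Inc 6)))) (Loop 6 (Seq (Dec 6) (Inc 3))).

Lemma double_runs X W rho : rho 6 = 0 ->
  runsd Double (counters X W rho) (rho 3 * 13 + 2) (counters X W (upd rho 3 (rho 3 + rho 3))).
Proof.
move=> r6; set v := rho 3.
have -> : v * 13 + 2 = (v * (3 + 2) + 1) + ((v + v) * (2 + 2) + 1) by lia.
pose f i := upd (upd rho 6 (i + i)) 3 (v - i).
pose g i := upd (upd rho 3 i) 6 (v + v - i).
apply: (@runsd_seq _ _ _ _ _ (counters X W (f v))).
  apply: (@runs_loop X W 3 _ v 3 f) => //.
  - by move=> i _; rewrite /f /upd /=; lia.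
  - move=> i iv; apply: (@runsd_seq _ _ _ 1 2); last apply: (@runsd_seq _ _ _ 1 1).
    + by apply: (@runs_dec _ _ _ _ (v - i.+1)); rewrite /f /upd /=; lia.
    + exact: runs_inc.
    + by apply: runsd_eq; [exact: runs_inc | rewrite /f; same_counters].
  - by rewrite /f; same_counters.
apply: (@runs_loop X W 6 _ (v + v) 2 g) => //.
- by move=> i _; rewrite /g /upd /=; lia.
- move=> i iv; apply: (@runsd_seq _ _ _ 1 1).
  + by apply: (@runs_dec _ _ _ _ (v + v - i.+1)); rewrite /g /upd /=; lia.
  + by apply: runsd_eq; [exact: runs_inc | rewrite /g; same_counters].
- by rewrite /f /g; same_counters.
- by rewrite /g; same_counters.
Qed.

(** Counter 3 starts at 1 and is doubled at each input symbol, while counter 5 counts them. The last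
    two loops bring the head of the input tape back through a copy of counter 5. *)
Definition Measure :=
  Seq (While 0 (fun s => s != None) (Seq (Inc 5) (Seq Double (Move 0 Right))))
    (Seq (Loop 5 (Seq (Dec 5) (Seq (Inc 6) (Dec 0)))) (Loop 6 (Seq (Dec 6) (Inc 5)))).

(** [Mark] writes the zero marks of all counters at once. Counter 3 is copied to 6 twice: to count
    the guessed cells, then to bring the head of the guess tape back. *)
Definition Setup :=
  Seq (Seq Mark (Seq (Inc 3) (Seq Measure (Add 3 6 7))))
    (Seq (Loop 6 (Seq (Dec 6) (Seq (Guess 1) (Inc 1))))
      (Seq (Add 3 6 7) (Loop 6 (Seq (Dec 6) (Dec 1))))).

Definition input_cells (x : seq bool) : cells :=
  fun z => if z is Posz k then nth None (map Some x) k else None.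

Definition sized (n N : nat) : nat -> nat := scons n (scons N (fun=> 0)).

(** Counters 3 and 5 are [reg 2 1] and [reg 2 0], so [2 ^ n] and [n] already are where [check 2]
    expects its variables. *)
Definition measured (n N : nat) : nat -> nat :=
  fun i => if i == 3 then N else if i == 5 then n else 0.

Lemma scan_loop_runs x W n k : n + k = size x ->
  runsd (While 0 (fun s => s != None) (Seq (Inc 5) (Seq Double (Move 0 Right))))
    (counters (input_cells x) W (upd (measured n (2 ^ n)) 0 n))
    (k * (2 ^ size x * 13 + 6) + 1)
    (counters (input_cells x) W (upd (measured (size x) (2 ^ size x)) 0 (size x))).
Proof.
elim: k n => [|k IH] n nk.
  rewrite -nk addn0; apply: runs_while_end.
  by rewrite /scan /= nth_default // size_map -nk addn0.
set st' := counters _ _ (upd (measured (size x) _) _ _).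
pose rho := upd (measured n.+1 (2 ^ n.+1)) 0 n.+1.
apply: (runs_conseq (runs_while_loop (Q1 := eq (counters (input_cells x) W rho))
  (Q2 := fun=> eq st') (m := 2 ^ size x * 13 + 4) _ _ (n := k * (2 ^ size x * 13 + 6) + 1) _)).
- by rewrite /scan /= (nth_map false) // /upd /=; lia.
- apply: (runs_le (m := 1 + ((2 ^ n * 13 + 2) + 1))); last first.
    have : 2 ^ n <= 2 ^ size x by rewrite leq_exp2l // -nk leq_addr.
    by lia.
  apply: runsd_seq; first exact: runs_inc.
  apply: runsd_seq; first apply: runsd_eq; first by apply: double_runs.
    reflexivity.
  apply: runsd_eq; first exact: runs_inc.
  by rewrite /rho; same_counters; rewrite /measured; repeat (case: eqP => ? //; try lia); rewrite expnS; lia.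
- by move=> _ <-; apply: IH; lia.
- by rewrite mulSn; lia.
- by move=> st''; split=> [[]//|<-]; exists (counters (input_cells x) W rho).
Qed.

Lemma measure_runs x W :
  runsd Measure (counters (input_cells x) W (measured 0 1))
    (size x * (2 ^ size x * 13 + 15) + 3)
    (counters (input_cells x) W (measured (size x) (2 ^ size x))).
Proof.
set n := size x; set N := 2 ^ n.
have -> : n * (N * 13 + 15) + 3 = (n * (N * 13 + 6) + 1) + ((n * (3 + 2) + 1) + (n * (2 + 2) + 1)).
  by nia.
apply: runsd_seq.
  have <- : upd (measured 0 (2 ^ 0)) 0 0 = measured 0 1.
    by apply/funext => i; rewrite /upd; case: eqP => // ->.
  exact: scan_loop_runs.
pose f i := upd (upd (upd (measured n N) 6 i) 5 (n - i)) 0 (n - i).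
pose g i := upd (upd (measured n N) 5 i) 6 (n - i).
apply: (@runsd_seq _ _ _ _ _ (counters (input_cells x) W (f n))).
  apply: (@runs_loop _ W 5 _ n 3 f) => //.
  - by move=> i _; rewrite /f /upd /=; lia.
  - move=> i iv; apply: (@runsd_seq _ _ _ 1 2); last apply: (@runsd_seq _ _ _ 1 1).
    + by apply: (@runs_dec _ _ _ _ (n - i.+1)); rewrite /f /upd /=; lia.
    + exact: runs_inc.
    + apply: runsd_eq; first by apply: (@runs_dec _ _ _ _ (n - i.+1)); rewrite /f /upd /=; lia.
      by rewrite /f; same_counters.
  - by rewrite /f subn0; same_counters; rewrite /measured //=; repeat (case: eqP => ? //; try lia).
apply: (@runs_loop _ W 6 _ n 2 g) => //.
- by move=> i _; rewrite /g /upd /=; lia.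
- move=> i iv; apply: (@runsd_seq _ _ _ 1 1).
  + by apply: (@runs_dec _ _ _ _ (n - i.+1)); rewrite /g /upd /=; lia.
  + by apply: runsd_eq; [exact: runs_inc | rewrite /g; same_counters].
- by rewrite /f /g; same_counters; rewrite /measured; repeat (case: eqP => ? //; try lia).
- by rewrite /g; same_counters; rewrite /measured; repeat (case: eqP => ? //; try lia).
Qed.

Lemma setup_runs x (n := size x) (N := 2 ^ size x) :
  runs Setup (input_store x) (n * (N * 13 + 15) + N * 27 + 12)
    (fun st' => exists w, st' =
       counters (input_cells x) (fill (fun=> None) 0 N w) (measured n N)).
Proof.
pose M0 := counters (input_cells x) (fun=> None) (fun=> 0).
pose M1 := counters (input_cells x) (fun=> None) (measured n N).
pose M2 := counters (input_cells x) (fun=> None) (upd (measured n N) 6 N).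
have first_part : runsd (Seq Mark (Seq (Inc 3) (Seq Measure (Add 3 6 7)))) (input_store x)
    (n * (N * 13 + 15) + N * 9 + 7) M2.
  have -> : n * (N * 13 + 15) + N * 9 + 7 =
     1 + (1 + ((n * (N * 13 + 15) + 3) + (N * 9 + 2))) by lia.
  apply: (@runsd_seq _ _ _ _ _ M0).
    apply: runsd_eq; first exact: runs_mark.
    by congr pair; apply/funext => j; apply/funext => z; case: j => [|[|j]]; case: z => -[|k].
  apply: runsd_seq; first exact: runs_inc.
  apply: (@runsd_seq _ _ _ _ _ M1).
    have -> : upd (fun=> 0) 3 1 = measured 0 1.
      by apply/funext => i; rewrite /upd /measured; case: eqP => //; case: eqP.
    exact: measure_runs.
  by apply: runsd_eq; [exact: (@runs_add _ _ (measured n N) 3 6 7) | same_counters].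
have last_part w : runsd (Seq (Add 3 6 7) (Loop 6 (Seq (Dec 6) (Dec 1)))) (filled M2 N w)
    ((N * 9 + 2) + (N * (2 + 2) + 1))
    (counters (input_cells x) (fill (fun=> None) 0 N w) (measured n N)).
  rewrite filled_counters; set rho := upd _ 1 _.
  apply: runsd_seq; first exact: (@runs_add _ _ rho 3 6 7).
  pose g i := upd (upd (measured n N) 6 (N - i)) 1 (N - i).
  apply: (@runs_loop _ _ 6 _ N 2 g) => //.
  - by move=> i _; rewrite /g /upd /=; lia.
  - move=> i iv; apply: (@runsd_seq _ _ _ 1 1).
    + by apply: (@runs_dec _ _ _ _ (N - i.+1)); rewrite /g /upd /=; lia.
    + apply: runsd_eq; first by apply: (@runs_dec _ _ _ _ (N - i.+1)); rewrite /g /upd /=; lia.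
      by rewrite /g; same_counters.
  - by rewrite /g /rho; same_counters; rewrite /measured; repeat (case: eqP => ? //; try lia).
  - by rewrite /g; same_counters; rewrite /measured; repeat (case: eqP => ? //; try lia).
have r6 : upd (measured n N) 6 N 6 = N by [].
pose res w := counters (input_cells x) (fill (fun=> None) 0 N w) (measured n N).
pose back (st : store) : store := (fun j => match j with 1 => 0%R | 6 => 0%R | _ => st.1 j end, st.2).
have backE w : back (filled M2 N w) = res w.
  rewrite filled_counters; congr pair; apply/funext => -[|[|[|[|[|[|[|j]]]]]]] //=.
apply: runs_conseq; first apply: (runs_seq (Q2 := fun st1 st' => exists w, st' = res w) first_part).
- move=> _ <-; apply: runs_conseq; first apply: (runs_seq (Q2 := fun st2 => eq (back st2))).
  + exact: (@guess_runs _ _ (upd (measured n N) 6 N) N r6).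
  + by move=> _ [w ->]; rewrite backE; exact: last_part.
  + exact: leqnn.
  + move=> st'; split=> [[_ [w ->] <-]|[w ->]]; first by exists w; rewrite backE.
    by exists (filled M2 N w); [exists w | rewrite backE].
- by rewrite -/n -/N; lia.
- by move=> st'; split=> [[] //|h]; exists M2.
Qed.

Definition decide (p : bform) : cmd := Seq Setup (Seq (check 2 p) (If 2 nonzero Skip Fail)).

(** The cut at [2 ^ size x] reflects the machine: cells beyond the guessed ones stay blank and count
    as false. *)
Definition guessed_language (p : bform) : language :=
  [set x | exists w, sat (nth false x) (fun v => (v < 2 ^ size x) && w v) p
                         (sized (size x) (2 ^ size x))].

Lemma decide_runs p : exists k, forall x,
  runs (decide p) (input_store x) ((2 ^ size x).+1 ^ k)
    (fun st' => exists w, sat (nth false x) (fun v => (v < 2 ^ size x) && w v) p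
                         (sized (size x) (2 ^ size x)) /\
     st' = counters (input_cells x) (fill (fun=> None) 0 (2 ^ size x) w)
        (upd (measured (size x) (2 ^ size x)) 2 1)).
Proof.
have [k ck] := check_runs p 2.
eexists => x; set n := size x; set N := 2 ^ n; set V := N.+1.
have N0 : 0 < N by rewrite expn_gt0.
have V2 : 1 < V by [].
have nV : n <= V ^ 1 by rewrite expn1 /V /N; have := @ltn_expl 2 n isT; lia.
have NV : N <= V ^ 1 by rewrite expn1.
have inX v : is_true_at (input_cells x) v = nth false x v.
  rewrite /is_true_at /=; case: (ltnP v (size x)) => vx; last by rewrite !nth_default ?size_map.
  by rewrite (nth_map false) //; case: nth.
have inW w v : is_true_at (fill (fun=> None) 0 N w) v = (v < N) && w v.
  by rewrite /is_true_at /= add0n; case: (v < N) => //; case: (w v).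
pose res w := counters (input_cells x) (fill (fun=> None) 0 N w) (measured n N).
pose ok w := sat (nth false x) (fun v => (v < N) && w v) p (sized n N).
have checked w : runsd (check 2 p) (res w) (V ^ k)
    (counters (input_cells x) (fill (fun=> None) 0 N w) (upd (measured n N) 2 (ok w))).
  have -> : ok w = sat (is_true_at (input_cells x)) (is_true_at (fill (fun=> None) 0 N w)) p (sized n N).
    by rewrite /ok; congr sat; apply/funext => v; rewrite ?inX ?inW.
  apply: ck => //.
  - by case=> [|[|i]] //=; rewrite -[V]expn1.
  - by case=> [|[|i]].
  - by case=> [|[|[|[|[|[|[|r]]]]]]].
have finish w : runs (If 2 nonzero Skip Fail)
    (counters (input_cells x) (fill (fun=> None) 0 N w) (upd (measured n N) 2 (ok w))) 3
    (fun st' => ok w /\ st' = counters (input_cells x) (fill (fun=> None) 0 N w) (upd (measured n N) 2 1)).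
  apply: runs_if; rewrite nonzero_scan // {1}/upd /=; case: (ok w) => /=.
    apply: runs_conseq; first exact: runs_skip.
      by [].
    by move=> st'; split=> [<-|[_ ->]].
  by apply: runs_conseq; [exact: runs_fail | by [] | move=> st'; split=> [|[]]].
pose final w := counters (input_cells x) (fill (fun=> None) 0 N w) (upd (measured n N) 2 1).
have setup : runs Setup (input_store x) (n * (N * 13 + 15) + N * 27 + 12)
    (fun st' => exists w, st' = res w) by exact: setup_runs.
apply: runs_conseq; first apply: (runs_seq (n := V ^ k + 3) (Q2 := fun st1 st' => exists w, st1 = res w /\ ok w /\ st' = final w) setup).
- move=> _ [w ->]; apply: runs_conseq; first apply: (runs_seq (Q2 := fun _ st' => ok w /\ st' = final w) (checked w)).
  + by move=> _ <-; exact: (finish w).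
  + exact: leqnn.
  + move=> st'; split=> [[_ _ [okw ->]]|[w' [e [okw ->]]]]; first by exists w.
    (* A store shows [w] only below [N], and so does the formula: two guesses with the same store
       satisfy it together. *)
    have ew : fill (fun=> None) 0 N w = fill (fun=> None) 0 N w'.
      by have := congr1 (fun st : store => st.2 1) e.
    eexists; first reflexivity; rewrite /final ew; split=> //.
    move: okw; rewrite /ok; congr (is_true (sat _ _ _ _)); apply/funext => v.
    by rewrite -!inW ew.
- by rewrite -/n -/N; exp_bound.
- move=> st'; split=> [[_ _ [w [_ [okw ->]]]]|[w [okw ->]]]; first by exists w.
  by exists (res w); [exists w | exists w].
Unshelve. all: exact: 0.
Qed.

Lemma fits_self P : fits P 0 P.
Proof. by split. Qed.

Lemma guessed_NEXP p : NEXP (guessed_language p).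
Proof.
have [k dk] := decide_runs p.
(* The time [(2 ^ n).+1 ^ k] is at most [2 ^ (n.+1 * k)], hence at most [2 ^ (n ^ 2)] as soon as
   [n > 2 * k]. *)
exists 2 => //.
set P := compile 0 (decide p).
have jP : all (jumps_within (size P)) P by apply: jumps_compile; rewrite size_compile.
exists (asm_machine P); split.
  move=> x; rewrite (asm_accepts jP).
  have [_ ->] := dk x P 0 (fits_self P).
  rewrite add0n; split=> [[w h]|[st' [w [h _]] _]]; last by exists w.
  eexists; first by exists w; split=> //.
  by exists [::] => //; rewrite /P size_compile; apply: eqxx.
exists (fun n => (2 ^ n).+1 ^ k); last first.
  move=> x s; apply: asm_halts.
  have [h _] := dk x P 0 (fits_self P).
  rewrite -[_ ^ k]addn0; apply: h => st' _.
  by move=> [|y s'] //= [[i []]]; rewrite nth_default // /P size_compile.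
exists 1; exists (2 * k).+1 => // n /= nk; rewrite mul1n.
apply: (@leq_trans ((2 ^ n.+1) ^ k)).
  case: (k) => [//|k']; rewrite leq_exp2r // expnS.
  by have : 0 < 2 ^ n; [rewrite expn_gt0 | lia].
rewrite -expnM leq_exp2l //.
by nia.
Qed.

(** * Definable predicates *)

Definition bset : Type := nat -> bool.
Definition env : Type := nat -> nat.

Definition definable (P : bset -> bset -> env -> Prop) :=
  exists p, forall X W th, sat X W p th <-> P X W th.

Definition is_term (f : env -> nat) := exists t, forall th, value t th = f th.

(* A set of numbers that depends on the environment. *)
Definition dset (E : bset -> bset -> env -> nat -> Prop) :=
  definable (fun X W th => E X W (fun i => th i.+1) (th 0)).

Lemma term_var i : is_term (fun th => th i).
Proof. by exists (Var i). Qed.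

Lemma term_const c : is_term (fun=> c).
Proof. by exists (Cst c). Qed.

Lemma term_add f g : is_term f -> is_term g -> is_term (fun th => f th + g th).
Proof. by move=> [a ha] [b hb]; exists (Plus a b) => th /=; rewrite ha hb. Qed.

Lemma term_mul f g : is_term f -> is_term g -> is_term (fun th => f th * g th).
Proof. by move=> [a ha] [b hb]; exists (Times a b) => th /=; rewrite ha hb. Qed.

Lemma term_succ f : is_term f -> is_term (fun th => (f th).+1).
Proof. by move=> [a ha]; exists (Plus (Cst 1) a) => th /=; rewrite ha. Qed.

Lemma term_exp f k : is_term f -> is_term (fun th => f th ^ k).
Proof.
move=> hf; elim: k => [|k IH]; first exact: term_const.
have [t ht] := term_mul hf IH.
by exists t => th; rewrite ht expnS.
Qed.

Lemma def_le f g : is_term f -> is_term g -> definable (fun X W th => f th <= g th).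
Proof. by move=> [a ha] [b hb]; exists (Le a b) => X W th /=; rewrite ha hb. Qed.

Lemma def_X f : is_term f -> definable (fun X W th => X (f th)).
Proof. by move=> [a ha]; exists (InX a) => X W th /=; rewrite ha. Qed.

Lemma def_W f : is_term f -> definable (fun X W th => W (f th)).
Proof. by move=> [a ha]; exists (InW a) => X W th /=; rewrite ha. Qed.

Lemma def_not P : definable P -> definable (fun X W th => ~ P X W th).
Proof.
move=> [p hp]; exists (Neg p) => X W th /=; rewrite -hp.
by split=> [/negP//|h]; apply/negP.
Qed.

Lemma def_and P Q : definable P -> definable Q ->
  definable (fun X W th => P X W th /\ Q X W th).
Proof.
move=> [p hp] [q hq]; exists (Conj p q) => X W th /=; rewrite -hp -hq.
by split=> /andP.
Qed.

Lemma definable_ext P Q : definable P -> (forall X W th, P X W th <-> Q X W th) -> definable Q.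
Proof. by move=> [p hp] h; exists p => X W th; rewrite hp. Qed.

Lemma def_or P Q : definable P -> definable Q ->
  definable (fun X W th => P X W th \/ Q X W th).
Proof.
move=> hp hq; apply: definable_ext (def_not (def_and (def_not hp) (def_not hq))) _.
move=> X W th; split=> [h|[h|h] [] //]; apply: contrapT => h'; apply: h.
by split=> h; apply: h'; [left|right].
Qed.

Lemma def_imp P Q : definable P -> definable Q ->
  definable (fun X W th => P X W th -> Q X W th).
Proof.
move=> hp hq; apply: definable_ext (def_or (def_not hp) hq) _.
move=> X W th; split=> [[]//|h]; case: (pselect (P X W th)) => [/h|]; [by right|by left].
Qed.

Lemma def_iff P Q : definable P -> definable Q ->
  definable (fun X W th => P X W th <-> Q X W th).
Proof. by move=> hp hq; exact: (def_and (def_imp hp hq) (def_imp hq hp)). Qed.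

Lemma def_eq f g : is_term f -> is_term g -> definable (fun X W th => f th = g th).
Proof.
move=> hf hg; apply: definable_ext (def_and (def_le hf hg) (def_le hg hf)) _.
by move=> X W th; split=> [[h1 h2]|->]; [apply/eqP; rewrite eqn_leq h1|].
Qed.

Lemma def_ex f P : is_term f ->
  definable (fun X W th => P X W (fun i => th i.+1) (th 0)) ->
  definable (fun X W th => exists v, v < f th /\ P X W th v).
Proof.
move=> [t ht] [p hp]; exists (Exi t p) => X W th /=; split.
  by move=> /hasP[v]; rewrite mem_iota ht => vt /hp; exists v.
by move=> [v [vt h]]; apply/hasP; exists v; [rewrite mem_iota ht | apply/hp].
Qed.

Lemma def_all f P : is_term f ->
  definable (fun X W th => P X W (fun i => th i.+1) (th 0)) ->
  definable (fun X W th => forall v, v < f th -> P X W th v).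
Proof.
move=> ht hp; apply: definable_ext (def_not (def_ex (P := fun X W th v => ~ P X W th v) ht (def_not hp))) _.
move=> X W th; split=> [h v vt|h [v [vt]]]; last by apply; exact: h.
by apply: contrapT => h'; apply: h; exists v.
Qed.

Fixpoint rename_term (r : nat -> nat) (t : term) : term :=
  match t with
  | Var i => Var (r i)
  | Cst c => Cst c
  | Plus a b => Plus (rename_term r a) (rename_term r b)
  | Times a b => Times (rename_term r a) (rename_term r b)
  end.

Fixpoint rename (r : nat -> nat) (p : bform) : bform :=
  match p with
  | Le a b => Le (rename_term r a) (rename_term r b)
  | InX t => InX (rename_term r t)
  | InW t => InW (rename_term r t)
  | Neg q => Neg (rename r q)
  | Conj q q' => Conj (rename r q) (rename r q')
  | Exi t q => Exi (rename_term r t) (rename (fun i => if i is j.+1 then (r j).+1 else 0) q)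
  end.

Lemma value_rename r t th : value (rename_term r t) th = value t (fun i => th (r i)).
Proof. by elim: t => //= a -> b ->. Qed.

Lemma sat_rename X W r p th : sat X W (rename r p) th = sat X W p (fun i => th (r i)).
Proof.
elim: p r th => [a b|t|t|q IH|q IH q' IH'|t q IH] r th /=; rewrite ?value_rename ?IH ?IH' //.
apply: eq_has => v; rewrite IH; congr sat.
by apply/funext => -[|i].
Qed.

Lemma def_rename r P : definable P -> definable (fun X W th => P X W (fun i => th (r i))).
Proof. by move=> [p hp]; exists (rename r p) => X W th; rewrite sat_rename hp. Qed.

(** A bounded quantifier over a new variable equal to [f th] takes the place of substituting a term
    into a formula. *)
Lemma def_mem E f : dset E -> is_term f -> definable (fun X W th => E X W th (f th)).
Proof.
move=> hE hf.
have hv : is_term (fun th : env => f (fun i => th i.+1)).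
  have [t ht] := hf; exists (rename_term S t) => th.
  by rewrite value_rename ht.
apply: definable_ext (def_ex (P := fun X W th v => v = f th /\ E X W th v)
  (term_succ hf) (def_and (def_eq (term_var 0) hv) hE)) _.
move=> X W th; split=> [[v [_ [->]]]//|h]; by exists (f th).
Qed.

Lemma dset_rename r E : dset E -> dset (fun X W th => E X W (fun i => th (r i))).
Proof. by move=> /(def_rename (fun i => if i is j.+1 then (r j).+1 else 0)). Qed.

Lemma def_mem_rename r E f : dset E -> is_term f ->
  definable (fun X W th => E X W (fun i => th (r i)) (f th)).
Proof. by move=> /(@dset_rename r); exact: def_mem. Qed.

Lemma term_rename r f : is_term f -> is_term (fun th => f (fun i => th (r i))).
Proof. by move=> [t ht]; exists (rename_term r t) => th; rewrite value_rename ht. Qed.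

(** A pairing that is itself a term: it lies between [(a + b) ^ 2] and [(a + b).+1 ^ 2], which
    recovers [a + b] and then [a]. It is injective but not onto; tags and addresses need no more. *)
Definition pr (a b : nat) := (a + b) * (a + b) + a.

Lemma term_pr f g : is_term f -> is_term g -> is_term (fun th => pr (f th) (g th)).
Proof. by move=> hf hg; do !(apply: term_add || apply: term_mul). Qed.

Ltac is_termT := cbv beta; repeat first
  [ eassumption | simple apply term_var | simple apply term_const
  | simple apply term_succ | simple apply term_pr | simple apply term_add
  | simple apply term_mul | simple apply term_exp
  | match goal with H : is_term _ |- _ => exact (term_rename _ H) end ].

(** Under [j] binders a set parameter sees the environment shifted by [j]; the shifts are tried one
    after the other. *)
Ltac renamed H r n :=
  match n with
  | S ?m => first [ refine (def_mem_rename r H _)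
                  | let r' := eval cbv beta in (fun i => r (S i)) in renamed H r' m ]
  end.

Ltac defT := cbv beta; repeat first
  [ eassumption
  | simple apply def_all; cbv beta | simple apply def_ex; cbv beta
  | simple apply def_and | simple apply def_or | simple apply def_iff
  | simple apply def_not | simple apply def_eq | simple apply def_le
  | simple apply def_W | simple apply def_X
  | match goal with
    | H : dset _ |- definable _ => first
      [ refine (def_mem H _) | renamed H S 15 ]
    end
  | simple apply def_imp
  | match goal with |- is_term _ => is_termT end ].

(** * Arithmetic description of machine runs *)

Section Histories.
Variables (E H : nat -> Prop) (Z : nat).

(** The leading numeral is a tag that separates the tables of a machine. In tags 5 to 7, rule [r]
    expects [s] on tape [i], writes [s'] and moves as the name says. Symbols are 0 for blank, 1 for
    [false] and 2 for [true]. *)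
Definition e_start q := E (pr 0 q).
Definition e_acc q := E (pr 1 q).
Definition e_yes q q' := E (pr 2 (pr q q')).
Definition e_no q q' := E (pr 3 (pr q q')).
Definition e_rule r q q' := E (pr 4 (pr r (pr q q'))).
Definition e_left r i s s' := E (pr 5 (pr r (pr i (pr s s')))).
Definition e_stay r i s s' := E (pr 6 (pr r (pr i (pr s s')))).
Definition e_right r i s s' := E (pr 7 (pr r (pr i (pr s s')))).
Definition e_last i := E (pr 8 i).

Definition h_state t q := H (pr 0 (pr t q)).
Definition h_ans t := H (pr 1 t).
Definition h_left t i j s := H (pr 2 (pr t (pr i (pr j s)))).
Definition h_right t i j s := H (pr 3 (pr t (pr i (pr j s)))).

(** Both halves of a tape are indexed from the head, so a move shifts all the cells: here the first
    left cell becomes the scanned one, and the written symbol goes to place 1. *)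
Definition go_left t i s' := forall j, j < Z -> forall a, a < 3 ->
  [/\ h_left t.+1 i j a <-> h_left t i j.+1 a,
      h_right t.+1 i 0 a <-> h_left t i 0 a,
      h_right t.+1 i 1 a <-> a = s' &
      h_right t.+1 i j.+2 a <-> h_right t i j.+1 a].

Definition go_stay t i s' := forall j, j < Z -> forall a, a < 3 ->
  [/\ h_left t.+1 i j a <-> h_left t i j a,
      h_right t.+1 i 0 a <-> a = s' &
      h_right t.+1 i j.+1 a <-> h_right t i j.+1 a].

Definition go_right t i s' := forall j, j < Z -> forall a, a < 3 ->
  [/\ h_left t.+1 i 0 a <-> a = s',
      h_left t.+1 i j.+1 a <-> h_left t i j a &
      h_right t.+1 i j a <-> h_right t i j.+1 a].

Definition queries q := exists q', q' < Z /\ e_yes q q'.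

Definition query_step t := exists q, q < Z /\ (h_state t q /\
  exists q1, q1 < Z /\ ((h_ans t /\ e_yes q q1 \/ ~ h_ans t /\ e_no q q1) /\
    ((forall q2, q2 < Z -> (h_state t.+1 q2 <-> q2 = q1)) /\
     forall i, i < Z -> forall j, j < Z -> forall a, a < 3 ->
       (h_left t.+1 i j a <-> h_left t i j a) /\
       (h_right t.+1 i j a <-> h_right t i j a)))).

Definition rule_step t := exists q, q < Z /\ (h_state t q /\ (~ queries q /\
  exists r, r < Z /\ exists q1, q1 < Z /\ (e_rule r q q1 /\
    ((forall q2, q2 < Z -> (h_state t.+1 q2 <-> q2 = q1)) /\
     forall i, i < Z -> forall s, s < 3 -> forall s', s' < 3 ->
       [/\ e_left r i s s' -> h_right t i 0 s /\ go_left t i s',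
           e_stay r i s s' -> h_right t i 0 s /\ go_stay t i s' &
           e_right r i s s' -> h_right t i 0 s /\ go_right t i s'])))).

(** The step formulas fix the cells below [Z] from cells up to [Z] one step earlier, so nothing
    would determine cell [Z] itself. It is declared blank, which is right as long as the run is too
    short to reach it. *)
Definition edges t := forall i, i < Z -> forall a, a < 3 ->
  (h_left t i Z a <-> a = 0) /\ (h_right t i Z a <-> a = 0).

Definition starts := (forall q, q < Z -> (h_state 0 q <-> e_start q)) /\
  forall i, i < Z -> forall j, j < Z -> forall a, a < 3 ->
    (h_left 0 i j a <-> a = 0) /\ (0 < i -> (h_right 0 i j a <-> a = 0)).

Definition history l := [/\ starts, forall t, t < l.+1 -> edges t &
  forall t, t < l -> query_step t \/ rule_step t].

Definition h_accepts t := exists q, q < Z /\ (h_state t q /\ e_acc q).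

Definition h_queries t := exists q, q < Z /\ (h_state t q /\ queries q).

Definition h_halts t := ~ h_queries t /\
  ~ exists q, q < Z /\ (h_state t q /\ exists r, r < Z /\ exists q1, q1 < Z /\
    (e_rule r q q1 /\
     forall i, i < Z -> forall s, s < 3 -> forall s', s' < 3 ->
       e_left r i s s' \/ (e_stay r i s s' \/ e_right r i s s') -> h_right t i 0 s)).

Definition h_input j s := h_right 0 0 j s.

Definition asks t (I : nat -> nat -> Prop) := exists i, i < Z /\ (e_last i /\
  exists l, l < Z /\ (h_right t i l 0 /\
  forall j, j < Z.+1 ->
    (j < l -> ~ h_right t i j 0 /\ forall s, s < 3 -> (I j s <-> h_right t i j s)) /\
    (l <= j -> forall s, s < 3 -> (I j s <-> s = 0)))).
End Histories.

Lemma def_and3 P Q R : definable P -> definable Q -> definable R ->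
  definable (fun X W th => [/\ P X W th, Q X W th & R X W th]).
Proof.
move=> hp hq hr; apply: definable_ext (def_and hp (def_and hq hr)) _.
by move=> X W th; split=> [[? []]|[]].
Qed.

Lemma def_and4 P Q R S : definable P -> definable Q -> definable R -> definable S ->
  definable (fun X W th => [/\ P X W th, Q X W th, R X W th & S X W th]).
Proof.
move=> hp hq hr hs; apply: definable_ext (def_and hp (def_and3 hq hr hs)) _.
by move=> X W th; split=> [[? []]|[]].
Qed.

Ltac def34T := repeat first [simple apply def_and3 | simple apply def_and4 | progress defT].

Section DefHistories.
Variables (E H : bset -> bset -> env -> nat -> Prop) (Z l : env -> nat).
Hypotheses (dE : dset E) (dH : dset H) (tZ : is_term Z) (tl : is_term l).

Lemma def_history : definable (fun X W th => history (E X W th) (H X W th) (Z th) (l th)).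
Proof.
rewrite /history /starts /edges /query_step /rule_step /queries /go_left /go_right /go_stay.
rewrite /e_start /e_yes /e_no /e_rule /e_left /e_stay /e_right /h_state /h_ans /h_left /h_right.
by def34T.
Qed.

Lemma def_accepts : definable (fun X W th => h_accepts (E X W th) (H X W th) (Z th) (l th)).
Proof. by rewrite /h_accepts /h_state /e_acc; def34T. Qed.

Lemma def_queries : definable (fun X W th => h_queries (E X W th) (H X W th) (Z th) (l th)).
Proof. by rewrite /h_queries /queries /h_state /e_yes; def34T. Qed.

Lemma def_halts : definable (fun X W th => h_halts (E X W th) (H X W th) (Z th) (l th)).
Proof.
rewrite /h_halts /h_queries /queries /h_state /e_yes /e_rule /e_left /e_stay /e_right /h_right.
by def34T.
Qed.

Lemma def_ans : definable (fun X W th => h_ans (H X W th) (l th)).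
Proof. by rewrite /h_ans; def34T. Qed.

Lemma def_asks H' : dset H' -> definable (fun X W th =>
  asks (E X W th) (H X W th) (Z th) (l th) (h_input (H' X W th))).
Proof. by move=> dH'; rewrite /asks /e_last /h_input /h_right; def34T. Qed.

Lemma def_input m : is_term m ->
  definable (fun X W th => h_input (H X W th) (l th) (m th)).
Proof. by move=> tm; rewrite /h_input /h_right; def34T. Qed.
End DefHistories.

(** * The formulas of the two languages *)

(** Exponentiation is not a term. Its graph is part of the guess, and the recursion
    [2 ^ u.+1 = 2 ^ u + 2 ^ u] lets bounded quantifiers verify it. *)
Definition power_table (V : nat) (W : bset) := forall u, u < V.+1 -> forall v, v < V.+1 ->
  (W (pr 0 (pr 0 v)) <-> v = 1) /\
  (W (pr 0 (pr u.+1 v)) <-> exists v', v' < V.+1 /\ (v = v' + v' /\ W (pr 0 (pr u v')))).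

(* The bit [u] of [c], read from the table of the powers of 2. *)
Definition bit (V : nat) (W : bset) (c u : nat) : Prop :=
  u < V /\ exists y, y < c.+1 /\ (W (pr 0 (pr u y)) /\
    exists a, a < c.+1 /\ exists r, r < y /\ c = (a + a).+1 * y + r).

Lemma dset_bit V c : is_term V -> is_term c -> dset (fun X W th => bit (V th) W (c th)).
Proof. by move=> tV tc; rewrite /dset /bit; def34T. Qed.

Lemma dset_slice f : is_term f -> forall k, dset (fun X W th u => W (pr k (pr (f th) u))).
Proof. by move=> tf k; rewrite /dset; def34T. Qed.

Lemma dset_slice0 k : dset (fun X W th u => W (pr k u)).
Proof. by rewrite /dset; def34T. Qed.

Definition poly_fun (z : nat -> nat) := forall f, is_term f -> is_term (fun th => z (f th)).

Ltac termT := cbv beta; repeat first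
  [ match goal with hz : poly_fun ?z |- is_term (fun th => ?z _) => refine (hz _ _) end
  | simple apply term_var | simple apply term_const
  | simple apply term_succ | simple apply term_pr | simple apply term_add
  | simple apply term_mul | simple apply term_exp ].

Ltac dsetT := first
  [ refine (dset_bit _ _); termT | refine (dset_slice0 _) | refine (dset_slice _ _); termT ].

Ltac historyT := cbv beta;
  match goal with
  | |- is_term _ => termT
  | |- dset _ => dsetT
  | |- definable (fun X W th => history _ _ _ _) => refine (def_history _ _ _ _)
  | |- definable (fun X W th => h_accepts _ _ _ _) => refine (def_accepts _ _ _ _)
  | |- definable (fun X W th => h_queries _ _ _ _) => refine (def_queries _ _ _ _)
  | |- definable (fun X W th => h_halts _ _ _ _) => refine (def_halts _ _ _ _)
  | |- definable (fun X W th => h_ans _ _) => refine (def_ans _ _)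
  | |- definable (fun X W th => bit _ _ _ _) => refine (def_mem (dset_bit _ _) _)
  | |- definable (fun X W th => asks _ _ _ _ _) => refine (def_asks _ _ _ _ _)
  | |- definable (fun X W th => h_input _ _ _) => refine (def_input _ _ _)
  | |- definable (fun X W th => [/\ _, _ & _]) => refine (def_and3 _ _ _)
  | |- definable (fun X W th => [/\ _, _, _ & _]) => refine (def_and4 _ _ _ _)
  | |- definable (fun X W th => _ /\ _) => refine (def_and _ _)
  | |- definable (fun X W th => _ \/ _) => refine (def_or _ _)
  | |- definable (fun X W th => _ <-> _) => refine (def_iff _ _)
  | |- definable (fun X W th => ~ _) => refine (def_not _)
  | |- definable (fun X W th => exists v : nat, _) => refine (def_ex _ _)
  | |- definable (fun X W th => _ = _ :> nat) => refine (def_eq _ _)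
  | |- definable (fun X W th => is_true (_ <= _)) => refine (def_le _ _)
  | |- definable (fun X W th => _ -> _) => refine (def_imp _ _)
  | |- definable (fun X W th => forall v : nat, _) => refine (def_all _ _)
  | |- definable (fun X W th => is_true (X _)) => refine (def_X _)
  | |- definable (fun X W th => is_true (W _)) => refine (def_W _)
  end.

(* The environment is [n, 2 ^ n]. The histories of the three machines [e0], [e1] and
   [eD] are coded by the binary expansions of numbers below [V = 2 ^ q n']. *)
Section Tower.
Variables (e0 e1 eD k : nat) (y0 y1 y2 z q : nat -> nat).
Hypotheses (py0 : poly_fun y0) (py1 : poly_fun y1) (py2 : poly_fun y2)
  (pz : poly_fun z) (pq : poly_fun q).

Definition tower_formula (X W : bset) (th : env) :=
  exists n', n' < (th 0).+1 /\ (th 0 = n' ^ k /\ exists V, V < th 1 /\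
  (power_table V W /\ q n' <= V /\ W (pr 0 (pr (q n') V)) /\
   ~ exists c, c < V /\ exists l, l < y0 n' /\
   [/\ history (bit V W e0) (bit V W c) (z n') l,
       h_accepts (bit V W e0) (bit V W c) (z n') l,
       forall j, j < (z n').+1 -> forall s, s < 3 -> (h_input (bit V W c) j s <->
         j < n' /\ (s = 2 /\ X j \/ s = 1 /\ ~ X j) \/ n' <= j /\ s = 0) &
       forall t, t < l -> h_queries (bit V W e0) (bit V W c) (z n') t ->
       (h_ans (bit V W c) t <->
        exists c', c' < V /\ exists l', l' < y1 n' /\
        [/\ history (bit V W e1) (bit V W c') (z n') l',
            h_accepts (bit V W e1) (bit V W c') (z n') l',
            asks (bit V W e0) (bit V W c) (z n') t (h_input (bit V W c')) &
            forall t', t' < l' -> h_queries (bit V W e1) (bit V W c') (z n') t' ->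
            (h_ans (bit V W c') t' <->
             exists c'', c'' < V /\ exists l'', l'' < y2 n' /\
             [/\ history (bit V W eD) (bit V W c'') (z n') l'',
                 h_accepts (bit V W eD) (bit V W c'') (z n') l'' &
                 asks (bit V W e1) (bit V W c') (z n') t' (h_input (bit V W c''))])])])).

Lemma def_tower : definable tower_formula.
Proof. rewrite /tower_formula /power_table. repeat historyT. Qed.
End Tower.

(* The machines [E0], [E1], [ED] and [EB] are for T, A, D and B. Entry [a] of the census is
   given by the history [H1 a] of [E1]: its input is a word of B, as [HB a] shows, and the
   histories [HD a t] justify its positive answers. The labels [L a t] of its queries are
   distinct and below [G], so that it asks at most [G] queries. When [ka] is the number of
   such entries, all of them are present, and the true answers are those of the entry that
   no other entry on the same word beats. *)
Section Census.
Variables (E0 E1 ED EB HM : nat -> Prop) (HB H1 : nat -> nat -> Prop).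
Variables (HD L : nat -> nat -> nat -> Prop) (X : bset) (nx Y m G ka : nat).
(** The longest run is that of the machine for D on a query of [M1]: at most [Y] steps on a word of
    length at most [m + Y <= 2 * Y]. It needs [3 * Y] cells and a margin. *)
Let Z := Y * 4.

Definition entry_word a := exists l, l < m.+1 /\ forall j, j < Z.+1 ->
  (j < l -> ~ h_input (H1 a) j 0 /\ (h_input (H1 a) j 1 <-> ~ h_input (H1 a) j 2)) /\
  (l <= j -> forall s, s < 3 -> (h_input (H1 a) j s <-> s = 0)).

Definition entry_in_B a := (exists l, l < Y /\
    (history EB (HB a) Z l /\ h_accepts EB (HB a) Z l)) /\
  forall j, j < Z.+1 -> forall s, s < 3 ->
    (h_input (HB a) j s <-> h_input (H1 a) j s).

Definition entry_query a t :=
  [/\ exists v, v < G /\ L a t v,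
      forall t', t' < t -> h_queries E1 (H1 a) Z t' ->
        forall v, v < G -> ~ (L a t v /\ L a t' v) &
      h_ans (H1 a) t -> exists l, l < Y /\
        [/\ history ED (HD a t) Z l, h_accepts ED (HD a t) Z l &
            asks E1 (H1 a) Z t (h_input (HD a t))]].

(** Answers are allowed only at times of queries. This makes the pattern canonical: spurious answers
    elsewhere would give several entries for one run and spoil the count. *)
Definition entry_run a := exists l, l < Y /\
  [/\ history E1 (H1 a) Z l, h_halts E1 (H1 a) Z l,
      forall t, t < Y -> h_ans (H1 a) t -> t < l /\ h_queries E1 (H1 a) Z t &
      forall t, t < l -> h_queries E1 (H1 a) Z t -> entry_query a t].

Definition same_input a a' := forall j, j < Z.+1 -> forall s, s < 3 ->
  (h_input (H1 a) j s <-> h_input (H1 a') j s).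

Definition same_answers a a' t := forall t', t' < t -> (h_ans (H1 a) t' <-> h_ans (H1 a') t').

Definition beaten a := exists a', a' < ka /\ (same_input a a' /\
  exists t, t < Y /\ [/\ h_ans (H1 a') t, ~ h_ans (H1 a) t & same_answers a a' t]).

Definition listed t := exists a, a < ka /\ [/\ asks E0 HM Z t (h_input (H1 a)), ~ beaten a &
  exists l, l < Y /\ (history E1 (H1 a) Z l /\ h_accepts E1 (H1 a) Z l)].

(** The bound [nx + l < m] keeps every word that [M0] asks within length [m], the range in which the
    entries settle membership in A. *)
Definition census := [/\
  forall a, a < ka -> [/\ entry_word a, entry_in_B a & entry_run a],
  forall a, a < ka -> forall a', a' < a -> ~ (same_input a a' /\ same_answers a a' Y) &
  exists l, l < m /\ [/\ nx + l < m, history E0 HM Z l /\ h_accepts E0 HM Z l,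
    forall j, j < Z.+1 -> forall s, s < 3 -> (h_input HM j s <->
      j < nx /\ (s = 2 /\ X j \/ s = 1 /\ ~ X j) \/ nx <= j /\ s = 0) &
    forall t, t < l -> h_queries E0 HM Z t -> (h_ans HM t <-> listed t)]].
End Census.

Definition parameters (e0 e1 eD eB nx Y m G ka : nat) :=
  pr e0 (pr e1 (pr eD (pr eB (pr nx (pr Y (pr m (pr G ka))))))).

(** Machines are numbers read through the table of powers, tag 0 of [W]; runs and labels are slices
    of [W] under tags 1 to 5. The value of [V] is free: it only has to exceed [p], and the input
    bits determine [p]. *)
Definition census_formula (X W : bset) (th : env) :=
  exists V, V < th 1 /\ (power_table V W /\ exists p, p < V /\
  ((forall u, u < th 0 -> (X u <-> bit V W p u)) /\
  exists e0, e0 < V /\ exists e1, e1 < V /\ exists eD, eD < V /\ exists eB, eB < V /\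
  exists nx, nx < V /\ exists Y, Y < V /\ exists m, m < V /\ exists G, G < V /\
  exists ka, ka < V /\ (p = parameters e0 e1 eD eB nx Y m G ka /\
    census (bit V W e0) (bit V W e1) (bit V W eD) (bit V W eB)
      (fun u => W (pr 1 u)) (fun a u => W (pr 2 (pr a u))) (fun a u => W (pr 3 (pr a u)))
      (fun a t u => W (pr 4 (pr (pr a t) u))) (fun a t v => W (pr 5 (pr a (pr t v))))
      X nx Y m G ka))).

Lemma def_census : definable census_formula.
Proof.
rewrite /census_formula /power_table /parameters /census /entry_word /entry_in_B /entry_run.
rewrite /entry_query /listed /beaten /same_input /same_answers.
by repeat historyT.
Qed.

(** * Histories of oracle machines *)

Lemma pr_inj a b c d : pr a b = pr c d -> a = c /\ b = d.
Proof.
rewrite /pr => h; case: (ltngtP (a + b) (c + d)) => [lt|lt|e]; last by rewrite e in h; lia.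
  by have := leq_mul lt lt; lia.
by have := leq_mul lt lt; lia.
Qed.

Lemma pr_le a b c d : a <= c -> b <= d -> pr a b <= pr c d.
Proof. by move=> ac bd; rewrite /pr leq_add // leq_mul // leq_add. Qed.

Lemma leq_pr a b : b <= pr a b.
Proof. by rewrite /pr; nia. Qed.

Lemma leq_pr_l a b : a <= pr a b.
Proof. by rewrite /pr leq_addl. Qed.

Definition symbol_code (s : symbol) : nat :=
  match s with None => 0 | Some false => 1 | Some true => 2 end.

Lemma symbol_code_inj : injective symbol_code.
Proof. by move=> [[]|] [[]|]. Qed.

Lemma symbol_code_lt s : symbol_code s < 3.
Proof. by case: s => [[]|]. Qed.

Definition move_code (m : move) : option bool :=
  match m with Left => None | Stay => Some false | Right => Some true end.

Definition move_decode (b : option bool) : move :=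
  match b with None => Left | Some false => Stay | Some true => Right end.

Lemma move_codeK : cancel move_code move_decode.
Proof. by case. Qed.

HB.instance Definition _ := Finite.copy move (can_type move_codeK).

Definition rank (T : finType) (x : T) : nat := enum_rank x.

Lemma rank_inj (T : finType) : injective (@rank T).
Proof. by move=> x y /ord_inj /enum_rank_inj. Qed.

Lemma rank_lt (T : finType) (x : T) : rank x < #|T|.
Proof. exact: ltn_ord. Qed.

(* The set of numbers that [x] begins at [I], in symbol codes. *)
Definition reads_word (w : nat) (I : nat -> nat -> Prop) (x : seq bool) :=
  forall j, j < w -> forall s, s < 3 -> (I j s <-> s = symbol_code (nth None (map Some x) j)).

(** Both lengths are below [w], so the blank that ends each word is seen; otherwise a word could be
    confused with an extension of it. *)
Lemma reads_word_inj w I x y : size x < w -> size y < w ->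
  reads_word w I x -> reads_word w I y -> x = y.
Proof.
move=> xw yw rx ry.
have same j : j < w -> nth None (map Some x) j = nth None (map Some y) j.
  move=> jw; apply: symbol_code_inj.
  have h := (rx j jw _ (symbol_code_lt _)).2 erefl.
  exact: ((ry j jw _ (symbol_code_lt _)).1 h).
have size_le (u v : seq bool) : size u < w -> (forall j, j < w -> nth None (map Some u) j = nth None (map Some v) j) ->
    size v <= size u.
  move=> uw uv; rewrite leqNgt; apply/negP => h; have := uv _ uw.
  by rewrite [X in X = _]nth_default ?size_map // (nth_map false) ?h.
have e : size x = size y.
  by apply/eqP; rewrite eqn_leq !size_le // => j /same ->.
apply: (@eq_from_nth _ false) => // j jx.
have jw : j < w by exact: ltn_trans xw.
by have := same j jw; rewrite !(nth_map false) -?e // => -[].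
Qed.

Lemma word_at_nth (t : tape) j : nth None (map Some (word_at t)) j =
  if j < index None (right_of t) then nth None (right_of t) j else None.
Proof.
rewrite /word_at; set r := right_of t.
have : None \notin take (index None r) r.
  apply/negP => h; have hr := mem_take h.
  by move: h; rewrite in_take // ltnn.
have pmapK (s : seq symbol) : None \notin s -> map Some (pmap id s) = s.
  by elim: s => //= -[b|] s IH; rewrite inE //= => h; rewrite IH.
move=> /pmapK ->; case: ltnP => h; first by rewrite nth_take.
by rewrite nth_default // size_take_min geq_min h.
Qed.

Lemma size_word_at (t : tape) : size (word_at t) <= size (right_of t).
Proof.
rewrite /word_at (leq_trans (_ : _ <= size (take (index None (right_of t)) (right_of t)))) //.
  by rewrite size_pmap count_size.
by rewrite size_take_min geq_minr.
Qed.

Section Machine.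
Variable M : oracle_machine.
Local Notation K := (last_tape M).+1.

Definition rule : Type := (state M * {ffun 'I_K -> symbol} * state M * {ffun 'I_K -> symbol * move})%type.

Definition source (r : rule) := r.1.1.1.
Definition scanned (r : rule) := r.1.1.2.
Definition target (r : rule) := r.1.2.
Definition actions (r : rule) := r.2.

Definition valid (r : rule) := delta (source r) (scanned r) (target r) (actions r).

Inductive machine_code : nat -> Prop :=
  | CodeStart : machine_code (pr 0 (rank (start M)))
  | CodeAccepting (q : state M) : accepting q -> machine_code (pr 1 (rank q))
  | CodeYes (q : state M) k : query q = Some k -> machine_code (pr 2 (pr (rank q) (rank (k true))))
  | CodeNo (q : state M) k : query q = Some k -> machine_code (pr 3 (pr (rank q) (rank (k false))))
  | CodeRule r : valid r -> machine_code (pr 4 (pr (rank r) (pr (rank (source r)) (rank (target r)))))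
  | CodeLeft r i : valid r -> (actions r i).2 = Left ->
      machine_code (pr 5 (pr (rank r) (pr (nat_of_ord i)
        (pr (symbol_code (scanned r i)) (symbol_code (actions r i).1)))))
  | CodeStay r i : valid r -> (actions r i).2 = Stay ->
      machine_code (pr 6 (pr (rank r) (pr (nat_of_ord i)
        (pr (symbol_code (scanned r i)) (symbol_code (actions r i).1)))))
  | CodeRight r i : valid r -> (actions r i).2 = Right ->
      machine_code (pr 7 (pr (rank r) (pr (nat_of_ord i)
        (pr (symbol_code (scanned r i)) (symbol_code (actions r i).1)))))
  | CodeLast : machine_code (pr 8 (last_tape M)).

Ltac decode h :=
  red in h;
  match type of h with machine_code ?u =>
    let v := fresh "v" in let e := fresh "e" in remember u as v eqn:e in h; destruct h
  end;
  repeat match goal with e : pr _ _ = pr _ _ |- _ => move: e => /pr_inj[? ?] end;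
  subst; try discriminate.

(* Otherwise the tactics below reduce the pairing of numerals to unary numbers. *)
Opaque pr.

Lemma code_start q : e_start machine_code q <-> q = rank (start M).
Proof. by split=> [h|->]; [decode h | exact: CodeStart]. Qed.

Ltac ranks := repeat match goal with
  | e : rank _ = rank _ |- _ => move: e => /rank_inj ?
  | e : symbol_code _ = symbol_code _ |- _ => move: e => /symbol_code_inj ?
  end; subst.

Lemma code_acc (q : state M) : e_acc machine_code (rank q) <-> accepting q.
Proof. by split=> [h|]; [decode h; ranks | exact: CodeAccepting]. Qed.

Lemma code_yes (q : state M) q' :
  e_yes machine_code (rank q) q' <-> exists2 k, query q = Some k & q' = rank (k true).
Proof.
split=> [h|[k e ->]]; last exact: CodeYes.
by decode h; ranks; exists k.
Qed.

Lemma code_no (q : state M) q' :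
  e_no machine_code (rank q) q' <-> exists2 k, query q = Some k & q' = rank (k false).
Proof.
split=> [h|[k e ->]]; last exact: CodeNo.
by decode h; ranks; exists k.
Qed.

Lemma code_rule r q q' : e_rule machine_code r q q' <->
  exists p, [/\ valid p, r = rank p, q = rank (source p) & q' = rank (target p)].
Proof.
split=> [h|[p [v -> -> ->]]]; last exact: CodeRule.
by decode h; exists r0; split.
Qed.

Lemma code_left (r : rule) (i : 'I_K) s s' : valid r -> e_left machine_code (rank r) i s s' <->
  [/\ (actions r i).2 = Left, s = symbol_code (scanned r i) & s' = symbol_code (actions r i).1].
Proof.
move=> v; split=> [h|[m -> ->]]; last exact: CodeLeft.
by decode h; ranks; have -> : i = i0 by apply: ord_inj.
Qed.

Lemma code_stay (r : rule) (i : 'I_K) s s' : valid r -> e_stay machine_code (rank r) i s s' <->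
  [/\ (actions r i).2 = Stay, s = symbol_code (scanned r i) & s' = symbol_code (actions r i).1].
Proof.
move=> v; split=> [h|[m -> ->]]; last exact: CodeStay.
by decode h; ranks; have -> : i = i0 by apply: ord_inj.
Qed.

Lemma code_right (r : rule) (i : 'I_K) s s' : valid r -> e_right machine_code (rank r) i s s' <->
  [/\ (actions r i).2 = Right, s = symbol_code (scanned r i) & s' = symbol_code (actions r i).1].
Proof.
move=> v; split=> [h|[m -> ->]]; last exact: CodeRight.
by decode h; ranks; have -> : i = i0 by apply: ord_inj.
Qed.

Lemma code_tape r i s s' :
  e_left machine_code r i s s' \/ (e_stay machine_code r i s s' \/ e_right machine_code r i s s') ->
  i < K.
Proof. by case=> [h|[h|h]]; decode h; exact: ltn_ord. Qed.

Lemma code_last i : e_last machine_code i <-> i = last_tape M.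
Proof. by split=> [h|->]; [decode h | exact: CodeLast]. Qed.

(** The answer is a parameter instead of coming from an oracle, so that runs with guessed answers
    make sense before these are compared with the truth. *)
Definition answer_step (b : bool) (c c' : config M) : Prop :=
  if query c.1 is Some k then c' = (k b, c.2) else step c c'.

Definition run_of (an : nat -> bool) (c : nat -> config M) (l : nat) (x : seq bool) :=
  c 0 = init M x /\ forall t, t < l -> answer_step (an t) (c t) (c t.+1).

Definition asking (c : config M) : bool := isSome (query c.1).

Definition halted (c : config M) := forall b c', ~ answer_step b c c'.

Definition word_of (c : config M) := word_at (c.2 ord_max).

Definition left_cell (c : config M) (i j : nat) : symbol :=
  if insub i is Some k then nth None (left_of (c.2 (k : 'I_K))) j else None.

Definition right_cell (c : config M) (i j : nat) : symbol :=
  if insub i is Some k then nth None (right_of (c.2 (k : 'I_K))) j else None.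

Lemma left_cellE c (i : 'I_K) j : left_cell c i j = nth None (left_of (c.2 i)) j.
Proof. by rewrite /left_cell valK. Qed.

Lemma right_cellE c (i : 'I_K) j : right_cell c i j = nth None (right_of (c.2 i)) j.
Proof. by rewrite /right_cell valK. Qed.

Definition fits_in (c : config M) (w : nat) :=
  forall i : 'I_K, size (left_of (c.2 i)) <= w /\ size (right_of (c.2 i)) <= w.

Lemma fits_in_step b c c' w : 0 < w -> fits_in c w -> answer_step b c c' -> fits_in c' w.+1.
Proof.
rewrite /answer_step => w0 f; case: (query c.1) => [k -> i|].
  by have [l r] := f i; split; exact: leqW.
move=> [d _ e] i; rewrite e ffunE; have [l r] := f i.
by case: (d i) => s [] /=; rewrite /Defs.shift /write /= ?size_behead ?size_behead /=; lia.
Qed.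

Lemma fits_in_run an c l x t : run_of an c l x -> t <= l -> fits_in (c t) (size x + t).+1.
Proof.
move=> [c0 st]; elim: t => [|t IH] tl.
  rewrite c0 addn0 => i; rewrite ffunE /=; split=> //.
  by case: ifP => _ //=; rewrite size_map.
by rewrite addnS; apply: (fits_in_step _ (IH (ltnW tl)) (st _ tl)).
Qed.

Lemma fits_in_cell c w i j : fits_in c w -> w <= j -> left_cell c i j = None /\ right_cell c i j = None.
Proof.
move=> f wj; rewrite /left_cell /right_cell; case: insubP => [k _ _|//].
by have [l r] := f k; rewrite !nth_default //; exact: leq_trans wj.
Qed.

Definition shifted (m : move) (s : symbol) (t : tape) := Defs.shift m (write s t).

Lemma shifted_left s t j : [/\ nth None (left_of (shifted Left s t)) j = nth None (left_of t) j.+1,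
  nth None (right_of (shifted Left s t)) 0 = nth None (left_of t) 0,
  nth None (right_of (shifted Left s t)) 1 = s &
  nth None (right_of (shifted Left s t)) j.+2 = nth None (right_of t) j.+1].
Proof. by rewrite /= !nth_behead nth0. Qed.

Lemma shifted_stay s t j : [/\ nth None (left_of (shifted Stay s t)) j = nth None (left_of t) j,
  nth None (right_of (shifted Stay s t)) 0 = s &
  nth None (right_of (shifted Stay s t)) j.+1 = nth None (right_of t) j.+1].
Proof. by rewrite /= nth_behead. Qed.

Lemma shifted_right s t j : [/\ nth None (left_of (shifted Right s t)) 0 = s,
  nth None (left_of (shifted Right s t)) j.+1 = nth None (left_of t) j &
  nth None (right_of (shifted Right s t)) j = nth None (right_of t) j.+1].
Proof. by rewrite /= nth_behead. Qed.

Definition big_enough (Z : nat) := [/\ #|state M| <= Z, #|{: rule}| <= Z, K <= Z & 3 <= Z].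

(* The tapes below [kk] and the cells below [w] are as in [c]. *)
Definition agrees (H : nat -> Prop) (Z kk w t : nat) (c : config M) :=
  (forall q, q < Z -> (h_state H t q <-> q = rank c.1)) /\
  forall i, i < kk -> forall j, j < w -> forall a, a < 3 ->
    (h_left H t i j a <-> a = symbol_code (left_cell c i j)) /\
    (h_right H t i j a <-> a = symbol_code (right_cell c i j)).

Section Semantics.
Variables (H : nat -> Prop) (Z : nat).
Hypothesis Zbig : big_enough Z.
Local Notation E := machine_code.

Lemma queriesP (q : state M) : queries E Z (rank q) <-> isSome (query q).
Proof.
case: Zbig => Zs _ _ _; split=> [[q' [_ /code_yes[k ->]]]//|].
case e: (query q) => [k|//] _; exists (rank (k true)); split.
  exact: leq_trans (rank_lt _) Zs.
by apply/code_yes; exists k.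
Qed.

Section Step.
Variables (t kk w : nat) (c : config M).
Hypothesis agree : agrees H Z kk w t c.

Lemma state_agrees : h_state H t (rank c.1) /\ rank c.1 < Z.
Proof.
case: Zbig => Zs _ _ _; have rZ : rank c.1 < Z by exact: leq_trans (rank_lt _) Zs.
by split=> //; apply/(agree.1 _ rZ).
Qed.

Lemma state_unique q : q < Z -> h_state H t q -> q = rank c.1.
Proof. by move=> qZ /(agree.1 _ qZ). Qed.

Lemma accepts_agrees : h_accepts E H Z t <-> accepting c.1.
Proof.
have [h r] := state_agrees; split=> [[q [qZ [/(state_unique qZ) ->]]]|]; first by move/code_acc.
by exists (rank c.1); split=> //; split=> //; apply/code_acc.
Qed.

Lemma queries_agrees : h_queries E H Z t <-> asking c.
Proof.
have [h r] := state_agrees; split=> [[q [qZ [/(state_unique qZ) ->]]]|]; first by move/queriesP.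
by exists (rank c.1); split=> //; split=> //; apply/queriesP.
Qed.
End Step.

Lemma scanned_agrees (t w : nat) c (i : 'I_K) s : 0 < w -> agrees H Z K w t c ->
  h_right H t i 0 (symbol_code s) <-> s = read (c.2 i).
Proof.
move=> w0 [_ /(_ i (ltn_ord i) 0 w0 _ (symbol_code_lt s))[_ ->]].
rewrite right_cellE nth0; split=> [/symbol_code_inj //|-> //].
Qed.

Lemma agrees_weaken t kk w kk' w' c : kk' <= kk -> w' <= w ->
  agrees H Z kk w t c -> agrees H Z kk' w' t c.
Proof.
move=> hk hw [a b]; split=> // i ik j jw; apply: b; [exact: leq_trans hk | exact: leq_trans hw].
Qed.

Lemma rule_applies (r : rule) t c : agrees H Z K Z.+1 t c -> valid r ->
  (forall i, i < Z -> forall s, s < 3 -> forall s', s' < 3 ->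
     e_left E (rank r) i s s' \/ (e_stay E (rank r) i s s' \/ e_right E (rank r) i s s') ->
     h_right H t i 0 s) <->
  scanned r = [ffun i => read (c.2 i)].
Proof.
move=> ag v; case: Zbig => _ _ ZK Z3; split=> [h|h].
  apply/ffunP => i; rewrite ffunE.
  apply/(scanned_agrees _ _ (ltn0Sn Z) ag) => //.
  apply: (h i (leq_trans (ltn_ord i) ZK) _ (symbol_code_lt _) (symbol_code (actions r i).1) (symbol_code_lt _)).
  case m: (actions r i).2; [left; apply/code_left | right; left; apply/code_stay | right; right; apply/code_right];
   by rewrite ?v ?m.
move=> i iZ s s3 s' s'3 d; have iK := code_tape d.
have e : s = symbol_code (scanned r (Ordinal iK)).
  by move: d; rewrite -[i]/(nat_of_ord (Ordinal iK)) code_left // code_stay // code_right //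
    => -[[]|[[]|[]]].
rewrite e -[i]/(nat_of_ord (Ordinal iK)); apply/(scanned_agrees _ _ (ltn0Sn Z) ag) => //.
by rewrite h ffunE.
Qed.

(** The formulas give the cells below [Z] of the next configuration. Cell [Z] comes from [edges]:
    the next configuration still fits below it, so blank is its true content. *)
Lemma step_sound t c w : agrees H Z K Z.+1 t c -> 0 < w -> fits_in c w -> w < Z -> edges H Z t.+1 ->
  query_step E H Z t \/ rule_step E H Z t ->
  exists2 c', answer_step `[< h_ans H t >] c c' & agrees H Z K Z.+1 t.+1 c'.
Proof.
move=> ag w0 fc wZ ed st; case: (Zbig) => Zs Zr ZK Z3.
have iZ (i : 'I_K) : i < Z by exact: leq_trans (ltn_ord i) ZK.
have extend c' : fits_in c' w.+1 ->
    (forall q, q < Z -> (h_state H t.+1 q <-> q = rank c'.1)) ->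
    (forall i : 'I_K, forall j, j < Z -> forall a, a < 3 ->
      (h_left H t.+1 i j a <-> a = symbol_code (left_cell c' i j)) /\
      (h_right H t.+1 i j a <-> a = symbol_code (right_cell c' i j))) ->
    agrees H Z K Z.+1 t.+1 c'.
  move=> f hq hc; split=> // i iK j; rewrite ltnS leq_eqVlt => /orP[/eqP->|jZ] a a3; last first.
    exact: (hc (Ordinal iK)).
  have [-> ->] := fits_in_cell i f wZ.
  exact: (ed i (iZ (Ordinal iK)) a a3).
case: st => [[q [qZ [/(state_unique ag qZ) -> [q1 [q1Z [yn [hq hc]]]]]]]|].
  have [k ek q1E] : exists2 k, query c.1 = Some k & q1 = rank (k `[< h_ans H t >]).
    by case: yn => [[ha /code_yes[k e ->]]|[ha /code_no[k e ->]]]; exists k => //; case: asboolP.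
  have st : answer_step `[< h_ans H t >] c (k `[< h_ans H t >], c.2) by rewrite /answer_step ek.
  exists (k `[< h_ans H t >], c.2) => //; apply: extend.
  - exact: fits_in_step st.
  - by move=> q2 q2Z; rewrite hq // q1E.
  - move=> i j jZ a a3; have [-> ->] := hc i (iZ i) j jZ a a3.
    exact: (ag.2 i (ltn_ord i) j (ltnW jZ) a a3).
move=> [q [qZ [/(state_unique ag qZ) -> [nq [_ [_ [q1 [q1Z [/code_rule[r [v -> sr ->]] [hq hr]]]]]]]]]].
have sc : scanned r = [ffun i => read (c.2 i)].
  apply/(rule_applies ag v) => i iZ' s s3 s' s'3.
  by have [h1 h2 h3] := hr i iZ' s s3 s' s'3 => -[/h1[]|[/h2[]|/h3[]]].
pose c' : config M := (target r, [ffun i => shifted (actions r i).2 (actions r i).1 (c.2 i)]).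
have st : answer_step `[< h_ans H t >] c c'.
  have nq' : query c.1 = None by case e: (query c.1) nq => // nq; case: nq; apply/queriesP; rewrite e.
  rewrite /answer_step nq'; exists (actions r) => //=.
  by move: v; rewrite /valid sc; move/rank_inj: sr => ->.
exists c' => //; apply: extend => //; first exact: fits_in_step st.
move=> i j jZ a a3.
have [h1 h2 h3] := hr i (iZ i) _ (symbol_code_lt (scanned r i)) _ (symbol_code_lt (actions r i).1).
have cells b k : k <= Z -> b < 3 ->
    (h_left H t i k b <-> b = symbol_code (left_cell c i k)) /\
    (h_right H t i k b <-> b = symbol_code (right_cell c i k)).
  by move=> kZ b3; apply: ag.2.
rewrite left_cellE right_cellE ffunE.
case m: (actions r i).2.
- have [_ go] : h_right H t i 0 (symbol_code (scanned r i)) /\ go_left H Z t i (symbol_code (actions r i).1).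
    by apply: h1; apply/code_left.
  have [g1 g2 g3 _] := go j jZ a a3.
  have [l1 l2 l3 _] := shifted_left (actions r i).1 (c.2 i) j.
  rewrite l1 -left_cellE g1 (cells _ _ jZ a3).1; split=> //.
  case: j jZ {g1 l1} => [|[|j]] jZ.
  + by rewrite l2 -left_cellE g2 (cells _ _ _ a3).1.
  + by rewrite l3 g3.
  have [_ _ _ g4] := go j (ltnW (ltnW jZ)) a a3.
  have [_ _ _ l4] := shifted_left (actions r i).1 (c.2 i) j.
  by rewrite l4 -right_cellE g4 (cells _ _ (ltnW (ltnW jZ)) a3).2.
- have [_ go] : h_right H t i 0 (symbol_code (scanned r i)) /\ go_stay H Z t i (symbol_code (actions r i).1).
    by apply: h2; apply/code_stay.
  have [g1 g2 _] := go j jZ a a3.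
  have [l1 l2 _] := shifted_stay (actions r i).1 (c.2 i) j.
  rewrite l1 -left_cellE g1 (cells _ _ (ltnW jZ) a3).1; split=> //.
  case: j jZ {g1 l1} => [|j] jZ; first by rewrite l2 g2.
  have [_ _ g3] := go j (ltnW jZ) a a3.
  have [_ _ l3] := shifted_stay (actions r i).1 (c.2 i) j.
  by rewrite l3 -right_cellE g3 (cells _ _ (ltnW jZ) a3).2.
have [_ go] : h_right H t i 0 (symbol_code (scanned r i)) /\ go_right H Z t i (symbol_code (actions r i).1).
  by apply: h3; apply/code_right.
have [g1 _ g3] := go j jZ a a3.
have [l1 _ l3] := shifted_right (actions r i).1 (c.2 i) j.
rewrite l3 -right_cellE g3 (cells _ _ jZ a3).2; split=> //.
case: j jZ {g3 l3} => [|j] jZ; first by rewrite l1 g1.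
have [_ g2 _] := go j (ltnW jZ) a a3.
have [_ l2 _] := shifted_right (actions r i).1 (c.2 i) j.
by rewrite l2 -left_cellE g2 (cells _ _ (ltnW (ltnW jZ)) a3).1.
Qed.

(** The formulas quantify over all tape numbers below [Z], and [go_left] mentions place [j.+2], up
    to [Z.+1]. Agreement is therefore needed on [Z] tapes and [Z.+2] cells, more than in
    [step_sound]. *)
Lemma step_complete (b : bool) t c c' w : agrees H Z Z Z.+2 t c -> agrees H Z Z Z.+2 t.+1 c' ->
  (h_ans H t <-> b) -> answer_step b c c' -> fits_in c w -> w < Z ->
  query_step E H Z t \/ rule_step E H Z t.
Proof.
move=> ag ag' hb st fc wZ; case: (Zbig) => Zs Zr ZK Z3.
have iZ (i : 'I_K) : i < Z by exact: leq_trans (ltn_ord i) ZK.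
have [h0 r0] := state_agrees ag.
have r1 : rank c'.1 < Z by exact: leq_trans (rank_lt _) Zs.
have cells i k a : i < Z -> k < Z.+2 -> a < 3 ->
    ((h_left H t i k a <-> a = symbol_code (left_cell c i k)) /\
     (h_right H t i k a <-> a = symbol_code (right_cell c i k))) /\
    ((h_left H t.+1 i k a <-> a = symbol_code (left_cell c' i k)) /\
     (h_right H t.+1 i k a <-> a = symbol_code (right_cell c' i k))).
  by move=> iZ' kZ a3; split; [apply: ag.2 | apply: ag'.2].
move: st; rewrite /answer_step; case e: (query c.1) => [k|] st.
  left; exists (rank c.1); split=> //; split=> //; exists (rank c'.1); split=> //; split; last split.
  - rewrite st /=; case: (b) hb => hb; [left|right]; split.
    + exact/hb.
    + by apply/code_yes; exists k.
    + by move/hb.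
    + by apply/code_no; exists k.
  - by move=> q2 q2Z; exact: ag'.1.
  - move=> i iZ' j jZ a a3; have [[-> ->] [-> ->]] := cells i j a iZ' (leqW (ltnW jZ)) a3.
    by rewrite st.
right; case: st => d dl c'E.
pose r : rule := (c.1, [ffun i => read (c.2 i)], c'.1, d).
have v : valid r by [].
exists (rank c.1); split=> //; split=> //; split; first by move/queriesP; rewrite e.
exists (rank r); split; first exact: leq_trans (rank_lt r) Zr.
exists (rank c'.1); split=> //; split; first by apply/code_rule; exists r.
split; first by move=> q2 q2Z; exact: ag'.1.
move=> i iZ' s s3 s' s'3.
have ag1 : agrees H Z K Z.+1 t c by exact: agrees_weaken ag.
have sc := (rule_applies ag1 v).2 erefl i iZ' s s3 s' s'3.
have c'i (k : 'I_K) : c'.2 k = shifted (d k).2 (d k).1 (c.2 k) by rewrite c'E ffunE.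
split=> he; (split; first (apply: sc; (by left) || (by right; left) || (by right; right)));
  move=> j jZ a a3.
- have iK : i < K by apply: code_tape; left; exact: he.
  move: he iZ'; rewrite -[i]/(nat_of_ord (Ordinal iK)); set i' := Ordinal iK.
  move=> /(code_left _ _ _ v)[m _ ->] iZ'.
  have [l1 l2 l3 l4] := shifted_left (d i').1 (c.2 i') j.
  have A k (kZ : k < Z.+2) := cells i' k a iZ' kZ a3.
  have j0 : j < Z.+2 by lia. have j1 : j.+1 < Z.+2 by lia. have j2 : j.+2 < Z.+2 by lia.
  have := c'i i'; rewrite m => e'.
  split; rewrite ?(A _ j0).2.1 ?(A _ j1).1.1 ?(A 0 _).2.2 ?(A 0 _).1.1 ?(A 1 _).2.2
    ?(A _ j2).2.2 ?(A _ j1).1.2 ?left_cellE ?right_cellE ?e' ?l1 ?l2 ?l3 ?l4 //.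
- have iK : i < K by apply: code_tape; right; left; exact: he.
  move: he iZ'; rewrite -[i]/(nat_of_ord (Ordinal iK)); set i' := Ordinal iK.
  move=> /(code_stay _ _ _ v)[m _ ->] iZ'.
  have [l1 l2 l3] := shifted_stay (d i').1 (c.2 i') j.
  have A k (kZ : k < Z.+2) := cells i' k a iZ' kZ a3.
  have j0 : j < Z.+2 by lia. have j1 : j.+1 < Z.+2 by lia.
  have := c'i i'; rewrite m => e'.
  split; rewrite ?(A _ j0).2.1 ?(A _ j0).1.1 ?(A 0 _).2.2 ?(A _ j1).2.2 ?(A _ j1).1.2
    ?left_cellE ?right_cellE ?e' ?l1 ?l2 ?l3 //.
- have iK : i < K by apply: code_tape; right; right; exact: he.
  move: he iZ'; rewrite -[i]/(nat_of_ord (Ordinal iK)); set i' := Ordinal iK.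
  move=> /(code_right _ _ _ v)[m _ ->] iZ'.
  have [l1 l2 l3] := shifted_right (d i').1 (c.2 i') j.
  have A k (kZ : k < Z.+2) := cells i' k a iZ' kZ a3.
  have j0 : j < Z.+2 by lia. have j1 : j.+1 < Z.+2 by lia.
  have := c'i i'; rewrite m => e'.
  split; rewrite ?(A 0 _).2.1 ?(A _ j1).2.1 ?(A _ j0).1.1 ?(A _ j0).2.2 ?(A _ j1).1.2
    ?left_cellE ?right_cellE ?e' ?l1 ?l2 ?l3 //.
Qed.

Lemma halts_agrees t c : agrees H Z K Z.+1 t c -> h_halts E H Z t <-> halted c.
Proof.
move=> ag; case: (Zbig) => Zs Zr ZK Z3; have [h0 r0] := state_agrees ag.
have qa := queries_agrees ag; split=> [[nq nr] b c'|h].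
  rewrite /answer_step; case e: (query c.1) => [k|].
    by case: nq; apply/qa; rewrite /asking e.
  move=> [d dl _]; apply: nr; exists (rank c.1); split=> //; split=> //.
  pose r : rule := (c.1, [ffun i => read (c.2 i)], c'.1, d).
  have v : valid r by [].
  exists (rank r); split; first exact: leq_trans (rank_lt r) Zr.
  exists (rank c'.1); split; first exact: leq_trans (rank_lt _) Zs.
  by split; [apply/code_rule; exists r | apply/(rule_applies ag v)].
split=> [/qa|[q [qZ [/(state_unique ag qZ) -> [_ [_ [q1 [_ [/code_rule[r [v -> sr _]] hr]]]]]]]]].
  rewrite /asking; case e: (query c.1) => [k|//] _.
  by apply: (h true (k true, c.2)); rewrite /answer_step e.
move: hr => /(rule_applies ag v) sc.
case e: (query c.1) => [k|].
  by apply: (h true (k true, c.2)); rewrite /answer_step e.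
apply: (h true (target r, [ffun i => shifted (actions r i).2 (actions r i).1 (c.2 i)])).
rewrite /answer_step e; exists (actions r) => //=.
by move: v; rewrite /valid sc; move/rank_inj: sr => ->.
Qed.

Lemma asks_agrees t c w I : agrees H Z K Z.+1 t c -> fits_in c w -> w < Z ->
  asks E H Z t I <-> reads_word Z.+1 I (word_of c).
Proof.
move=> [_ ag] f wZ; case: (Zbig) => Zs Zr ZK Z3.
set r := right_of (c.2 ord_max).
have cell j : right_cell c (last_tape M) j = nth None r j.
  by rewrite -[last_tape M]/(nat_of_ord (ord_max : 'I_K)) right_cellE.
have agr j : j < Z.+1 -> forall a, a < 3 -> (h_right H t (last_tape M) j a <-> a = symbol_code (nth None r j)).
  by move=> jZ a a3; rewrite (ag _ (ltnSn _) j jZ a a3).2 cell.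
have sr : index None r < Z.
  by apply: leq_ltn_trans wZ; apply: leq_trans (index_size _ _) (f ord_max).2.
have code0 s : symbol_code s = 0 -> s = None by case: s => [[]|].
have nblank j : j < index None r -> nth None r j <> None.
  by move=> ji e; have := before_find None ji; rewrite /= e eqxx.
have iblank : nth None r (index None r) = None.
  case: (boolP (None \in r)) => [h|h]; first exact: nth_index.
  by rewrite (memNindex h) nth_default.
split=> [[i [_ [/code_last-> [l [lZ [h0 hl]]]]]] j jZ s s3|rd].
  have lE : l = index None r.
    have l0 : nth None r l = None by apply: code0; symmetry; apply/(agr l (leqW lZ)).
    apply/eqP; rewrite eqn_leq; apply/andP; split; rewrite leqNgt; apply/negP => lt.
      have [/(_ lt)[] + _ _] := hl _ (leqW sr).
      by apply; apply/agr => //; [exact: leqW | rewrite iblank].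
    exact: (nblank l lt).
  rewrite /word_of word_at_nth -/r -lE; have [h1 h2] := hl j jZ.
  case: ltnP => jl; last by apply: h2.
  by have [_ /(_ s s3) ->] := h1 jl; exact: agr.
exists (last_tape M); split; first exact: ZK.
split; first exact/code_last.
exists (index None r); split=> //; split.
  by apply/agr => //; [exact: leqW | rewrite iblank].
move=> j jZ; split=> [jl|lj s s3].
  split=> [/(agr j jZ 0 isT)/esym/code0|s s3]; first exact: nblank.
  by rewrite rd // agr // /word_of word_at_nth -/r jl.
by rewrite rd // /word_of word_at_nth -/r ltnNge lj.
Qed.

Lemma init_agrees x : (size x).+1 < Z -> starts E H Z -> edges H Z 0 ->
  reads_word Z.+1 (h_input H) x -> agrees H Z K Z.+1 0 (init M x).
Proof.
move=> xZ [hq hc] ed rd; case: (Zbig) => Zs Zr ZK Z3.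
split=> [q qZ|i iK j jZ a a3]; first by rewrite hq // code_start.
have iZ : i < Z by exact: leq_trans iK ZK.
rewrite -[i]/(nat_of_ord (Ordinal iK)) left_cellE right_cellE !ffunE /= nth_nil.
have lft : h_left H 0 i j a <-> a = 0.
  by move: jZ; rewrite ltnS leq_eqVlt => /orP[/eqP->|jZ]; [exact: (ed i iZ a a3).1 | exact: (hc i iZ j jZ a a3).1].
split=> //; case: i iK iZ {lft} => [|i] iK iZ; first exact: rd.
rewrite /= nth_nil; move: jZ; rewrite ltnS leq_eqVlt => /orP[/eqP->|jZ].
  exact: (ed i.+1 iZ a a3).2.
exact: (hc i.+1 iZ j jZ a a3).2.
Qed.

Lemma history_sound l x : history E H Z l -> reads_word Z.+1 (h_input H) x ->
  (size x + l).+2 <= Z ->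
  exists2 c, run_of (fun t => `[< h_ans H t >]) c l x &
    forall t, t <= l -> agrees H Z K Z.+1 t (c t).
Proof.
move=> [hs he ht] rd xl.
suff : forall n, n <= l -> exists2 c, run_of (fun t => `[< h_ans H t >]) c n x &
    forall t, t <= n -> agrees H Z K Z.+1 t (c t) by apply.
elim=> [_|n IH nl].
  (* The run is built one configuration at a time; [fits_in_run] keeps it away from cell [Z]. *)
  exists (fun=> init M x) => // -[|//] _.
  by apply: init_agrees => //; [lia | exact: he].
have [c [c0 cs] ca] := IH (ltnW nl).
have fn : fits_in (c n) (size x + n).+1 by apply: (@fits_in_run (fun t => `[< h_ans H t >]) c n).
have [||d st ag] := step_sound (ca n (leqnn n)) _ fn _ (he n.+1 nl) (ht n nl); try lia.
exists (fun t => if t == n.+1 then d else c t).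
  split=> [//|t tn]; rewrite (ltn_eqF tn); case: eqP => [[e]|ne]; first by rewrite e.
  by apply: cs; lia.
by move=> t tn; case: eqP => [->//|ne]; apply: ca; lia.
Qed.

Lemma history_complete an c l x : run_of an c l x ->
  (forall t, t <= l -> agrees H Z Z Z.+2 t (c t)) ->
  (forall t, t < l -> (h_ans H t <-> an t)) -> (size x + l).+2 <= Z ->
  history E H Z l /\ reads_word Z.+1 (h_input H) x.
Proof.
move=> r ag ha xl; have [c0 st] := r; case: (Zbig) => Zs Zr ZK Z3.
have ag0 : agrees H Z Z Z.+2 0 (init M x) by rewrite -c0; exact: ag.
have cell0 i j : left_cell (init M x) i j = None /\ (0 < i -> right_cell (init M x) i j = None).
  rewrite /left_cell /right_cell; case: insubP => [k _ <-|//]; rewrite !ffunE /= nth_nil.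
  split=> //; rewrite -[_ == ord0]/(nat_of_ord k == 0) => k0.
  by rewrite (negbTE (lt0n_neq0 k0)) nth_nil.
split; last first.
  move=> j jZ s s3; rewrite /h_input (ag0.2 0 (ltnW (ltnW Z3)) j (leqW jZ) s s3).2.
  by rewrite (right_cellE (init M x) (ord0 : 'I_K) j) ffunE.
split.
- split=> [q qZ|i iZ j jZ a a3]; first by rewrite ag0.1 // code_start.
  have [-> ->] := ag0.2 i iZ j (leqW (ltnW jZ)) a a3.
  by have [-> h] := cell0 i j; split=> // /h ->.
- move=> t tl i iZ a a3; have f := fits_in_run r tl.
  have le : (size x + t).+1 <= Z by lia.
  have := (ag t tl).2 i iZ Z (leqnSn _) a a3.
  by have [-> ->] := fits_in_cell i f le.
- move=> t tl; apply: (step_complete (ag t (ltnW tl)) (ag t.+1 tl) (ha t tl) (st t tl)).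
    exact: fits_in_run r (ltnW tl).
  by lia.
Qed.
End Semantics.

Inductive run_facts (an : nat -> bool) (c : nat -> config M) : nat -> Prop :=
  | FactState t : run_facts an c (pr 0 (pr t (rank (c t).1)))
  | FactAnswer t : an t -> run_facts an c (pr 1 t)
  | FactLeft t i j : run_facts an c (pr 2 (pr t (pr i (pr j (symbol_code (left_cell (c t) i j))))))
  | FactRight t i j : run_facts an c (pr 3 (pr t (pr i (pr j (symbol_code (right_cell (c t) i j)))))).

(* All the facts about the first [Z] steps, tapes and cells are below it. *)
Definition fact_bound (Z : nat) := (pr 3 (pr Z (pr Z (pr Z.+1 Z)))).+1.

Ltac decode_fact h :=
  match type of h with run_facts _ _ ?u =>
    let v := fresh "v" in let e := fresh "e" in remember u as v eqn:e in h; destruct h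
  end;
  repeat match goal with e : pr _ _ = pr _ _ |- _ => move: e => /pr_inj[? ?] end;
  subst; try discriminate.

Lemma facts_agree H Z an c t : big_enough Z -> t < Z ->
  (forall u, u < fact_bound Z -> (H u <-> run_facts an c u)) ->
  agrees H Z Z Z.+2 t (c t) /\ (h_ans H t <-> an t).
Proof.
move=> [_ _ _ Z3] tZ hH.
have tZ' := ltnW tZ.
split; last first.
  rewrite /h_ans hH; last by rewrite ltnS pr_le // (leq_trans tZ') // leq_pr_l.
  by split=> [h|]; [decode_fact h | exact: FactAnswer].
split=> [q qZ|i iZ j jZ a a3].
  rewrite /h_state hH.
    by split=> [h|->]; [decode_fact h | exact: FactState].
  rewrite ltnS pr_le // pr_le //; apply: leq_trans (leq_pr _ _); apply: leq_trans (leq_pr _ _).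
  exact: ltnW.
have b k : k <= 3 -> pr k (pr t (pr i (pr j a))) < fact_bound Z.
  move=> k3; rewrite ltnS; do !(apply: pr_le => //); first exact: ltnW.
  by apply: leq_trans Z3; exact: ltnW.
rewrite /h_left /h_right !hH ?b //; split; split=> [h|->].
- by decode_fact h.
- exact: FactLeft.
- by decode_fact h.
- exact: FactRight.
Qed.

Lemma machine_code_bound Z u : big_enough Z -> machine_code u ->
  u < (pr 8 (pr Z (pr Z (pr Z Z)))).+1.
Proof.
move=> [Zs Zr ZK Z3] h; rewrite ltnS.
have R (x : state M) : rank x <= Z by apply: ltnW; exact: leq_trans (rank_lt _) Zs.
have Rr (x : rule) : rank x <= Z by apply: ltnW; exact: leq_trans (rank_lt _) Zr.
have Ri (i : 'I_K) : i <= Z by apply: ltnW; exact: leq_trans (ltn_ord i) ZK.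
have S s : symbol_code s <= Z by apply: ltnW; exact: leq_trans (symbol_code_lt s) Z3.
have prr (a b d : nat) : a <= d -> a <= pr b d by move=> ad; exact: leq_trans ad (leq_pr _ _).
case: h => [|q _|q k _|q k _|r _|r i _ _|r i _ _|r i _ _|].
- by apply: pr_le => //; do 3!apply: (prr _ _ _).
- by apply: pr_le => //; do 3!apply: (prr _ _ _).
- by do 2!(apply: pr_le => //); do 2!apply: (prr _ _ _).
- by do 2!(apply: pr_le => //); do 2!apply: (prr _ _ _).
- by do 3!(apply: pr_le => //); apply: (prr _ _ _).
- by do 4!(apply: pr_le => //).
- by do 4!(apply: pr_le => //).
- by do 4!(apply: pr_le => //).
- by apply: pr_le => //; do 3!apply: (prr _ _ _); exact: ltnW.
Qed.
End Machine.

(** * Binary expansions *)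

Definition nbit (c u : nat) : bool := odd (c %/ 2 ^ u).

Lemma nbit_small c u : c < 2 ^ u -> nbit c u = false.
Proof. by move=> h; rewrite /nbit divn_small. Qed.

Lemma bits_exist (P : nat -> bool) U :
  exists2 c, c < 2 ^ U & forall u, nbit c u = (u < U) && P u.
Proof.
elim: U => [|U [c cU hc]]; first by exists 0 => // u; rewrite /nbit div0n.
have p0 u : 0 < 2 ^ u by rewrite expn_gt0.
exists (c + P U * 2 ^ U).
  by rewrite expnS; case: (P U); lia.
move=> u; rewrite /nbit ltnS; case: (ltngtP u U) => uU /=.
- have -> : c + P U * 2 ^ U = (P U * 2 ^ (U - u)) * 2 ^ u + c.
    by rewrite -mulnA -expnD subnK ?(ltnW uU) // addnC.
  rewrite divnMDl // oddD; move: (hc u); rewrite /nbit uU => ->.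
  by rewrite oddM oddX subn_eq0 leqNgt uU andbF.
- rewrite divn_small //; apply: (@leq_trans (2 ^ U.+1)); last by rewrite leq_exp2l.
  by rewrite expnS; case: (P U); lia.
- by rewrite uU addnC divnMDl // divn_small // addn0; case: (P U).
Qed.

Lemma nbit_inj n c d : c < 2 ^ n -> d < 2 ^ n ->
  (forall u, u < n -> nbit c u = nbit d u) -> c = d.
Proof.
elim: n c d => [|n IH] c d; first by rewrite expn0 !ltnS !leqn0 => /eqP-> /eqP->.
move=> cn dn h; have e0 : odd c = odd d by have := h 0 isT; rewrite /nbit !divn1.
have half a : a < 2 ^ n.+1 -> a./2 < 2 ^ n by rewrite expnS; lia.
have e1 : c./2 = d./2.
  apply: IH; [exact: half | exact: half | move=> u un].
  by have := h u.+1 un; rewrite /nbit expnS !divnMA !divn2.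
by rewrite -(odd_double_half c) -(odd_double_half d) e0 e1.
Qed.

Lemma power_tableP V (W : bset) : power_table V W -> forall u, u <= V.+1 -> forall v, v <= V ->
  W (pr 0 (pr u v)) <-> v = 2 ^ u.
Proof.
move=> h; elim=> [|u IH] uV v vV; first exact: (h 0 isT v vV).1.
rewrite (h u uV v vV).2; split=> [[v' [v'V [-> w]]]|e].
  by have := (IH (ltnW uV) v' v'V).1 w => ->; rewrite expnS; lia.
have vE : v = 2 ^ u + 2 ^ u by rewrite e expnS; lia.
exists (2 ^ u); split; first by lia.
by split=> //; apply/IH; [exact: ltnW | lia |].
Qed.

Lemma power_table_holds V (W : bset) :
  (forall u, u <= V.+1 -> forall v, v <= V -> (W (pr 0 (pr u v)) <-> v = 2 ^ u)) ->
  power_table V W.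
Proof.
move=> h u uV v vV; split; first by rewrite h.
rewrite h //; split=> [e|[v' [v'V [-> /h]]]]; last first.
  by move=> ->; rewrite ?expnS; lia.
have vE : v = 2 ^ u + 2 ^ u by rewrite e expnS; lia.
exists (2 ^ u); split; first by lia.
by split=> //; apply/h; lia.
Qed.

Lemma bitP V (W : bset) c u : power_table V W -> c < V -> (bit V W c u <-> nbit c u).
Proof.
move=> /power_tableP h cV; rewrite /bit; split.
  move=> [uV [y [yc [/h w [a [ac [r [ry e]]]]]]]].
  have yE : y = 2 ^ u by apply: w; lia.
  rewrite /nbit {1}e yE divnMDl; last by rewrite expn_gt0.
  by rewrite divn_small -?yE // addn0 /= addnn odd_double.
case: (ltnP u V) => [uV b|Vu]; last first.
  rewrite nbit_small //; apply: (leq_trans cV); apply: (leq_trans Vu).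
  by apply: ltnW; rewrite ltn_expl.
split=> //; exists (2 ^ u).
have p0 : 0 < 2 ^ u by rewrite expn_gt0.
have le : 2 ^ u <= c.
  by rewrite leqNgt; apply/negP => lt; move: b; rewrite /nbit divn_small.
split=> //; split; first by apply/h; lia.
set q := c %/ 2 ^ u; have oq : odd q by [].
have qE : q = (q./2 + q./2).+1.
  by rewrite -{1}(odd_double_half q) oq addnn.
exists q./2; split; first by have := leq_div c (2 ^ u); rewrite -/q; lia.
exists (c %% 2 ^ u); split; first by rewrite ltn_mod.
by rewrite -qE -divn_eq.
Qed.

Lemma machine_number_exists (M : oracle_machine) : exists e, forall u, nbit e u <-> machine_code M u.
Proof.
pose Z := #|state M| + #|{: rule M}| + (last_tape M).+1 + 3.
have bZ : big_enough M Z by rewrite /Z; split; lia.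
have [e _ he] := bits_exist (fun u => `[< machine_code M u >]) (pr 8 (pr Z (pr Z (pr Z Z)))).+1.
exists e => u; rewrite he; split=> [/andP[_ /asboolP]//|h].
by rewrite (machine_code_bound bZ h) asboolT.
Qed.

Definition machine_number (M : oracle_machine) : nat := projT1 (cid (machine_number_exists M)).

(** Stated as an equality of predicates, so that the number of a machine can be rewritten into its
    true tables throughout a formula. *)
Lemma bit_machine_number V (W : bset) M : power_table V W -> machine_number M < V ->
  bit V W (machine_number M) = machine_code M.
Proof.
move=> t h; apply/funext => u; apply/propext; rewrite bitP //.
by rewrite /machine_number; case: cid => e /= ->.
Qed.

(** * Runs of oracle machines *)

Lemma computation_fun (T : Type) (next : T -> T -> Prop) x s :
  computation next x s -> exists c : nat -> T, [/\ c 0 = x, c (size s) = last x s &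
    forall t, t < size s -> next (c t) (c t.+1)].
Proof.
elim: s x => [|y s IH] x /=; first by exists (fun=> x).
move=> [xy /IH[c [c0 cs ct]]]; exists (fun t => if t is t'.+1 then c t' else x).
by split=> //= -[|t] ts; [rewrite c0 | exact: ct].
Qed.

Lemma fun_computation_mkseq (T : Type) (next : T -> T -> Prop) (c : nat -> T) l :
  (forall t, t < l -> next (c t) (c t.+1)) ->
  computation next (c 0) (mkseq (fun t => c t.+1) l).
Proof.
elim: l c => [//|l IH] c h; rewrite /mkseq /=; split; first exact: h.
rewrite -[1]addn0 iotaDl -map_comp.
exact: (IH (fun t => c t.+1) (fun t tl => h t.+1 tl)).
Qed.

Lemma fun_computation (T : Type) (next : T -> T -> Prop) (c : nat -> T) l :
  (forall t, t < l -> next (c t) (c t.+1)) ->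
  exists s, [/\ computation next (c 0) s, size s = l & last (c 0) s = c l].
Proof.
move=> h; exists (mkseq (fun t => c t.+1) l); split; first exact: fun_computation_mkseq.
  exact: size_mkseq.
by case: l {h} => // l; rewrite mkseqS last_rcons.
Qed.

Lemma oracle_stepE (M : oracle_machine) (O : language) (c c' : config M) (b : bool) :
  (asking c -> (b <-> O (word_of c))) -> oracle_step O c c' <-> answer_step b c c'.
Proof.
rewrite /oracle_step /answer_step /asking; case: (query c.1) => [k|//] /(_ isT) h.
have -> : (word_at (c.2 ord_max) \in O) = b.
  by apply/idP/idP; [rewrite inE => w; apply/h; exact: w | move/h; rewrite inE].
by [].
Qed.

Lemma oracle_run (M : oracle_machine) (O : language) (an : nat -> bool) c l x :
  run_of an c l x -> (forall t, t < l -> asking (c t) -> (an t <-> O (word_of (c t)))) ->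
  exists s, [/\ computation (@oracle_step M O) (init M x) s, size s = l &
                last (init M x) s = c l].
Proof.
move=> [<- st] h; apply: fun_computation => t tl.
by apply/(@oracle_stepE M O _ _ (an t)); [exact: h | exact: st].
Qed.

Lemma oracle_run_exists (M : oracle_machine) (O : language) x s :
  computation (@oracle_step M O) (init M x) s ->
  exists c, [/\ run_of (fun t => `[< O (word_of (c t)) >]) c (size s) x &
                c (size s) = last (init M x) s].
Proof.
move=> h; have [c [c0 cs ct]] := computation_fun h; by exists c.
Qed.

(** The bound holds at every length, unlike [bigO]: the formulas need explicit numbers of steps. *)
Definition decides (M : oracle_machine) (O L : language) (u : nat -> nat) :=
  (forall x, L x <-> accepts (@oracle_step M O) x) /\
  forall x s, computation (@oracle_step M O) (init M x) s -> size s <= u (size x).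

Section Coding.
Variables (M : oracle_machine) (O L : language) (u : nat -> nat).
Hypothesis dec : decides M O L u.
Local Notation E := (machine_code M).
Local Notation K := (last_tape M).+1.
Variables (Z y : nat) (w : seq bool).
Hypotheses (Zbig : big_enough M Z) (yZ : (size w + y).+1 <= Z).

Lemma coded_sound H l : l < y -> history E H Z l -> h_accepts E H Z l ->
  reads_word Z.+1 (h_input H) w ->
  (forall t (c : config M), t < l -> agrees H Z K Z.+1 t c -> fits_in c (size w + y) ->
     asking c -> (h_ans H t <-> O (word_of c))) ->
  L w.
Proof.
move=> ly hi ac rd ans.
have wl : (size w + l).+2 <= Z by lia.
have [c r ag] := history_sound Zbig hi rd wl.
apply/dec.1.
have [t tl|s [hs sl ls]] := @oracle_run M O _ c l w r.
  move=> asks_t; have tl' := ltnW tl.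
  rewrite -(ans t (c t) tl (ag t tl') _ asks_t); first by split=> /asboolP.
  have f := fits_in_run r tl'; move=> i; have [f1 f2] := f i; split; lia.
exists s => //; rewrite ls; exact/(accepts_agrees Zbig (ag l (leqnn l))).
Qed.

Lemma run_coded an (c : nat -> config M) l H : run_of an c l w -> l < y ->
  (forall v, v < fact_bound Z -> (H v <-> run_facts an c v)) ->
  [/\ history E H Z l, reads_word Z.+1 (h_input H) w &
      forall t, t <= l -> agrees H Z K Z.+1 t (c t) /\ (h_ans H t <-> an t)].
Proof.
move=> r ly hH; have wl : (size w + l).+2 <= Z by lia.
have fa t : t <= l -> agrees H Z Z Z.+2 t (c t) /\ (h_ans H t <-> an t).
  by move=> tl; apply: facts_agree => //; lia.
have [h1 h2] : history E H Z l /\ reads_word Z.+1 (h_input H) w.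
  apply: (history_complete Zbig r) => // [t tl|t tl]; first exact: (fa t tl).1.
  exact: (fa t (ltnW tl)).2.
split=> // t tl; have [h3 h4] := fa t tl; split=> //.
case: (Zbig) => _ _ ZK _; exact: agrees_weaken h3.
Qed.

Hypothesis uy : u (size w) < y.

Lemma coded_complete : L w -> exists (c : nat -> config M) l,
  [/\ l < y, run_of (fun t => `[< O (word_of (c t)) >]) c l w & accepting (c l).1].
Proof.
move=> /dec.1[s hs ac]; have [c [r cs]] := oracle_run_exists hs.
by exists c, (size s); split; [exact: leq_ltn_trans (dec.2 _ _ hs) uy | | rewrite cs].
Qed.

(* [Q c t] is the condition under which the query at time [t] of the history [c]
   has a positive answer. *)
Lemma number_coded V (Hc : nat -> nat -> Prop) (Q : nat -> nat -> Prop) :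
  2 ^ fact_bound Z <= V -> (forall c, c < V -> forall v, Hc c v <-> nbit c v) ->
  (forall c t (cf : config M), c < V -> agrees (Hc c) Z K Z.+1 t cf -> fits_in cf (size w + y) ->
     (Q c t <-> O (word_of cf))) ->
  L w <-> exists c, c < V /\ exists l, l < y /\
    [/\ history E (Hc c) Z l, h_accepts E (Hc c) Z l, reads_word Z.+1 (h_input (Hc c)) w &
        forall t, t < l -> h_queries E (Hc c) Z t -> (h_ans (Hc c) t <-> Q c t)].
Proof.
move=> UV hc hQ; split=> [/coded_complete[c [l [ly r ac]]]|[c [cV [l [ly [hi ac rd an]]]]]].
  set an := fun t => `[< O (word_of (c t)) >] in r.
  have [d dU hd] := bits_exist (fun v => `[< run_facts an c v >]) (fact_bound Z).
  have dV : d < V by exact: leq_trans UV.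
  have [hi rd ag] : [/\ history E (Hc d) Z l, reads_word Z.+1 (h_input (Hc d)) w &
      forall t, t <= l -> agrees (Hc d) Z K Z.+1 t (c t) /\ (h_ans (Hc d) t <-> an t)].
    apply: (run_coded r ly) => v vU; rewrite hc // hd vU /=.
    by split=> [/asboolP|/asboolP].
  exists d; split=> //; exists l; split=> //; split=> //.
    exact/(accepts_agrees Zbig (ag l (leqnn l)).1).
  move=> t tl _; have [ag1 ->] := ag t (ltnW tl).
  rewrite (hQ d t (c t)) //; first by split=> /asboolP.
  by have f := fits_in_run r (ltnW tl); move=> i; have [f1 f2] := f i; split; lia.
apply: (coded_sound ly hi ac rd) => t cf tl ag f q.
rewrite an //; last exact/(queries_agrees Zbig ag).
exact: hQ.
Qed.
End Coding.

Definition plain (M : machine) : oracle_machine := @OracleMachine M (fun=> None).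

Lemma plain_queries M H Z t : ~ h_queries (machine_code (plain M)) H Z t.
Proof.
move=> [q [_ [_ [q' [_ h]]]]]; rewrite /e_yes in h.
by remember (pr 2 (pr q q')) as v eqn:e in h; destruct h => //; move: e => /pr_inj[].
Qed.

Lemma time_polynomial (M : machine) next (L : language) c :
  @decides_in_time M next L (fun n => n ^ c) ->
  exists A, forall x s, computation next (init M x) s -> size s <= A * (size x).+1 ^ c.
Proof.
move=> [_ [u [a [n0 _ hu]] h]].
(* The sum absorbs the finitely many lengths below [n0], on which [bigO] says nothing; [(size x).+1]
   keeps the power positive at length 0. *)
exists (a + \sum_(i < n0) u i) => x s /h hs; apply: (leq_trans hs).
have p0 : 0 < (size x).+1 ^ c by rewrite expn_gt0.
case: (leqP n0 (size x)) => hx.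
  apply: (leq_trans (hu _ hx)); apply: leq_mul; first exact: leq_addr.
  by case: (c) => // c'; rewrite leq_exp2r.
apply: (@leq_trans (a + \sum_(i < n0) u i)); last by rewrite leq_pmulr.
by rewrite (bigD1 (Ordinal hx)) //= addnCA leq_addr.
Qed.

Transparent pr.

Lemma polynomial_growth f : poly_fun f -> exists k, forall n, 2 <= n -> f n <= n ^ k.
Proof.
move=> /(_ _ (term_var 0))[t ht]; have [k hk] := value_exp t.
by exists k => n n2; rewrite -(ht (fun=> n)); exact: hk.
Qed.

Lemma term_fact_bound f : is_term f -> is_term (fun th => fact_bound (f th)).
Proof.
move=> hf; rewrite /fact_bound.
by repeat first [ eassumption | simple apply term_const | simple apply term_succ | simple apply term_pr ].
Qed.

Lemma fact_bound_polynomial f : poly_fun f -> poly_fun (fact_bound \o f).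
Proof. by move=> hf h /hf; exact: term_fact_bound. Qed.

(** * Correctness of the exponential search *)

Section TowerBody.
Variables (M0 M1 : oracle_machine) (MD : machine) (L A D : language) (u : nat -> nat).
Hypotheses (dec0 : decides M0 A L u) (dec1 : decides M1 D A u)
  (decD : decides (plain MD) set0 D u) (mono : forall a b, a <= b -> u a <= u b).
Variables (X W : bset) (V Z y0 y1 y2 : nat) (x : seq bool).
Hypotheses (big0 : big_enough M0 Z) (big1 : big_enough M1 Z) (bigD : big_enough (plain MD) Z).
Hypotheses (table : power_table V W) (VZ : 2 ^ fact_bound Z <= V).
Local Notation m := (size x).
Hypotheses (uy0 : u m < y0) (uy1 : u (m + y0) < y1) (uy2 : u (m + y0 + y1) < y2).
Hypothesis yZ : (m + y0 + y1 + y2).+1 <= Z.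
Local Notation H := (bit V W).

Let hH c : c < V -> forall v, H c v <-> nbit c v.
Proof. by move=> cV v; exact: bitP. Qed.

(** The levels are treated from the inside out. A run asks words longer than its input by at most
    its time bound, whence the arguments [m + y0] and [m + y0 + y1] of [u]. At this level there is
    no query, so the condition on answers is empty. *)
Lemma bottom_coded w : size w <= m + y0 + y1 ->
  D w <-> exists c, c < V /\ exists l, l < y2 /\
    [/\ history (machine_code (plain MD)) (H c) Z l, h_accepts (machine_code (plain MD)) (H c) Z l &
        reads_word Z.+1 (h_input (H c)) w].
Proof.
move=> wm.
rewrite (number_coded decD bigD (y := y2) (Hc := H) (Q := fun _ _ => False) _ _ VZ hH) //.
- split=> -[c [cV [l [ly]]]].
    by move=> [hi ac rd _]; exists c; split=> //; exists l.
  move=> [hi ac rd]; exists c; split=> //; exists l; split=> //; split=> // t _ q.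
  by case: (@plain_queries MD (H c) Z t).
- by apply: leq_trans yZ; rewrite ltnS leq_add2r.
- by apply: leq_ltn_trans uy2; exact: mono.
Qed.

Lemma middle_coded w : size w <= m + y0 ->
  A w <-> exists c', c' < V /\ exists l', l' < y1 /\
    [/\ history (machine_code M1) (H c') Z l', h_accepts (machine_code M1) (H c') Z l',
        reads_word Z.+1 (h_input (H c')) w &
        forall t', t' < l' -> h_queries (machine_code M1) (H c') Z t' -> (h_ans (H c') t' <->
          exists c'', c'' < V /\ exists l'', l'' < y2 /\
          [/\ history (machine_code (plain MD)) (H c'') Z l'',
              h_accepts (machine_code (plain MD)) (H c'') Z l'' &
              asks (machine_code M1) (H c') Z t' (h_input (H c''))])].
Proof.
move=> wm.
have uy : u (size w) < y1 by apply: leq_ltn_trans uy1; exact: mono.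
have wZ : (size w + y1).+1 <= Z by move: yZ; lia.
apply: (number_coded dec1 big1 wZ uy VZ hH (Q := fun c' t' => exists c'', c'' < V /\ exists l'', l'' < y2 /\
  [/\ history (machine_code (plain MD)) (H c'') Z l'',
      h_accepts (machine_code (plain MD)) (H c'') Z l'' &
      asks (machine_code M1) (H c') Z t' (h_input (H c''))])).
move=> c t cf cV ag f.
rewrite bottom_coded; last first.
  by rewrite (leq_trans (size_word_at _)) // (leq_trans (f ord_max).2) //; lia.
have as_ I := asks_agrees big1 I ag f wZ.
by split=> -[c'' [cV' [l'' [ly [hi ac rd]]]]]; exists c''; split=> //; exists l''; split=> //;
  split=> //; move: rd; rewrite as_.
Qed.

Lemma top_coded : L x <-> exists c, c < V /\ exists l, l < y0 /\
  [/\ history (machine_code M0) (H c) Z l, h_accepts (machine_code M0) (H c) Z l,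
      reads_word Z.+1 (h_input (H c)) x &
      forall t, t < l -> h_queries (machine_code M0) (H c) Z t -> (h_ans (H c) t <->
      exists c', c' < V /\ exists l', l' < y1 /\
      [/\ history (machine_code M1) (H c') Z l', h_accepts (machine_code M1) (H c') Z l',
        asks (machine_code M0) (H c) Z t (h_input (H c')) &
        forall t', t' < l' -> h_queries (machine_code M1) (H c') Z t' -> (h_ans (H c') t' <->
          exists c'', c'' < V /\ exists l'', l'' < y2 /\
          [/\ history (machine_code (plain MD)) (H c'') Z l'',
              h_accepts (machine_code (plain MD)) (H c'') Z l'' &
              asks (machine_code M1) (H c') Z t' (h_input (H c''))])])].
Proof.
have wZ : (m + y0).+1 <= Z by move: yZ; lia.
apply: (number_coded dec0 big0 wZ uy0 VZ hH (Q := fun c t =>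
  exists c', c' < V /\ exists l', l' < y1 /\
      [/\ history (machine_code M1) (H c') Z l', h_accepts (machine_code M1) (H c') Z l',
        asks (machine_code M0) (H c) Z t (h_input (H c')) &
        forall t', t' < l' -> h_queries (machine_code M1) (H c') Z t' -> (h_ans (H c') t' <->
          exists c'', c'' < V /\ exists l'', l'' < y2 /\
          [/\ history (machine_code (plain MD)) (H c'') Z l'',
              h_accepts (machine_code (plain MD)) (H c'') Z l'' &
              asks (machine_code M1) (H c') Z t' (h_input (H c''))])])).
move=> c t cf cV ag f.
rewrite middle_coded; last first.
  by rewrite (leq_trans (size_word_at _)) // (leq_trans (f ord_max).2).
have as_ I := asks_agrees big0 I ag f wZ.
by split=> -[c'' [cV' [l'' [ly [hi ac rd an]]]]]; exists c''; split=> //; exists l''; split=> //;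
  split=> //; move: rd; rewrite as_.
Qed.
End TowerBody.

Lemma take_word_code x n j : n <= size x ->
  forall s, s < 3 ->
  (s = symbol_code (nth None (map Some (take n x)) j) <->
   (j < n /\ (s = 2 /\ nth false x j \/ s = 1 /\ ~ nth false x j) \/ n <= j /\ s = 0)).
Proof.
move=> nx s s3; have sz : size (take n x) = n by rewrite size_take_min; apply/minn_idPl.
case: (ltnP j n) => jn.
  rewrite (nth_map false) ?sz // nth_take //.
  by case: (nth false x j) => /=; split=> h; intuition lia.
by rewrite nth_default ?size_map ?sz //=; split=> h; intuition lia.
Qed.

(** Complementation costs nothing here: the only guessed object is the table of powers, which stands
    outside the negation, and everything below is a search over numbers that code full runs. The
    padding [n ^ k] makes room for these numbers. *)
Lemma tower_exists (g : nat -> nat) (L : language) : NP_T (P_T g NP) L ->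
  exists k p, 0 < k /\ forall x n, 2 <= n -> size x = n ^ k ->
    (guessed_language p x <-> ~ L (take n x)).
Proof.
move=> [A [D [cD _ [MD tD]] [M1 [c1 [_ t1 _]]]] [M0 [c0 t0]]].
have [a0 b0] := time_polynomial t0; have [a1 b1] := time_polynomial t1.
have [aD bD] := time_polynomial tD.
pose u n := a0 * n.+1 ^ c0 + a1 * n.+1 ^ c1 + aD * n.+1 ^ cD.
have dec0 : decides M0 A L u.
  split=> [x|x s /b0 h]; first exact: t0.1.
  by apply: (leq_trans h); rewrite /u -addnA leq_addr.
have dec1 : decides M1 D A u.
  split=> [x|x s /b1 h]; first exact: t1.1.
  by apply: (leq_trans h); rewrite /u addnAC leq_addl.
have decD : decides (plain MD) set0 D u.
  split=> [x|x s h]; first exact: tD.1.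
  by apply: (leq_trans (bD x s h)); rewrite /u leq_addl.
have mono a b : a <= b -> u a <= u b.
  have e c : a <= b -> a.+1 ^ c <= b.+1 ^ c by case: c => // c ab; rewrite leq_exp2r.
  by move=> ab; rewrite /u !leq_add // leq_mul // e.
pose B := #|state M0| + #|{: rule M0}| + (last_tape M0).+1 +
  (#|state M1| + #|{: rule M1}| + (last_tape M1).+1) +
  (#|state (plain MD)| + #|{: rule (plain MD)}| + (last_tape (plain MD)).+1) + 3 +
  (machine_number M0 + machine_number M1 + machine_number (plain MD)).
pose y0 n := (u n).+1.
pose y1 n := (u (n + y0 n)).+1.
pose y2 n := (u (n + y0 n + y1 n)).+1.
pose z n := (n + y0 n + y1 n + y2 n + B).+1.
have pu : poly_fun u.
  move=> h th; rewrite /u; repeat first [ eassumption | simple apply term_const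
    | simple apply term_succ | simple apply term_add | simple apply term_mul | simple apply term_exp ].
have p0 : poly_fun y0 by move=> h th; apply: term_succ; exact: pu.
have p1 : poly_fun y1.
  by move=> h th; apply: term_succ; apply: pu; apply: term_add => //; exact: p0.
have p2 : poly_fun y2.
  move=> h th; apply: term_succ; apply: pu; apply: term_add; last exact: p1.
  by apply: term_add => //; exact: p0.
have pz : poly_fun z.
  move=> h th; apply: term_succ; apply: term_add; last exact: term_const.
  apply: term_add; last exact: p2.
  by apply: term_add; [apply: term_add => //; exact: p0 | exact: p1].
have pq := fact_bound_polynomial pz.
set q := fact_bound \o z in pq.
(* With [V = 2 ^ q n], the largest address of the table is the square of [pr V.+1 V <= 16 * V ^ 2],
   hence below [2 ^ (q n * 4 + 9)]. The summand [n] ensures [n <= n ^ k]. *)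
have [k hk] : exists k, forall n, 2 <= n -> q n * 4 + 9 + n <= n ^ k.
  apply: polynomial_growth => h th; apply: term_add => //.
  apply: term_add; last exact: term_const.
  by apply: term_mul; [exact: pq | exact: term_const].
have [p hp] := def_tower (machine_number M0) (machine_number M1) (machine_number (plain MD)) k
  p0 p1 p2 pz pq.
have k0 : 0 < k.
  by rewrite lt0n; apply/eqP => k0; have := hk 2 isT; rewrite k0 expn0; lia.
exists k, p; split=> // x n n2 xn.
have nk : n <= size x by rewrite xn; have := hk n n2; lia.
pose Z := z n; pose V := 2 ^ q n.
have sz : size (take n x) = n by rewrite size_take_min; apply/minn_idPl.
have ZV : Z < V.
  apply: leq_ltn_trans (_ : q n < V); last by rewrite ltn_expl.
  rewrite /q /= /fact_bound; apply: ltnW; rewrite ltnS.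
  by do 4!(apply: (leq_trans _ (leq_pr _ _))).
have big : [/\ big_enough M0 Z, big_enough M1 Z & big_enough (plain MD) Z].
  by split; rewrite /big_enough /Z /z /B; split; lia.
have num : [/\ machine_number M0 < V, machine_number M1 < V & machine_number (plain MD) < V].
  by split; apply: leq_ltn_trans ZV; rewrite /Z /z /B; lia.
have VN : pr 0 (pr V.+1 V) < 2 ^ size x.
  apply: (@leq_trans (2 ^ (q n * 4 + 9))); last first.
    by rewrite leq_exp2l // xn; apply: leq_trans (hk n n2); lia.
  have V1 : 0 < V by rewrite expn_gt0.
  rewrite expnD expnM -/V.
  have h1 : pr V.+1 V <= 16 * V ^ 2 by rewrite /pr expnS expn1; nia.
  apply: (@leq_ltn_trans ((16 * V ^ 2) * (16 * V ^ 2))).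
    by rewrite {1}/pr !add0n addn0; apply: leq_mul.
  have V4 : V ^ 2 * V ^ 2 = V ^ 4 by rewrite -expnD.
  have V40 : 0 < V ^ 4 by rewrite expn_gt0 V1.
  by rewrite mulnACA V4; lia.
have body (W : bset) : power_table V W ->
    (exists c, c < V /\ exists l, l < y0 n /\
    [/\ history (bit V W (machine_number M0)) (bit V W c) (z n) l,
       h_accepts (bit V W (machine_number M0)) (bit V W c) (z n) l,
       forall j, j < (z n).+1 -> forall s, s < 3 -> (h_input (bit V W c) j s <->
         j < n /\ (s = 2 /\ nth false x j \/ s = 1 /\ ~ nth false x j) \/ n <= j /\ s = 0) &
       forall t, t < l -> h_queries (bit V W (machine_number M0)) (bit V W c) (z n) t ->
       (h_ans (bit V W c) t <->
        exists c', c' < V /\ exists l', l' < y1 n /\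
        [/\ history (bit V W (machine_number M1)) (bit V W c') (z n) l',
            h_accepts (bit V W (machine_number M1)) (bit V W c') (z n) l',
            asks (bit V W (machine_number M0)) (bit V W c) (z n) t (h_input (bit V W c')) &
            forall t', t' < l' -> h_queries (bit V W (machine_number M1)) (bit V W c') (z n) t' ->
            (h_ans (bit V W c') t' <->
             exists c'', c'' < V /\ exists l'', l'' < y2 n /\
             [/\ history (bit V W (machine_number (plain MD))) (bit V W c'') (z n) l'',
                 h_accepts (bit V W (machine_number (plain MD))) (bit V W c'') (z n) l'' &
                 asks (bit V W (machine_number M1)) (bit V W c') (z n) t' (h_input (bit V W c''))])])]) <->
    L (take n x).
  move=> tab; have [n0 n1 nD] := num; have [b0' b1' bD'] := big.
  rewrite !(bit_machine_number tab) //.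
  have VZ : 2 ^ fact_bound Z <= V by [].
  have yZ : (size (take n x) + y0 n + y1 n + y2 n).+1 <= Z by rewrite sz /Z /z; lia.
  have h0 : u (size (take n x)) < y0 n by rewrite sz.
  have h1 : u (size (take n x) + y0 n) < y1 n by rewrite sz.
  have h2 : u (size (take n x) + y0 n + y1 n) < y2 n by rewrite sz.
  rewrite (top_coded dec0 dec1 decD mono b0' b1' bD' tab VZ h0 h1 h2 yZ).
  have rd c : (forall j, j < Z.+1 -> forall s, s < 3 -> (h_input (bit V W c) j s <->
      j < n /\ (s = 2 /\ nth false x j \/ s = 1 /\ ~ nth false x j) \/ n <= j /\ s = 0)) <->
      reads_word Z.+1 (h_input (bit V W c)) (take n x).
    by split=> h j jZ s s3; rewrite h // take_word_code.
  by split=> -[c [cV [l [ly [hi ac /rd inp an]]]]]; exists c; split=> //; exists l.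
have npow n' : n ^ k = n' ^ k -> n' = n.
  by move/eqP; rewrite eqn_exp2r // => /eqP.
(* Any guess that passes the tests is the intended one where it matters: [n'] is a [k]-th root,
   hence [n], and a correct table forces [V'] to be [2 ^ q n]. *)
split=> [[w /hp[n' [_ [e [V' [V'N [tab [qV [pw nex]]]]]]]]]|nL].
  have n'E : n' = n by apply: npow; rewrite -xn.
  subst n'; have V'E : V' = V by apply/(power_tableP tab (leqW qV) (leqnn _)).
  by subst V' => /(body _ tab).
pose w idx := `[< exists a, idx = pr 0 (pr a (2 ^ a)) >].
have tab : power_table V (fun v => (v < 2 ^ size x) && w v).
  apply: power_table_holds => a aV b bV.
  have -> : pr 0 (pr a b) < 2 ^ size x.
    by apply: leq_ltn_trans VN; do 2!(apply: pr_le => //).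
  by split=> [/asboolP[a' /pr_inj[_ /pr_inj[-> ->]]]//|->]; apply/asboolP; exists a.
exists w; apply/hp; exists n; split; first exact: nk.
split; first exact: xn.
exists V; split.
  apply: leq_ltn_trans VN; apply: (leq_trans _ (leq_pr _ _)); exact: leq_pr.
split=> //; split; first by apply: ltnW; rewrite ltn_expl.
split; last by move=> /(body _ tab).
apply/(power_tableP tab) => //.
by apply: leqW; apply: ltnW; rewrite ltn_expl.
Qed.

(** * Answer patterns of a deterministic oracle machine *)

Definition accepts_within (M : machine) (w : seq bool) (y : nat) :=
  exists (c : nat -> config (plain M)) l,
    [/\ l < y, run_of (fun=> false) c l w & accepting (c l).1].

Lemma accepts_within_sound M (L : language) u w y :
  decides (plain M) set0 L u -> accepts_within M w y -> L w.
Proof.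
move=> [dec _] [c [l [_ r ac]]]; apply/dec.
have [//|s [hs sl ls]] := @oracle_run (plain M) set0 _ c l w r.
by exists s => //; rewrite ls.
Qed.

Lemma accepts_within_complete M (L : language) u w y :
  decides (plain M) set0 L u -> u (size w) < y -> L w -> accepts_within M w y.
Proof.
move=> dec uy /(coded_complete dec uy)[c [l [ly [c0 st] ac]]].
by exists c, l; split=> //; split=> // t tl; exact: (st t tl).
Qed.

Fixpoint asked (M : oracle_machine) (c : nat -> config M) (t : nat) : nat :=
  if t is t'.+1 then asked c t' + asking (c t') else 0.

Lemma asked_lt (M : oracle_machine) (c : nat -> config M) s t : s < t -> asking (c s) -> asked c s < asked c t.
Proof.
elim: t => // t IH; rewrite ltnS leq_eqVlt => /orP[/eqP->|st] as_ /=.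
  by rewrite as_ addn1.
by apply: leq_trans (leq_addr _ _); exact: IH.
Qed.

Lemma asked_card (M : oracle_machine) (c : nat -> config M) l : asked c l = #|[pred t : 'I_l | asking (c t)]|.
Proof.
rewrite -sum1_card (eq_bigl (fun t : 'I_l => asking (c t))); last by move=> t; rewrite inE.
rewrite big_mkcond /=; elim: l => [|l IH]; first by rewrite big_ord0.
by rewrite big_ord_recr /= IH; case: asking.
Qed.

Lemma halting_run (T : Type) (next : T -> T -> Prop) x b :
  halts_within next x b -> exists s, computation next x s /\ forall y, ~ next (last x s) y.
Proof.
elim: b x => [|b IH] x h.
  by exists [::]; split=> // y xy; have := h [:: y] (conj xy I).
case: (pselect (exists y, next x y)) => [[y xy]|n]; last first.
  by exists [::]; split=> // y xy; apply: n; exists y.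
have [|s [hs ls]] := IH y; first by move=> s ys; have := h (y :: s) (conj xy ys).
by exists (y :: s).
Qed.

Section Patterns.
Variables (M : oracle_machine) (MB MD : machine) (m Y G : nat).
Hypothesis det : deterministic M.

(* The pattern [f] lists the answers to the queries of the halting computation [c]. *)
Definition pattern_run (q : seq bool) (f : nat -> bool) (c : nat -> config M) (l : nat) :=
  [/\ l < Y, run_of f c l q, halted (c l) &
      forall t, f t -> t < l /\ asking (c t)].

(** Distinct labels below [G] bound the number of queries in a way that a bounded formula can state.
    Negative answers are not checked at all: false ones are allowed, and only the comparison of
    patterns discards them. *)
Definition valid_pattern (q : seq bool) (f : nat -> bool) :=
  [/\ size q <= m, accepts_within MB q Y & exists (c : nat -> config M) l, [/\ pattern_run q f c l,
     exists lab : nat -> nat, forall t, t < l -> asking (c t) ->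
       lab t < G /\ forall t', t' < t -> asking (c t') -> lab t' <> lab t &
     forall t, f t -> accepts_within MD (word_of (c t)) Y]].

Lemma answer_step_det b (c c1 c2 : config M) :
  answer_step b c c1 -> answer_step b c c2 -> c1 = c2.
Proof.
rewrite /answer_step; case: (query c.1) => [k -> -> //|].
move=> [b1 d1 e1] [b2 d2 e2]; have [s e] := det d1 d2.
by case: c1 c2 d1 d2 e1 e2 s => [q1 t1] [q2 t2] /= _ _ -> -> ->; rewrite e.
Qed.

Lemma asking_not_halted (c : config M) : asking c -> ~ halted c.
Proof.
rewrite /asking; case e: (query c.1) => [k|//] _ h.
by apply: (h true (k true, c.2)); rewrite /answer_step e.
Qed.

Lemma same_run q (f f' : nat -> bool) (c c' : nat -> config M) l l' t : run_of f c l q -> run_of f' c' l' q ->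
  (forall s, s < t -> f s = f' s) -> t <= l -> t <= l' -> c t = c' t.
Proof.
move=> [c0 h] [c0' h']; elim: t => [|t IH] ff tl tl'; first by rewrite c0 c0'.
apply: (answer_step_det (h t tl)); rewrite (IH _ (ltnW tl) (ltnW tl')).
  by rewrite ff //; exact: h'.
by move=> s st; apply: ff; exact: ltnW.
Qed.

(* Two runs with the same answers before [t] agree up to [t]: if the first one asks
   at [t], then so does the second one. *)
Lemma same_query q (f f' : nat -> bool) (c c' : nat -> config M) l l' t : pattern_run q f c l -> pattern_run q f' c' l' ->
  (forall s, s < t -> f s = f' s) -> t < l -> asking (c t) ->
  [/\ t < l', c' t = c t & asking (c' t)].
Proof.
move=> [_ r h _] [_ r' h' _] ff tl as_.
have tl' : t <= l'.
  rewrite leqNgt; apply/negP => lt.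
  have e := same_run r r' (fun s sl => ff s (ltn_trans sl lt)) (ltnW (ltn_trans lt tl)) (leqnn l').
  by apply: (h' (f l') (c l'.+1)); rewrite -e; apply: r.2; exact: ltn_trans tl.
have e := same_run r r' ff (ltnW tl) tl'.
rewrite -e; split=> //; move: tl'; rewrite leq_eqVlt => /orP[/eqP tl'|//].
by case: (asking_not_halted as_); rewrite e tl'.
Qed.

Lemma first_difference (f f' : nat -> bool) : (exists t, f t <> f' t) ->
  exists t, f t <> f' t /\ forall s, s < t -> f s = f' s.
Proof.
move=> [t0 h0].
have h : exists t, f t != f' t by exists t0; apply/eqP.
exists (ex_minn h); case: ex_minnP => t /eqP ht min; split=> // s st.
by apply/eqP; apply/negPn/negP => /min; rewrite leqNgt st.
Qed.

(** Query times depend on earlier answers and range below [Y]; numbering the queries instead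
    compresses a pattern to [G] bits. *)
Definition answers_by_index (c : nat -> config M) (l : nat) (f : nat -> bool) (i : nat) : bool :=
  `[< exists t, [/\ t < l, asking (c t), asked c t = i & f t] >].

Lemma asked_run q (f f' : nat -> bool) (c c' : nat -> config M) l l' t : run_of f c l q -> run_of f' c' l' q ->
  (forall s, s < t -> f s = f' s) -> t <= l -> t <= l' -> asked c t = asked c' t.
Proof.
move=> r r'; elim: t => //= t IH ff tl tl'.
have ff' s : s < t -> f s = f' s by move=> st; apply: ff; exact: ltnW.
by rewrite IH ?(same_run r r' ff') //; exact: ltnW.
Qed.

(** Up to the first time at which two patterns differ, the two runs coincide and have asked equally
    often. The query at that time thus has the same index in both, with different answers. *)
Lemma answers_by_index_inj q (f f' : nat -> bool) (c c' : nat -> config M) l l' : pattern_run q f c l -> pattern_run q f' c' l' ->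
  asked c l <= G -> asked c' l' <= G ->
  (forall i, i < G -> answers_by_index c l f i = answers_by_index c' l' f' i) -> f = f'.
Proof.
move=> p p' cG cG' ff; apply/funext => t; apply/eqP; apply/negPn/negP => /eqP ne.
have [{ne}t [ne same]] := first_difference (ex_intro _ t ne).
(* By symmetry the first pattern is the one that answers yes at [t], which makes [t] a time of
   query. *)
wlog ft : f f' c c' l l' p p' cG cG' ff ne same / f t.
  move=> th; case e: (f t); first exact: (th f f' c c' l l').
  case e': (f' t); last by rewrite e e' in ne.
  by apply: (th f' f c' c l' l) => // [i iG|/esym //|s st]; [rewrite ff | rewrite same].
have [tl as_] : t < l /\ asking (c t) by case: p => _ _ _; apply.
have [tl' ct as'] := same_query p p' same tl as_.
have [_ r _ _] := p; have [_ r' _ _] := p'.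
have ae := asked_run r r' same (ltnW tl) (ltnW tl').
have iG : asked c t < G by apply: leq_trans cG; exact: asked_lt.
have : answers_by_index c l f (asked c t) by apply/asboolP; exists t.
rewrite ff // => /asboolP[t' [t'l' as'' e f't']].
have tt : t' = t.
  case: (ltngtP t' t) => // lt.
    by have := asked_lt lt as''; rewrite e ae ltnn.
  by have := asked_lt lt as'; rewrite e ae ltnn.
by apply: ne; rewrite ft -tt f't'.
Qed.

Lemma asked_le_labels (c : nat -> config M) l (lab : nat -> nat) : (forall t, t < l -> asking (c t) ->
    lab t < G /\ forall t', t' < t -> asking (c t') -> lab t' <> lab t) ->
  asked c l <= G.
Proof.
move=> h; rewrite asked_card; set S := [pred t | _].
(* [inord] needs a nonempty range; for [G = 0] no query can have a label. *)
case: (posnP G) => [G0|G0].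
  rewrite G0 leqn0; apply/eqP/eq_card0 => t; rewrite !inE.
  by apply/negP => /(h _ (ltn_ord t))[]; rewrite G0.
have inj : {in S &, injective (fun t : 'I_l => inord (lab t) : 'I_G.-1.+1)}.
  move=> s t; rewrite !inE => as_ at_ /(congr1 (@nat_of_ord _)).
  have [sG hs] := h _ (ltn_ord s) as_; have [tG ht] := h _ (ltn_ord t) at_.
  rewrite !inordK ?prednK // => e; apply: ord_inj.
  case: (ltngtP s t) => // lt; first by case: (ht _ lt as_).
  by case: (hs _ lt at_).
by rewrite -(card_in_imset inj) (leq_trans (max_card _)) // card_ord prednK.
Qed.

Definition entry : finType := (m.-bseq bool * {ffun 'I_Y -> bool})%type.

Definition pattern_of (f : {ffun 'I_Y -> bool}) (t : nat) : bool :=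
  if insub t is Some i then f i else false.

Definition valid_entry : pred entry := fun e => `[< valid_pattern e.1 (pattern_of e.2) >].

Lemma pattern_of_inj : injective pattern_of.
Proof.
move=> f f' e; apply/ffunP => i; have := congr1 (fun h => h (nat_of_ord i)) e.
by rewrite /pattern_of valK.
Qed.

Lemma valid_entry_exists q f : valid_pattern q f ->
  exists e, [/\ valid_entry e, e.1 = q :> seq bool & pattern_of e.2 = f].
Proof.
move=> v; have [qm _ [c [l [[lY _ _ fl] _ _]]]] := v.
have fE : pattern_of [ffun i : 'I_Y => f i] = f.
  apply/funext => t; rewrite /pattern_of; case: insubP => [i _ <-|]; first by rewrite ffunE.
  rewrite -leqNgt => Yt; apply/esym/negbTE/negP => /fl[tl _].
  by have := ltn_trans tl lY; rewrite ltnNge Yt.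
by exists (Bseq qm, [ffun i : 'I_Y => f i]); split=> //; apply/asboolP; rewrite fE.
Qed.

(** An entry is determined by its word and by its [G] answers in order of queries. This bound makes
    the census short when B is sparse. *)
Lemma card_valid_entry (B : pred (m.-bseq bool)) :
  (forall e, valid_entry e -> B e.1) -> #|valid_entry| <= #|B| * 2 ^ G.
Proof.
move=> vB.
have run (e : entry) : valid_entry e -> {cl : (nat -> config M) * nat |
    pattern_run e.1 (pattern_of e.2) cl.1 cl.2 /\ asked cl.1 cl.2 <= G}.
  move=> /asboolP[_ _ h]; apply: cid; move: h => [c [l [p [lab hl] _]]].
  by exists (c, l); split=> //; exact: asked_le_labels hl.
pose code (e : entry) : m.-bseq bool * {ffun 'I_G -> bool} :=
  (e.1, if pselect (valid_entry e) is left h then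
          [ffun i : 'I_G => answers_by_index (sval (run e h)).1 (sval (run e h)).2 (pattern_of e.2) i]
        else [ffun=> false]).
have inj : {in valid_entry &, injective code}.
  move=> [q f] [q' f'] v v' [/= qq]; subst q'.
  case: pselect => // h; case: pselect => // h' /ffunP ff; congr pair.
  apply: pattern_of_inj.
  case: (run _ h) ff => -[c l] [/= p cG]; case: (run _ h') => -[c' l'] [/= p' cG'] ff.
  apply: (answers_by_index_inj p p' cG cG') => i iG.
  by have := ff (Ordinal iG); rewrite !ffunE.
rewrite -(card_in_image inj).
have -> : 2 ^ G = #|{: {ffun 'I_G -> bool}}| by rewrite card_ffun card_bool card_ord.
rewrite -cardX; apply: subset_leq_card; apply/fintype.subsetP => _ /fintype.imageP[e ve ->].
by rewrite inE /= andbT; exact: vB.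
Qed.

Section Truth.
Variables (A D : language) (u : nat -> nat) (g : nat -> nat).
Hypotheses (decM : decides M D A u) (decD : decides (plain MD) set0 D u).
Hypothesis mono : forall a b, a <= b -> u a <= u b.
Hypotheses (uY : u (m + u m).+1 < Y) (atmost : makes_at_most_queries M D g).
Hypothesis gG : forall n, n <= m -> g n <= G.

Definition truthful (f : nat -> bool) (c : nat -> config M) (l : nat) :=
  forall t, t < l -> asking (c t) -> (f t <-> D (word_of (c t))).

Lemma answer_step_irrelevant b b' (c c' : config M) :
  ~~ asking c -> answer_step b c c' -> answer_step b' c c'.
Proof. by rewrite /asking /answer_step; case: (query c.1). Qed.

(** The true computation is one of the patterns: its queries are labelled by their rank, [g] bounds
    their number by [G], and a positive answer of D has an accepting run of fewer than [Y] steps. *)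
Lemma true_pattern q : size q <= m -> accepts_within MB q Y ->
  exists f, valid_pattern q f /\ exists c l, pattern_run q f c l /\ truthful f c l.
Proof.
move=> qm qB.
have [s [hs ls]] := halting_run (fun s => decM.2 q s).
have [c [r cs]] := oracle_run_exists hs.
have sl := decM.2 _ _ hs; set l := size s in sl cs r.
have lu : l <= u m by exact: leq_trans (mono qm).
(* The answers are set to false outside the queries, as [pattern_run] demands; this changes no
   step. *)
pose f t := [&& t < l, asking (c t) & `[< D (word_of (c t)) >]].
have rf : run_of f c l q.
  split=> [|t tl]; first exact: r.1.
  have := r.2 t tl; case: (boolP (asking (c t))) => as_; last exact: answer_step_irrelevant.
  by rewrite /f tl as_.
have hl : halted (c l).
  move=> b c'; rewrite /answer_step => h; apply: (ls (if query (c l).1 is Some k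
    then (k (word_at ((c l).2 ord_max) \in D), (c l).2) else c')).
  by rewrite -cs /oracle_step; case: query h.
have lY : l < Y.
  by apply: leq_ltn_trans uY; apply: (leq_trans sl); apply: mono; lia.
have pf : pattern_run q f c l by split=> // t /and3P[].
have cG : asked c l <= G.
  have h : computation (@oracle_step M D) (init M q) (mkseq (fun t => c t.+1) l).
    rewrite -r.1; apply: fun_computation_mkseq => t tl.
    by apply/(@oracle_stepE M D _ _ `[< D (word_of (c t)) >]) => [_|]; [split=> /asboolP | exact: r.2].
  apply: leq_trans (gG qm); apply: leq_trans (atmost h).
  have -> : init M q :: mkseq (fun t => c t.+1) l = mkseq c l.+1.
    by rewrite /mkseq /= -[1]addn0 iotaDl -map_comp -r.1.
  rewrite mkseqS -cats1 count_cat; apply: leq_trans (leq_addr _ _).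
  elim: (l) => // k IH; rewrite mkseqS -cats1 count_cat /= addn0.
  by rewrite leq_add2r.
exists f; split; last first.
  by exists c, l; split=> // t tl as_; rewrite /f tl as_ /=; split=> /asboolP.
split=> //; exists c, l; split=> //.
  exists (asked c) => t tl as_; split=> [|t' t't as']; first by apply: leq_trans cG; exact: asked_lt.
  by apply/eqP; rewrite ltn_eqF //; exact: asked_lt.
move=> t /and3P[tl as_ /asboolP dw]; apply: (accepts_within_complete decD) => //.
apply: leq_ltn_trans uY; apply: mono; apply: (leq_trans (size_word_at _)).
apply: (leq_trans ((fits_in_run rf (ltnW tl)) ord_max).2).
by rewrite ltnS leq_add // (leq_trans (ltnW tl)).
Qed.

(** Before the first difference both runs coincide, so the same word is asked there. If [f] answered
    yes, its witness would put the word in D and the truth would agree. Errors are thus only missing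
    positive answers, and the truth is the lexicographic maximum. *)
Lemma truth_beats q f c l f0 c0 l0 t : pattern_run q f c l ->
  (forall s, f s -> accepts_within MD (word_of (c s)) Y) ->
  pattern_run q f0 c0 l0 -> truthful f0 c0 l0 ->
  f t <> f0 t -> (forall s, s < t -> f s = f0 s) -> f0 t /\ ~ f t.
Proof.
move=> p ver p0 tr ne same.
suff nft : ~ f t by case e: (f0 t) => //; case e': (f t) nft ne => //; rewrite e.
move=> ft; have [tl as_] : t < l /\ asking (c t) by case: p => _ _ _; apply.
have [tl0 ct as0] := same_query p p0 same tl as_.
apply: ne; rewrite ft; apply/esym/(tr t tl0 as0); rewrite ct.
exact: (accepts_within_sound decD (ver t ft)).
Qed.
End Truth.
End Patterns.

(** * Correctness of the census *)

Lemma history_prefix E H Z l l' : l' <= l -> history E H Z l -> history E H Z l'.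
Proof.
by move=> ll [h1 h2 h3]; split=> // t tl; [apply: h2; exact: leq_trans tl _ | apply: h3; exact: leq_trans tl ll].
Qed.

Lemma plain_history_sound (M : machine) H Z l y w : big_enough (plain M) Z -> l < y ->
  (size w + y).+1 <= Z -> history (machine_code (plain M)) H Z l ->
  h_accepts (machine_code (plain M)) H Z l -> reads_word Z.+1 (h_input H) w ->
  accepts_within M w y.
Proof.
move=> bZ ly yZ hi ac rd.
have [c [c0 st] ag] := history_sound bZ hi rd ltac:(lia).
exists c, l; split=> //.
exact: ((accepts_agrees bZ (ag l (leqnn l))).1 ac).
Qed.

Section CensusCorrect.
Variables (M0 M1 : oracle_machine) (MB MD : machine) (T A B D : language).
Variables (u g : nat -> nat).
Hypotheses (dec0 : decides M0 A T u) (dec1 : decides M1 D A u).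
Hypotheses (decB : decides (plain MB) set0 B u) (decD : decides (plain MD) set0 D u).
Hypotheses (det : deterministic M1) (atmost : makes_at_most_queries M1 D g).
Hypotheses (mono : forall a b, a <= b -> u a <= u b) (AB : A `<=` B).
Variables (xx : seq bool) (Y m G : nat).
Local Notation Z := (Y * 4).
Hypotheses (big0 : big_enough M0 Z) (big1 : big_enough M1 Z).
Hypotheses (bigB : big_enough (plain MB) Z) (bigD : big_enough (plain MD) Z).
Hypotheses (xm : (size xx + u (size xx)).+1 < m) (mY : m <= Y) (uY : u (m + u m).+1 < Y).
Hypothesis gG : forall n, n <= m -> g n <= G.
Local Notation E0 := (machine_code M0).
Local Notation E1 := (machine_code M1).
Local Notation EB := (machine_code (plain MB)).
Local Notation ED := (machine_code (plain MD)).
Local Notation valid_entry := (@valid_entry M1 MB MD m Y G).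
Local Notation entry := (entry m Y).
Local Notation ka := (#|valid_entry|).

Section Entries.
Variables (HM : nat -> Prop) (HB H1 : nat -> nat -> Prop) (HD L : nat -> nat -> nat -> Prop).

Lemma entry_word_exists a : entry_word H1 Y m a ->
  exists w, size w <= m /\ reads_word Z.+1 (h_input (H1 a)) w.
Proof.
move=> [l [lm h]]; exists (mkseq (fun j => `[< h_input (H1 a) j 2 >]) l).
split=> [|j jZ s s3]; first by rewrite size_mkseq.
have [h1 h2] := h j jZ; case: (ltnP j l) => jl; last first.
  rewrite nth_default; first exact: (h2 jl s s3).
  by rewrite size_map size_mkseq.
have [n0 n12] := h1 jl.
rewrite (nth_map false) ?size_mkseq // nth_mkseq //=; case: asboolP => b /=.
  by case: s s3 => [|[|[|]]] // _; split=> // /n12.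
by case: s s3 => [|[|[|]]] // _; split=> // _; exact/n12.
Qed.

Lemma entry_sound a : entry_word H1 Y m a -> entry_in_B EB HB H1 Y a ->
  entry_run E1 ED H1 HD L Y G a ->
  exists (e : entry) (c : nat -> config M1) l, [/\ valid_entry e,
    reads_word Z.+1 (h_input (H1 a)) e.1,
    forall t, t < Y -> (h_ans (H1 a) t <-> pattern_of e.2 t),
    pattern_run Y e.1 (pattern_of e.2) c l &
    history E1 (H1 a) Z l /\ forall t, t <= l -> agrees (H1 a) Z (last_tape M1).+1 Z.+1 t (c t)].
Proof.
move=> /entry_word_exists[w [wm rd]] [[lB [lBY [hB aB]]] sB] [l [lY [hi ha an qu]]].
have [c r ag] := history_sound big1 hi rd ltac:(lia).
pose f t := (t < Y) && `[< h_ans (H1 a) t >].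
have fE t : t < Y -> (f t <-> h_ans (H1 a) t).
  by rewrite /f => -> /=; split=> /asboolP.
have as_ t : t <= l -> (h_queries E1 (H1 a) Z t <-> asking (c t)).
  by move=> tl; exact: (queries_agrees big1 (ag t tl)).
have p : pattern_run Y w f c l.
  split=> //.
  - split=> [|t tl]; first exact: r.1.
    by have := r.2 t tl; rewrite /f (ltn_trans tl lY).
  - exact/(halts_agrees big1 (ag l (leqnn l))).
  - move=> t /andP[tY /asboolP h]; have [tl q] := an t tY h.
    by split=> //; apply/as_ => //; exact: ltnW.
have v : valid_pattern M1 MB MD m Y G w f.
  split=> //.
    apply: (plain_history_sound bigB lBY _ hB aB); first by lia.
    by move=> j jZ s s3; rewrite sB //; exact: rd.
  exists c, l; split=> //.
    (* [L] may hold several labels for one query; any choice works, since no label is shared by two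
       queries. *)
    exists (fun t => xget 0 [set v | v < G /\ L a t v]) => t tl ast.
    have lab s : s < l -> asking (c s) ->
        let v := xget 0 [set v | v < G /\ L a s v] in v < G /\ L a s v.
      move=> sl ass; have [[v [vG Lv]] _ _] := qu s sl ((as_ s (ltnW sl)).2 ass).
      by case: xgetP => [y _ //|/(_ v)]; case.
    have [vG Lv] := lab t tl ast; split=> // t' t't as't e.
    have [_ distinct _] := qu t tl ((as_ t (ltnW tl)).2 ast).
    have [v'G Lv'] := lab t' (ltn_trans t't tl) as't.
    apply: (distinct t' t't ((as_ t' (ltnW (ltn_trans t't tl))).2 as't) _ vG).
    by split=> //; rewrite -e.
  move=> t /andP[tY /asboolP h]; have [tl q] := an t tY h.
  have [_ _ /(_ h)[lD [lDY [hD aD asD]]]] := qu t tl q.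
  have f1 := fits_in_run r (ltnW tl).
  have sz : size (word_of (c t)) <= m + Y.
    by apply: (leq_trans (size_word_at _)); apply: (leq_trans (f1 ord_max).2); lia.
  apply: (plain_history_sound bigD lDY _ hD aD); first by lia.
  by apply/(asks_agrees big1 _ (ag t (ltnW tl)) f1) => //; lia.
have [e [ve e1 e2]] := valid_entry_exists v.
exists e, c, l; split=> //.
- by rewrite e1.
- by move=> t tY; rewrite e2 fE.
- by rewrite e1 e2.
Qed.
End Entries.

Lemma truthful_transfer q f (c : nat -> config M1) l c' l' : pattern_run Y q f c l -> @pattern_run M1 Y q f c' l' ->
  truthful D f c l -> @truthful M1 D f c' l'.
Proof.
move=> p p' tr t tl as_.
have [tl0 e as0] := same_query det p' p (fun _ _ => erefl) tl as_.
by rewrite (tr t tl0 as0) e.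
Qed.

(** [accepts] allows acceptance before the end of a computation, so an accepting run has to be
    located inside the halting run of the entry. *)
Lemma true_run_prefix q f (c c' : nat -> config M1) l l' : @pattern_run M1 Y q f c l -> truthful D f c l ->
  run_of (fun t => `[< D (word_of (c' t)) >]) c' l' q ->
  l' <= l /\ forall t, t <= l' -> c' t = c t.
Proof.
move=> [_ r h _] tr r'.
suff main t : t <= l' -> t <= l /\ c' t = c t.
  by split=> [|t /main[]//]; have [] := main l' (leqnn l').
elim: t => [_|t IH tl']; first by rewrite r.1 r'.1.
have [tl e] := IH (ltnW tl'); have st := r'.2 t tl'.
have tl1 : t < l.
  move: tl; rewrite leq_eqVlt => /orP[/eqP tl|//].
  by move: st; rewrite e tl => /h.
split=> //; rewrite e in st; apply: (answer_step_det det _ (r.2 t tl1)).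
case: (boolP (asking (c t))) => as_; last exact: answer_step_irrelevant st.
have -> : f t = `[< D (word_of (c t)) >] by apply/idP/asboolP => /(tr t tl1 as_).
by [].
Qed.

Section Listed.
Variables (HM : nat -> Prop) (HB H1 : nat -> nat -> Prop) (HD L : nat -> nat -> nat -> Prop).
Hypothesis entries : forall a, a < ka ->
  [/\ entry_word H1 Y m a, entry_in_B EB HB H1 Y a & entry_run E1 ED H1 HD L Y G a].
Hypothesis distinct : forall a, a < ka -> forall a', a' < a ->
  ~ (same_input H1 Y a a' /\ same_answers H1 a a' Y).

Definition entry_at (a : nat) (e : entry) := exists (c : nat -> config M1) l, [/\ valid_entry e,
    reads_word Z.+1 (h_input (H1 a)) e.1,
    forall t, t < Y -> (h_ans (H1 a) t <-> pattern_of e.2 t),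
    pattern_run Y e.1 (pattern_of e.2) c l &
    history E1 (H1 a) Z l /\ forall t, t <= l -> agrees (H1 a) Z (last_tape M1).+1 Z.+1 t (c t)].

(** The counting argument: [ka] entries decode to pairwise distinct elements of a set of cardinal
    [ka], so none of its elements is missing. *)
Lemma entry_at_surjective e : valid_entry e -> exists2 a, a < ka & entry_at a e.
Proof.
move=> ve.
have /choice[f hf] : forall a : 'I_ka, exists e, entry_at a e.
  by move=> a; have [h1 h2 h3] := entries (ltn_ord a); exact: entry_sound h1 h2 h3.
have inj : injective f.
  have half (a a' : 'I_ka) : a' < a -> f a <> f a'.
    move=> lt e'; have [c [l [_ rd an _ _]]] := hf a; have [c' [l' [_ rd' an' _ _]]] := hf a'.
    apply: (distinct (ltn_ord a) lt); split=> [j jZ s s3|t tY].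
      by rewrite rd // rd' // e'.
    by rewrite an // an' // e'.
  move=> a a' e'; apply: ord_inj; case: (ltngtP a a') => // /half[] //.
have sub : {subset codom f <= valid_entry}.
  by move=> _ /codomP[a ->]; have [c [l []]] := hf a.
have e_im : e \in codom f.
  have h : #|codom f| = ka by rewrite card_codom // card_ord.
  have sub' : codom f \subset valid_entry by exact/fintype.subsetP.
  by rewrite (elimT (subset_cardP h) sub').
have [a ea] := codomP e_im.
by exists a => //; rewrite ea; exact: hf.
Qed.

Lemma entry_at_word a e q : size q <= m -> entry_at a e ->
  reads_word Z.+1 (h_input (H1 a)) q <-> e.1 = q :> seq bool.
Proof.
move=> qm [c [l [ve rd _ _ _]]]; split=> [rd'|<-//].
have em : size e.1 <= m by exact: size_bseq.
have mZ : m < Z.+1 by lia.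
exact: (reads_word_inj (leq_ltn_trans em mZ) (leq_ltn_trans qm mZ) rd rd').
Qed.

(** Since the list is complete, the true pattern of the queried word is on it. An unbeaten entry
    must equal this pattern and the true entry is never beaten, so acceptance by the entry is
    acceptance by [M1] with oracle D. *)
Lemma listed_iff t cf w : agrees HM Z (last_tape M0).+1 Z.+1 t cf -> fits_in cf w -> w < Z ->
  size (word_of cf) <= m ->
  listed E0 E1 HM H1 Y ka t <-> A (@word_of M0 cf).
Proof.
move=> ag fi wZ; set q := word_of cf => qm.
have askE a := asks_agrees big0 (h_input (H1 a)) ag fi wZ.
have truth w' : size w' <= m -> accepts_within MB w' Y -> exists a e c l,
    [/\ a < ka, entry_at a e, e.1 = w' :> seq bool &
        @pattern_run M1 Y w' (pattern_of e.2) c l /\ truthful D (pattern_of e.2) c l].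
  move=> w'm w'B.
  have [f [vf [c0 [l0 [p0 tr]]]]] := true_pattern dec1 decD mono uY atmost gG w'm w'B.
  have [e [ve e1 e2]] := valid_entry_exists vf.
  have [a aka ea] := entry_at_surjective ve.
  by exists a, e, c0, l0; split=> //; rewrite e2.
split=> [[a [aka [/askE rd nb [l [lY [hi ac]]]]]]|Aq].
  have [h1 h2 h3] := entries aka; have [e ea] := entry_sound h1 h2 h3.
  have e1 : e.1 = q :> seq bool by apply/(entry_at_word qm ea).
  have [c [l1 [ve rde an p [hl ag1]]]] := ea.
  have /asboolP[_ qB [cv [lv [pv _ ver]]]] := ve; rewrite e1 in p qB pv.
  have [b [e0 [c0 [l0 [bka eb e0q [p0 tr]]]]]] := truth q qm qB.
  (* Were they different, the entry of the true pattern would beat this one at the first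
     difference. *)
  have fE : pattern_of e.2 = pattern_of e0.2.
    apply/funext => s; apply/eqP; apply/negPn/negP => /eqP ne.
    have [{ne}s [ne same]] := first_difference (ex_intro _ s ne).
    have [b1 b2] := truth_beats det decD pv ver p0 tr ne same.
    apply: nb; exists b; split=> //.
    have [cb [lb [_ rdb anb pb _]]] := eb.
    have sY : s < Y by have [sl _] : s < l0 /\ asking (c0 s) by [case: p0 => _ _ _; apply]; case: p0 => h _ _ _; exact: ltn_trans h.
    split=> [j jZ s' s3|].
      by rewrite rde // rdb // e1 e0q.
    exists s; split=> //; split; [exact/(anb s sY) | by move/(an s sY) | move=> t' t's].
    by rewrite an ?(ltn_trans t's) // anb ?(ltn_trans t's) // same.
  have tr1 : truthful D (pattern_of e.2) c l1.
    by rewrite fE in p *; exact: truthful_transfer p0 p tr.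
  have [_ rp hp _] := p.
  (* [listed] has its own length [l]. A history longer than [l1] would go on from a halted
     configuration, since both runs follow the same answers. *)
  have l_le : l <= l1.
    rewrite leqNgt; apply/negP => lt.
    have [c' r' _] := history_sound big1 hi rde ltac:(rewrite e1; lia).
    rewrite e1 in r'.
    have ce : c l1 = c' l1.
      apply: (same_run det rp r' _ (leqnn l1) (ltnW lt)) => s sl.
      have sY : s < Y by lia.
      by apply/idP/asboolP => /(an s sY).
    by apply: (hp _ (c' l1.+1)); rewrite ce; exact: r'.2 l1 lt.
  apply/dec1.1.
  have rl : run_of (pattern_of e.2) c l q by split=> [|t' tl]; [exact: rp.1 | apply: rp.2; exact: leq_trans tl l_le].
  have [t' tl|s [hs sl ls]] := oracle_run (O := D) rl.
    by apply: tr1; exact: leq_trans tl l_le.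
  exists s => //; rewrite ls.
  exact: ((accepts_agrees big1 (ag1 l l_le)).1 ac).
have qB : accepts_within MB q Y.
  apply: (accepts_within_complete decB); last exact: AB.
  by apply: leq_ltn_trans uY; apply: mono; lia.
have [a [e [c [l [aka ea e1 [p tr]]]]]] := truth q qm qB.
have [c1 [l1 [ve rd an p1 [hl ag1]]]] := ea; rewrite e1 in p1 rd.
have tr1 := truthful_transfer p p1 tr.
exists a; split=> //; split; first exact/askE.
  (* A rival would answer yes where the truth answers no at their first difference, against
     [truth_beats]. *)
  move=> [b [bka [si [s [sY [b1 b2 b3]]]]]].
  have [h1 h2 h3] := entries bka; have [e' ea'] := entry_sound h1 h2 h3.
  have [c' [l' [ve' rd' an' p' _]]] := ea'.
  have e1' : e'.1 = q :> seq bool.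
    by apply/(entry_at_word qm ea') => j jZ s' s3; rewrite -si //; exact: rd.
  have /asboolP[_ _ [cv [lv [pv _ ver]]]] := ve'; rewrite e1' in pv.
  have e't : pattern_of e'.2 s by exact/(an' s sY).
  have ne : pattern_of e'.2 s <> pattern_of e.2 s.
    by rewrite e't => /esym h; apply: b2; exact/(an s sY).
  have same s' : s' < s -> pattern_of e'.2 s' = pattern_of e.2 s'.
    move=> s's; have s'Y := ltn_trans s's sY; have h := b3 s' s's.
    apply/idP/idP => [/(an' s' s'Y) k|/(an s' s'Y) k].
      by apply/(an s' s'Y)/h.
    by apply/(an' s' s'Y)/h.
  by have [_] := truth_beats det decD pv ver p tr ne same; apply.
have uq : u (size q) < Y by apply: leq_ltn_trans uY; apply: mono; lia.
have [c0 [l0 [l0Y r0 ac]]] := coded_complete dec1 uq Aq.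
have [l01 ce] := true_run_prefix p1 tr1 r0.
exists l0; split=> //; split; first exact: history_prefix hl.
apply/(accepts_agrees big1 (ag1 l0 l01)).
by rewrite -ce.
Qed.
End Listed.

Lemma input_word H : (forall j, j < Z.+1 -> forall s, s < 3 -> (h_input H j s <->
    j < size xx /\ (s = 2 /\ nth false xx j \/ s = 1 /\ ~ nth false xx j) \/ size xx <= j /\ s = 0)) <->
  reads_word Z.+1 (h_input H) xx.
Proof.
have code j s (s3 : s < 3) := @take_word_code xx (size xx) j (leqnn _) s s3.
by split=> h j jZ s s3; rewrite h //; move: (code j s s3); rewrite take_size => ->.
Qed.

Lemma census_sound HM HB H1 HD L :
  census E0 E1 ED EB HM HB H1 HD L (nth false xx) (size xx) Y m G ka -> T xx.
Proof.
move=> [ent dis [l [lm [nl [hi ac] /input_word rd ans]]]].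
have yZ : (size xx + l.+1).+1 <= Z by lia.
apply: (coded_sound dec0 big0 yZ (ltnSn l) hi ac rd) => t c tl ag f as_.
rewrite ans //; last exact/(queries_agrees big0 ag).
apply: (listed_iff ent dis ag f); first by lia.
by apply: (leq_trans (size_word_at _)); apply: (leq_trans (f ord_max).2); lia.
Qed.

Lemma plain_run_coded (M : machine) w y H c l : big_enough (plain M) Z -> l < y ->
  (size w + y).+1 <= Z -> run_of (fun=> false) c l w -> accepting (c l).1 ->
  (forall v, v < fact_bound Z -> (H v <-> @run_facts (plain M) (fun=> false) c v)) ->
  [/\ history (machine_code (plain M)) H Z l, h_accepts (machine_code (plain M)) H Z l &
      reads_word Z.+1 (h_input H) w].
Proof.
move=> bZ ly yZ r ac hH; have [hi rd ag] := run_coded bZ yZ r ly hH.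
by split=> //; apply/(accepts_agrees bZ (ag l (leqnn l)).1).
Qed.

(** The witnesses are prescribed only below explicit bounds, because a guess stores nothing at
    addresses from [2 ^ n] on. The entries are the valid pairs in the order of [enum]. *)
Lemma census_complete : T xx -> exists (FM : nat -> Prop) (FB F1 : nat -> nat -> Prop)
    (FD FL : nat -> nat -> nat -> Prop), forall HM HB H1 HD L,
  (forall v, v < fact_bound Z -> (HM v <-> FM v)) ->
  (forall a v, a < ka -> v < fact_bound Z -> (HB a v <-> FB a v)) ->
  (forall a v, a < ka -> v < fact_bound Z -> (H1 a v <-> F1 a v)) ->
  (forall a t v, a < ka -> t < Y -> v < fact_bound Z -> (HD a t v <-> FD a t v)) ->
  (forall a t v, a < ka -> t < Y -> v < G -> (L a t v <-> FL a t v)) ->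
  census E0 E1 ED EB HM HB H1 HD L (nth false xx) (size xx) Y m G ka.
Proof.
move=> Txx.
have [c0 [l0 [l0u r0 ac0]]] := coded_complete dec0 (ltnSn (u (size xx))) Txx.
set an0 := fun t => `[< A (word_of (c0 t)) >] in r0.
pose e0 : entry := (Bseq (isT : size ([::] : seq bool) <= m), [ffun=> false]).
pose ent a : entry := nth e0 (enum valid_entry) a.
have ent_valid a : a < ka -> valid_entry (ent a).
  by move=> aka; have : ent a \in enum valid_entry; [rewrite mem_nth // -cardE | rewrite mem_enum].
have /choice[dB hB] : forall a, exists p : (nat -> config (plain MB)) * nat, a < ka ->
    [/\ p.2 < Y, run_of (fun=> false) p.1 p.2 (ent a).1 & accepting (p.1 p.2).1].
  move=> a; case: (ltnP a ka) => aka; last by exists (fun=> init (plain MB) [::], 0).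
  by have /asboolP[_ [c [l h]] _] := ent_valid a aka; exists (c, l).
have /choice[d1 h1] : forall a, exists p : (nat -> config M1) * nat * (nat -> nat), a < ka ->
    [/\ pattern_run Y (ent a).1 (pattern_of (ent a).2) p.1.1 p.1.2,
     forall t, t < p.1.2 -> asking (p.1.1 t) ->
       p.2 t < G /\ forall t', t' < t -> asking (p.1.1 t') -> p.2 t' <> p.2 t &
     forall t, pattern_of (ent a).2 t -> accepts_within MD (word_of (p.1.1 t)) Y].
  move=> a; case: (ltnP a ka) => aka; last by exists (fun=> init M1 [::], 0, fun=> 0).
  by have /asboolP[_ _ [c [l [p [lab hl] hD]]]] := ent_valid a aka; exists (c, l, lab).
have /choice[dD hD] : forall at_ : nat * nat, exists p : (nat -> config (plain MD)) * nat,
    at_.1 < ka -> pattern_of (ent at_.1).2 at_.2 ->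
    [/\ p.2 < Y, run_of (fun=> false) p.1 p.2 (word_of ((d1 at_.1).1.1 at_.2)) &
        accepting (p.1 p.2).1].
  move=> [a t] /=; case: (pselect (a < ka /\ pattern_of (ent a).2 t)) => [[aka ft]|n].
    by have [_ _ /(_ t ft)[c [l h]]] := h1 a aka; exists (c, l).
  by exists (fun=> init (plain MD) [::], 0) => aka ft; case: n.
exists (run_facts an0 c0), (fun a => run_facts (fun=> false) (dB a).1),
  (fun a => run_facts (pattern_of (ent a).2) (d1 a).1.1),
  (fun a t => run_facts (fun=> false) (dD (a, t)).1), (fun a t v => v = (d1 a).2 t).
move=> HM HB H1 HD L eM eB e1 eD eL.
have entries a : a < ka -> [/\ entry_word H1 Y m a, entry_in_B EB HB H1 Y a &
    entry_run E1 ED H1 HD L Y G a].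
  move=> aka; have [p lab ver] := h1 a aka; have [lY r ha fa] := p.
  have em : size (ent a).1 <= m by exact: size_bseq.
  have yZ : (size (ent a).1 + Y).+1 <= Z by lia.
  have [hi rd ag] := run_coded big1 yZ r lY (fun v vU => e1 a v aka vU).
  have [lBY rB aB] := hB a aka.
  have [hiB acB rdB] := plain_run_coded bigB lBY yZ rB aB (fun v vU => eB a v aka vU).
  set c := (d1 a).1.1 in p lab ver r ha fa ag; set l := (d1 a).1.2 in p lab lY r ha hi ag fa.
  have as_ t : t <= l -> (h_queries E1 (H1 a) Z t <-> asking (c t)).
    by move=> tl; exact: (queries_agrees big1 (ag t tl).1).
  split.
  - exists (size (ent a).1); split=> // j jZ; split=> [jl|lj s s3].
      by rewrite !rd // (nth_map false) //; case: nth; split=> //; split.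
    by rewrite rd // nth_default // size_map.
  - split; first by exists (dB a).2.
    by move=> j jZ s s3; rewrite rdB // rd.
  - exists l; split=> //; split=> //.
    + exact/(halts_agrees big1 (ag l (leqnn l)).1).
    + move=> t tY hat.
      have ft : pattern_of (ent a).2 t.
        have tZ : t < Z by lia.
        exact/(facts_agree big1 tZ (fun v vU => e1 a v aka vU)).2.
      have [tl ast] := fa t ft; split=> //; apply/as_ => //; exact: ltnW.
    + move=> t tl /(as_ t (ltnW tl)) ast; have tY := ltn_trans tl lY.
      have [vG distinct] := lab t tl ast; split.
      * by exists ((d1 a).2 t); split=> //; apply/eL.
      * move=> t' t't q v vG' [/(eL a t v aka tY vG') -> /(eL a t' _ aka (ltn_trans t't tY) vG)].
        move/esym; apply: distinct => //; apply/as_ => //; exact: ltnW (ltn_trans t't tl).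
      * move=> hat; have ft : pattern_of (ent a).2 t by apply/(ag t (ltnW tl)).2.
        have [lDY rD aD] := hD (a, t) aka ft.
        have f1 := fits_in_run r (ltnW tl).
        have wY : (size (word_of (c t)) + Y).+1 <= Z.
          have : size (word_of (c t)) <= m + Y.
            apply: (leq_trans (size_word_at _)); apply: (leq_trans (f1 ord_max).2).
            by rewrite -addnS leq_add.
          by lia.
        have [hiD acD rdD] := plain_run_coded bigD lDY wY rD aD (fun v vU => eD a t v aka tY vU).
        exists (dD (a, t)).2; split=> //; split=> //.
        apply/(asks_agrees big1 _ (ag t (ltnW tl)).1 f1) => //.
        by apply: (@leq_ltn_trans (m + Y)); [rewrite -addnS leq_add | lia].
have distinct a : a < ka -> forall a', a' < a -> ~ (same_input H1 Y a a' /\ same_answers H1 a a' Y).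
  move=> aka a' a'a [si sa]; have a'ka := ltn_trans a'a aka.
  have read b : b < ka -> reads_word Z.+1 (h_input (H1 b)) (ent b).1 /\
      forall t, t < Y -> (h_ans (H1 b) t <-> pattern_of (ent b).2 t).
    move=> bka; have [[lY r _ _] _ _] := h1 b bka.
    have em : size (ent b).1 <= m by exact: size_bseq.
    have yZ : (size (ent b).1 + Y).+1 <= Z by lia.
    have [_ rd _] := run_coded big1 yZ r lY (fun v vU => e1 b v bka vU).
    split=> // t tY; have tZ : t < Z by lia.
    exact: (facts_agree big1 tZ (fun v vU => e1 b v bka vU)).2.
  have [rd an] := read a aka; have [rd' an'] := read a' a'ka.
  have ee : ent a = ent a'.
    case: (ent a) (ent a') (size_bseq (ent a).1) (size_bseq (ent a').1) rd rd' an an' => [w f] [w' f'] /= wm wm' rd rd' an an'.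
    congr pair.
      apply: val_inj; have mZ : m < Z.+1 by lia.
      apply: (reads_word_inj (leq_ltn_trans wm mZ) (leq_ltn_trans wm' mZ) rd) => j jZ s s3.
      by rewrite si //; exact: rd'.
    apply/ffunP => i; have iY := ltn_ord i.
    have := an i iY; have := an' i iY; have := sa i iY; rewrite /pattern_of valK.
    by move=> h3 h4 h5; apply/idP/idP => [/h5/h3/h4|/h4/h3/h5].
  have := @nth_uniq _ e0 (enum valid_entry) a a'; rewrite -!cardE => /(_ aka a'ka (enum_uniq _)).
  by rewrite -/(ent a) -/(ent a') ee eqxx => /esym; rewrite gtn_eqF.
split=> //.
have yZ : (size xx + (u (size xx)).+1).+1 <= Z by lia.
have [hi rd ag] := run_coded big0 yZ r0 l0u eM.
exists l0; split; first by lia.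
split=> //; first by lia.
- by split=> //; apply/(accepts_agrees big0 (ag l0 (leqnn l0)).1).
- exact/input_word.
- move=> t tl _; have [ag1 ->] := ag t (ltnW tl).
  have f := fits_in_run r0 (ltnW tl).
  rewrite (listed_iff entries distinct ag1 f); first by split=> /asboolP.
    by lia.
  by apply: (leq_trans (size_word_at _)); apply: (leq_trans (f ord_max).2); lia.
Qed.
End CensusCorrect.

(** * Growth *)

Lemma linear_lt_exp A t : 2 * A + 2 <= t -> A * t.+1 <= 2 ^ t.
Proof.
move=> h; rewrite -(subnK h); elim: (t - _) => [|i IH].
  have h1 : A.+1 <= 2 ^ A by rewrite ltn_expl.
  have -> : 2 ^ (0 + (2 * A + 2)) = 4 * (2 ^ A * 2 ^ A).
    by rewrite add0n expnD mulnC mul2n -addnn expnD.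
  by nia.
by rewrite addSn expnS; nia.
Qed.

Lemma le_exp_div A : 0 < A -> exists n0, forall n, n0 <= n -> n <= 2 ^ (n %/ A).
Proof.
move=> A0; exists (A * (2 * A + 2)) => n h.
have t0 : 2 * A + 2 <= n %/ A by rewrite leq_divRL // mulnC.
by apply: leq_trans (linear_lt_exp t0); rewrite ltnW // mulnC ltn_ceil.
Qed.

Lemma poly_le_exp_div j K : 0 < K -> exists n0, forall n, n0 <= n -> n ^ j <= 2 ^ (n %/ K).
Proof.
move=> K0; case: j => [|j]; first by exists 0 => n _; rewrite expn0 expn_gt0.
have [|n0 h] := @le_exp_div (K * j.+1); first by rewrite muln_gt0 K0.
exists n0 => n /h {}h; apply: (@leq_trans ((2 ^ (n %/ (K * j.+1))) ^ j.+1)).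
  by rewrite leq_exp2r.
by rewrite -expnM leq_exp2l // divnMA leq_divM.
Qed.

(** With [s = n %/ K], one has [n.+1 <= 2 * K * s], and the constant [(2 * K) ^ d] is at most one
    further factor [s]. *)
Lemma poly_le_div d K : 0 < K -> exists n0, forall n, n0 <= n ->
  n.+1 ^ d <= (n %/ K) ^ d.+1.
Proof.
move=> K0; exists (K * (2 * K) ^ d) => n h.
set s := n %/ K.
have p0 : 0 < (2 * K) ^ d by rewrite expn_gt0 muln_gt0 K0.
have hs : (2 * K) ^ d <= s by rewrite leq_divRL // mulnC.
have ns : n.+1 <= 2 * K * s.
  have := ltn_ceil n K0; rewrite -/s; nia.
apply: (@leq_trans ((2 * K * s) ^ d)); first by case: (d) => // d'; rewrite leq_exp2r.
by rewrite expnMn expnS leq_mul.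
Qed.

Section Reals.
Variable R : realType.
Local Open Scope ring_scope.

Lemma root_le (M s r : nat) : (0 < r)%N -> (M <= s ^ r)%N -> M%:R `^ (r%:R^-1) <= s%:R :> R.
Proof.
move=> r0 h; have h' : M%:R <= s%:R `^ r%:R :> R by rewrite powR_mulrn ?ler0n // -natrX ler_nat.
apply: (@le_trans _ _ ((s%:R `^ r%:R) `^ (r%:R^-1))).
  by apply: ge0_ler_powR => //; rewrite ?invr_ge0 ?nnegrE ?ler0n ?powR_ge0.
by rewrite -powRrM mulfV ?powRr1 // pnatr_eq0 -lt0n.
Qed.

Lemma le_root (a M r : nat) : (0 < r)%N -> a%:R <= M%:R `^ (r%:R^-1) :> R -> (a ^ r <= M)%N.
Proof.
move=> r0 h; rewrite -(ler_nat R) natrX -powR_mulrn ?ler0n //.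
apply: (@le_trans _ _ ((M%:R `^ (r%:R^-1)) `^ r%:R)).
  by apply: ge0_ler_powR => //; rewrite ?nnegrE ?ler0n ?powR_ge0.
by rewrite -powRrM mulVf ?powRr1 // pnatr_eq0 -lt0n.
Qed.

Lemma sparse_le (B : language) (r s M : nat) : (0 < r)%N -> (M <= s ^ r)%N ->
  #|` fset_set (upto B M)|%:R < 2 `^ (M%:R `^ (r%:R^-1)) :> R ->
  (#|` fset_set (upto B M)| <= 2 ^ s)%N.
Proof.
move=> r0 h lt; rewrite -(ler_nat R) natrX -powR_mulrn //.
apply: (le_trans (ltW lt)); apply: ler_powR; first by rewrite ler1n.
exact: root_le.
Qed.
End Reals.

Lemma infinite_unbounded (S : set nat) b : infinite_set S -> exists2 M, S M & b <= M.
Proof.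
move=> inf; apply: contrapT => h; apply: inf.
apply: (@sub_finite_set _ _ `I_b); last exact: finite_II.
by move=> M SM /=; rewrite ltnNge; apply/negP => bM; apply: h; exists M.
Qed.

Lemma card_upto (B : language) m (P : pred (m.-bseq bool)) : (forall w, P w -> B w) ->
  #|P| <= #|` fset_set (upto B m)|.
Proof.
move=> PB; rewrite cardE -(size_map (fun w : m.-bseq bool => w : seq bool)).
apply: uniq_leq_size; first by rewrite map_inj_uniq ?enum_uniq //; exact: val_inj.
move=> v /mapP[w]; rewrite mem_enum => Pw ->.
rewrite in_fset_set; last exact: finite_upto.
by rewrite inE; split; [exact: PB | exact: size_bseq].
Qed.

Lemma upto_subset (B : language) a b : a <= b ->
  #|` fset_set (upto B a)| <= #|` fset_set (upto B b)|.
Proof.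
move=> ab; apply: fsubset_leq_card; apply/fsubsetP => v.
rewrite !in_fset_set; try exact: finite_upto.
by rewrite !inE => -[Bv va]; split=> //; exact: leq_trans ab.
Qed.

(** The density is tested with exponent [1 / d.+1]: a sparse length [M] that is polynomial in [n] of
    degree [d] has [d.+1]-th root at most [n %/ K] for large [n]. The same exponent serves for
    [g]. *)
Lemma sparse_length (R : realType) (B : language) (g m : nat -> nat) d K b :
  NEXPD R B -> sub_polynomial R g -> 0 < K -> (forall n, n <= m n) ->
  (forall n, 2 <= n -> m n <= n ^ d) ->
  exists2 n, b <= n & (forall l, l <= m n -> g l <= n %/ K) /\
    #|` fset_set (upto B (m n))| <= 2 ^ (n %/ K).
Proof.
move=> sparse sub K0 nm md.
have c0 : (0 < d.+1%:R^-1 :> R)%R by rewrite invr_gt0 ltr0n.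
have [n1 _ hg] := sub _ c0.
have [n2 h2] := poly_le_div d K0.
pose C := \max_(l < n1) g l.
(* The summand [K * C] makes [n %/ K] at least [C], which covers [g] on the lengths below [n1]. *)
pose b' := b + K * C + n2 + 2.
have [M MS bM] := infinite_unbounded (m b') (sparse _ c0).
have ex : exists n, m n <= M by exists b'.
have bd n : m n <= M -> n <= M by apply: leq_trans.
(* A sparse length [M] need not be a value of [m]. For the greatest [n] with [m n <= M], maximality
   gives [M < m n.+1], so [M] is still polynomial in [n], and sparsity passes down to [m n]. *)
case: (ex_maxnP ex bd) => n mn max.
have bn : b' <= n by exact: max.
have Mn : M < m n.+1 by rewrite ltnNge; apply/negP => /max; rewrite ltnn.
have n2n : n2 <= n by rewrite /b' in bn; lia.
have Ms : M <= (n %/ K) ^ d.+1.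
  apply: (leq_trans (ltnW Mn)); apply: (leq_trans (md _ _)); last exact: h2.
  by rewrite /b' in bn; lia.
exists n; first by rewrite /b' in bn; lia.
split=> [l lm|].
  case: (leqP n1 l) => ln.
    rewrite -(@leq_exp2r _ _ d.+1) //; apply: leq_trans (le_root (ltn0Sn d) (hg l ln)) _.
    by apply: leq_trans Ms; exact: leq_trans mn.
  apply: (@leq_trans C); first exact: (@leq_bigmax _ (fun i : 'I_n1 => g i) (Ordinal ln)).
  by rewrite leq_divRL // mulnC; rewrite /b' in bn; lia.
exact: leq_trans (upto_subset B mn) (sparse_le (ltn0Sn d) Ms MS).
Qed.

(** * Diagonalization *)

Definition tagged_facts (FM : nat -> Prop) (FB F1 : nat -> nat -> Prop)
    (FD FL : nat -> nat -> nat -> Prop) (idx : nat) : bool :=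
  `[< (exists a, idx = pr 0 (pr a (2 ^ a))) \/ (exists v, idx = pr 1 v /\ FM v) \/
      (exists a v, idx = pr 2 (pr a v) /\ FB a v) \/
      (exists a v, idx = pr 3 (pr a v) /\ F1 a v) \/
      (exists a t v, idx = pr 4 (pr (pr a t) v) /\ FD a t v) \/
      (exists a t v, idx = pr 5 (pr a (pr t v)) /\ FL a t v) >].

Lemma tagged_factsP FM FB F1 FD FL : let w := tagged_facts FM FB F1 FD FL in
  [/\ forall a b, w (pr 0 (pr a b)) <-> b = 2 ^ a,
      forall v, w (pr 1 v) <-> FM v,
      forall a v, w (pr 2 (pr a v)) <-> FB a v,
      forall a v, w (pr 3 (pr a v)) <-> F1 a v &
      (forall a t v, w (pr 4 (pr (pr a t) v)) <-> FD a t v) /\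
      (forall a t v, w (pr 5 (pr a (pr t v))) <-> FL a t v)].
Proof.
have inj := pr_inj.
split; last split; intros; (split; [move=> /asboolP h | move=> h; apply/asboolP]).
all: repeat match goal with
  | h : _ \/ _ |- _ => destruct h
  | h : ex _ |- _ => destruct h
  | h : _ /\ _ |- _ => destruct h
  | h : pr _ _ = pr _ _ |- _ => apply inj in h
  end; subst => //.
all: try (by left; exists a); right.
- by left; exists v.
- by right; left; exists a, v.
- by do 2!right; left; exists a, v.
- by do 3!right; left; exists a, t, v.
- by do 4!right; exists a, t, v.
Qed.

Section Diagonal.
Variables (M0 M1 : oracle_machine) (MB MD : machine) (T A B D : language).
Variables (u g : nat -> nat).
Hypotheses (dec0 : decides M0 A T u) (dec1 : decides M1 D A u).
Hypotheses (decB : decides (plain MB) set0 B u) (decD : decides (plain MD) set0 D u).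
Hypotheses (det : deterministic M1) (atmost : makes_at_most_queries M1 D g).
Hypotheses (mono : forall a b, a <= b -> u a <= u b) (AB : A `<=` B).
Variables (xx : seq bool) (Y m G n V Q : nat).
Let Z := Y * 4.
Hypotheses (big0 : big_enough M0 Z) (big1 : big_enough M1 Z).
Hypotheses (bigB : big_enough (plain MB) Z) (bigD : big_enough (plain MD) Z).
Hypotheses (xm : (size xx + u (size xx)).+1 < m) (mY : m <= Y) (uY : u (m + u m).+1 < Y).
Hypothesis gG : forall l, l <= m -> g l <= G.
Let ka := #|@valid_entry M1 MB MD m Y G|.
Let pi := parameters (machine_number M0) (machine_number M1) (machine_number (plain MD))
  (machine_number (plain MB)) (size xx) Y m G ka.
Hypotheses (piV : pi < V) (Vn : V < 2 ^ n).
Hypotheses (YQ : Y <= Q) (GQ : G <= Q) (kaQ : ka <= Q).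
Hypotheses (room_table : pr 0 (pr V.+1 V) < 2 ^ n)
  (room_facts : pr 4 (pr (pr Q Q) (fact_bound Z)) < 2 ^ n)
  (room_labels : pr 5 (pr Q (pr Q Q)) < 2 ^ n).

(** On this input the advice is correct, so S accepts exactly when a true census supports an
    accepting run of [M0] on [xx]. The [room] hypotheses keep the addresses of that census below
    [2 ^ n]. *)
Lemma diagonal_input p x : (forall X W th, sat X W p th <-> census_formula X W th) ->
  x = mkseq (nbit pi) n -> nth false xx = nth false x -> (guessed_language p x <-> T xx).
Proof.
move=> hp xE xxE.
have sx : size x = n by rewrite xE size_mkseq.
have nx i : i < n -> nth false x i = nbit pi i by move=> h; rewrite xE nth_mkseq.
have VN : V < 2 ^ n by [].
have [n0V n1V nDV nBV] : [/\ machine_number M0 < V, machine_number M1 < V,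
   machine_number (plain MD) < V & machine_number (plain MB) < V].
  split; apply: leq_ltn_trans piV; rewrite /pi /parameters.
  all: repeat first [exact: leq_pr_l | apply: (leq_trans _ (leq_pr _ _))].
have [nxV YV mV [GV kaV]] : [/\ size xx < V, Y < V, m < V & G < V /\ ka < V].
  split; last split; apply: leq_ltn_trans piV; rewrite /pi /parameters.
  all: repeat first [exact: leq_pr_l | exact: leqnn | apply: (leq_trans _ (leq_pr _ _))].
rewrite /guessed_language /= sx; split=> [[w /hp[V' [V'n [tab [p' [p'V [xb]]]]]]]|Tx].
  move=> [e0 [e0V [e1 [e1V [eD [eDV [eB [eBV [nx' [_ [Y' [_ [m' [_ [G' [_ [ka' [_ [pE]]]]]]]]]]]]]]]]]]].
  (* Both numbers are below [2 ^ n] and the input shows their [n] bits, so the guess has no freedom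
     in its parameters. *)
  have p'E : p' = pi.
    apply: (@nbit_inj n); [|exact: ltn_trans piV VN|].
      exact: ltn_trans V'n.
    move=> i i_n; rewrite -nx //; have [h1 h2] := xb i i_n.
    by apply/idP/idP => [h|h]; [apply: h2; exact/(bitP i tab p'V) | exact/(bitP i tab p'V)/h1].
  move: pE e0V e1V eDV eBV; rewrite p'E /pi /parameters.
  do 8!(move/pr_inj => [<-]); move=> <- e0V e1V eDV eBV.
  rewrite !(bit_machine_number tab) // -xxE.
  exact: (census_sound dec0 dec1 decB decD det atmost mono AB big0 big1 bigB bigD xm mY uY gG).
have [FM [FB [F1 [FD [FL hF]]]]] := census_complete dec0 dec1 decB decD det atmost mono AB big0 big1 bigB bigD xm mY uY gG Tx.
have [w0 w1 w2 w3 [w4 w5]] := tagged_factsP FM FB F1 FD FL.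
set w := tagged_facts FM FB F1 FD FL in w0 w1 w2 w3 w4 w5.
exists w; apply/hp; exists V; split; first exact: VN.
have inW i : i < 2 ^ n -> (i < 2 ^ n) && w i = w i by move=> ->.
have tab : power_table V (fun v => (v < 2 ^ n) && w v).
  apply: power_table_holds => a aV b bV; rewrite inW //.
  by apply: leq_ltn_trans room_table; do 2!(apply: pr_le => //).
split=> //; exists pi; split=> //; split.
  by move=> i i_n; rewrite (bitP _ tab) // nx.
exists (machine_number M0); split=> //; exists (machine_number M1); split=> //.
exists (machine_number (plain MD)); split=> //; exists (machine_number (plain MB)); split=> //.
exists (size xx); split=> //; exists Y; split=> //; exists m; split=> //.
exists G; split=> //; exists ka; split=> //; split=> //.
rewrite !(bit_machine_number tab) // -xxE.
have small a b c : a <= 4 -> b <= pr Q Q -> c < fact_bound Z -> pr a (pr b c) < 2 ^ n.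
  move=> a4 bQ cF; apply: leq_ltn_trans room_facts.
  by apply: pr_le => //; apply: pr_le => //; exact: ltnW.
have kaQ' a : a < ka -> a <= Q by move=> aka; apply: leq_trans kaQ; exact: ltnW.
have kaQ2 a : a < ka -> a <= pr Q Q by move=> /kaQ' aQ; apply: leq_trans (leq_pr _ _).
apply: hF.
- move=> v vF; rewrite inW //; apply: leq_ltn_trans room_facts; apply: pr_le => //.
  by apply: leq_trans (ltnW vF) _; exact: leq_pr.
- by move=> a v aka vF; rewrite inW //; apply: small => //; exact: kaQ2.
- by move=> a v aka vF; rewrite inW //; apply: small => //; exact: kaQ2.
- move=> a t v aka tY vF; rewrite inW //; apply: small => //.
  by apply: pr_le; [exact: kaQ' | exact: leq_trans (ltnW tY) YQ].
- move=> a t v aka tY vG; rewrite inW //; apply: leq_ltn_trans room_labels.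
  apply: pr_le => //; apply: pr_le; first exact: kaQ'.
  by apply: pr_le; [exact: leq_trans (ltnW tY) YQ | exact: leq_trans (ltnW vG) GQ].
Qed.
End Diagonal.

Lemma fact_bound_le a b : a <= b -> fact_bound a <= fact_bound b.
Proof. by move=> ab; rewrite /fact_bound ltnS; do !(apply: pr_le => //). Qed.

Ltac poly_funT := move=> ? ?; cbv beta delta [parameters]; repeat first [ eassumption
  | simple apply term_const | simple apply term_succ | simple apply term_pr
  | simple apply term_add | simple apply term_mul | simple apply term_exp
  | simple apply term_fact_bound ].

Definition diagonal_room (Q : nat) : nat :=
  let V := (parameters Q Q Q Q Q Q Q Q Q).+1 in
  (V + pr 0 (pr V.+1 V) + pr 4 (pr (pr Q Q) (fact_bound (Q * 4))) + pr 5 (pr Q (pr Q Q))).+1.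

(** [diagonal_room] is polynomial, say of degree [K]; with [s = n %/ (2 * K.+1)], the power
    [(2 ^ (2 * s)) ^ K] is below [2 ^ n]. *)
Lemma diagonal_room_growth : exists K, forall n, 0 < n %/ (2 * K.+1) ->
  diagonal_room (2 ^ (2 * (n %/ (2 * K.+1)))) <= 2 ^ n.
Proof.
have [K hK] : exists K, forall n, 2 <= n -> diagonal_room n <= n ^ K.
  by apply: polynomial_growth; rewrite /diagonal_room; poly_funT.
exists K => n; set s := n %/ _ => s0.
apply: (leq_trans (hK _ _)); first by rewrite -{1}[2]expn1 leq_exp2l //; lia.
rewrite -expnM leq_exp2l //.
have : s * (2 * K.+1) <= n by exact: leq_divM.
by nia.
Qed.

Theorem theorem6 (R : realType) (B : language)
    (hB : ((NP `&` coNP) `&` NEXPD R) B) (g : nat -> nat)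
    (hg : well_sub_polynomial R g) :
  ~ (NEXP `<=` NP_T (P_T g NP `&` power_set B)).
Proof.
move=> sub; have [[[cB _ [MB tB]] _] sparse] := hB; have [subg _ _] := hg.
have [pS hpS] := def_census.
(* The supposed inclusion is used twice: on S, to place its padded complement T in NEXP, and then on
   T, to obtain the machines to be simulated. *)
have [k [pT [k0 tower]]] : exists k p, 0 < k /\ forall x n, 2 <= n -> size x = n ^ k ->
    (guessed_language p x <-> ~ guessed_language pS (take n x)).
  apply: (@tower_exists g); have [A [PA _] NA] := sub _ (guessed_NEXP pS).
  by exists A.
have [A [[D [cD _ [MD tD]] [M1 [c1 [det t1 atmost]]]] AB] [M0 [c0 t0]]] := sub _ (guessed_NEXP pT).
set T := guessed_language pT in t0.
have [a0 b0] := time_polynomial t0; have [a1 b1] := time_polynomial t1.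
have [aD bD] := time_polynomial tD; have [aB bB] := time_polynomial tB.
pose u n := a0 * n.+1 ^ c0 + a1 * n.+1 ^ c1 + aD * n.+1 ^ cD + aB * n.+1 ^ cB.
have dec0 : decides M0 A T u.
  by split=> [x|x s /b0 h]; [exact: t0.1 | apply: (leq_trans h); rewrite /u; do 4!move: (_ * _) => ?; lia].
have dec1 : decides M1 D A u.
  by split=> [x|x s /b1 h]; [exact: t1.1 | apply: (leq_trans h); rewrite /u; do 4!move: (_ * _) => ?; lia].
have decD : decides (plain MD) set0 D u.
  split=> [x|x s h]; first exact: tD.1.
  by apply: (leq_trans (bD x s h)); rewrite /u; do 4!move: (_ * _) => ?; lia.
have decB : decides (plain MB) set0 B u.
  split=> [x|x s h]; first exact: tB.1.
  by apply: (leq_trans (bB x s h)); rewrite /u; do 4!move: (_ * _) => ?; lia.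
have mono a b : a <= b -> u a <= u b.
  have e c : a <= b -> a.+1 ^ c <= b.+1 ^ c by case: c => // c ab; rewrite leq_exp2r.
  by move=> ab; rewrite /u !leq_add // leq_mul // e.
pose C := #|state M0| + #|{: rule M0}| + (last_tape M0).+1 +
  (#|state M1| + #|{: rule M1}| + (last_tape M1).+1) +
  (#|state (plain MD)| + #|{: rule (plain MD)}| + (last_tape (plain MD)).+1) +
  (#|state (plain MB)| + #|{: rule (plain MB)}| + (last_tape (plain MB)).+1) + 3 +
  (machine_number M0 + machine_number M1 + machine_number (plain MD) + machine_number (plain MB)).
(* On padded inputs, of length [n ^ k], [M0] takes at most [u (n ^ k)] steps, so [m n] bounds its
   queries. Likewise [y n] bounds the runs on these queries and on those of [M1], as well as the
   sizes and numbers of the machines. *)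
pose m n := (n + n ^ k + u (n ^ k)).+2.
pose y n := (m n + u (m n + u (m n)).+1 + C + n).+1.
have [d hd] : exists d, forall n, 2 <= n -> m n <= n ^ d.
  by apply: polynomial_growth; rewrite /m /u; poly_funT.
have [j hj] : exists j, forall n, 2 <= n -> y n <= n ^ j.
  by apply: polynomial_growth; rewrite /y /m /u; poly_funT.
have [K room] := diagonal_room_growth.
set r := 2 * K.+1 in room; have r0 : 0 < r by [].
have [n0 h0] := poly_le_exp_div j r0.
have [n nb [gm Bm]] := sparse_length (n0 + r + 2) sparse subg r0
  (fun n => leq_trans (leq_addr _ _) (leq_trans (leq_addr _ _) (leqW (leqnSn _))) : n <= m n) hd.
have n2 : 2 <= n by lia.
set s := n %/ r in gm Bm room.
have s0 : 0 < s by rewrite divn_gt0 //; lia.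
have ys : y n <= 2 ^ s by apply: (leq_trans (hj n n2)); apply: h0; lia.
have sn : s <= n by exact: leq_div.
set ka := #|@valid_entry M1 MB MD (m n) (y n) s|.
pose Q := 2 ^ (2 * s).
have yQ : y n <= Q by apply: (leq_trans ys); rewrite leq_exp2l //; lia.
have kaQ : ka <= Q.
  (* One factor [2 ^ s] counts the words of B, the other the patterns on each word. *)
  rewrite /Q mul2n -addnn expnD.
  apply: (@leq_trans (#|[pred w : (m n).-bseq bool | `[< B w >]]| * 2 ^ s)).
    apply: card_valid_entry => // e /asboolP[_ acc _].
    by apply/asboolP; exact: accepts_within_sound decB acc.
  rewrite leq_mul2r; apply/orP; right; apply: leq_trans Bm.
  by apply: card_upto => w /asboolP.
have {}room := room n s0; rewrite -/s -/Q /diagonal_room in room.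
pose V := (parameters Q Q Q Q Q Q Q Q Q).+1.
rewrite -/V in room.
pose pi := parameters (machine_number M0) (machine_number M1) (machine_number (plain MD))
  (machine_number (plain MB)) (n ^ k) (y n) (m n) s ka.
have yC : C + m n + n < y n by rewrite /y; lia.
have piV : pi < V.
  rewrite ltnS /pi /parameters; rewrite /C in yC.
  by do 8!(apply: pr_le; first by rewrite ?/m in yC yQ *; lia).
pose x := mkseq (nbit pi) n.
pose xx := x ++ nseq (n ^ k - n) false.
have sx : size x = n by rewrite size_mkseq.
have nk : n <= n ^ k by rewrite -{1}[n]expn1 leq_pexp2l //; lia.
have sxx : size xx = n ^ k by rewrite size_cat sx size_nseq subnKC.
(* The padding consists of the default value of [nth], so S reads the padded input of [M0] directly
   from the bits of [x]. *)
have xxE : nth false xx = nth false x.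
  apply/funext => i; rewrite nth_cat sx nth_nseq.
  by case: ltnP => // ni; rewrite nth_default ?sx // if_same.
have Tx := tower xx n n2 sxx; rewrite take_size_cat // in Tx.
have Sx : guessed_language pS x <-> T xx.
  have ZQ : fact_bound (y n * 4) <= fact_bound (Q * 4) by apply: fact_bound_le; rewrite leq_mul2r yQ.
  have bigs : [/\ big_enough M0 (y n * 4), big_enough M1 (y n * 4),
      big_enough (plain MB) (y n * 4) & big_enough (plain MD) (y n * 4)].
    by rewrite /C in yC; split; split; lia.
  have [big0 big1 bigB bigD] := bigs.
  have sQ : s <= Q by lia.
  apply: (@diagonal_input M0 M1 MB MD T A B D u g dec0 dec1 decB decD det atmost mono AB
    xx (y n) (m n) s n V Q) => //.
  - by rewrite sxx /m; lia.
  - by lia.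
  - by rewrite /y; lia.
  - by rewrite sxx.
  - by lia.
  - by lia.
  - apply: leq_ltn_trans (_ : pr 4 (pr (pr Q Q) (fact_bound (Q * 4))) < 2 ^ n); last by lia.
    by do !(apply: pr_le => //).
  - by lia.
  - by rewrite sxx.
by have nT : ~ T xx; [move=> t; exact: Tx.1 t (Sx.2 t) | apply: (nT); apply/Tx => /Sx].
Qed.
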